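(* Let $\varphi:\mathbb D\to\mathbb D$ be analytic. Let $\sigma:[0,1)\to(0,\infty)$ be continuous and integrable such that $\omega_\sigma(r)=\int_r^1(t-r)\sigma(t)\,dt$ is (I)-admissible. (i) If $C_\varphi$ is compact on the Hardy space $H^2$, then $C_\varphi$ is compact on $\mathcal A^2_\sigma(\mathbb D)$. (ii) If $C_\varphi$ is compact on $\mathcal A^2_\sigma(\mathbb D)$, then $C_\varphi$ is compact on the Bergman space $\mathcal A^2_0(\mathbb D)$; consequently $\displaystyle\lim_{|z|\to1^-}\frac{1-|\varphi(z)|}{1-|z|}=\infty$.
   Context: $\mathbb D$ is the open unit disc, $dA=dx\,dy/\pi$, $C_\varphi f=f\circ\varphi$. $\mathcal A^2_\sigma(\mathbb D)$ is the space of analytic $f$ on $\mathbb D$ with $\int_{\mathbb D}|f(z)|^2\sigma(|z|)\,dA(z)<\infty$; $\mathcal A^2_0(\mathbb D)$ is the case $\sigma\equiv1$. A positive integrable $\omega\in C^2[0,1)$ is (I)-admissible if: (W1) $\omega$ non-increasing; (W2) there is $\delta>0$ with $r\mapsto\omega(r)(1-r)^{-(1+\delta)}$ non-decreasing on $[0,1)$; (W3) $\lim_{r\to1^-}\omega(r)=0$; (W4(I)) $\omega$ convex and $\lim_{r\to1^-}\omega'(r)=0$. *)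

(* Defs.v *)
From HB Require Import structures.
From mathcomp Require Import all_boot all_order all_algebra.
From mathcomp Require Import all_classical all_reals all_analysis.
From mathcomp Require Import complex.
Import Order.TTheory GRing.Theory Num.Theory.
Import numFieldNormedType.Exports.

Set Implicit Arguments.
Unset Strict Implicit.
Unset Printing Implicit Defensive.

Local Open Scope classical_set_scope.
Local Open Scope ring_scope.

Section Defs.
Variable R : realType.
Local Notation C := (R[i]).

Definition cabs (z : C) : R := Num.sqrt (complex.Re z ^+ 2 + complex.Im z ^+ 2).

Definition cpt (x y : R) : C := Complex x y.

(* complex differentiability at z (derivative along the complex scalar 1) *)
Definition cholo (f : C -> C) (z : C) : Prop := derivable (f : C^o -> C^o) z 1.

Definition analytic_disc (f : C -> C) : Prop :=
  forall z : C, cabs z < 1 -> cholo f z.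

Definition analytic_selfmap (phi : C -> C) : Prop :=
  analytic_disc phi /\ forall z : C, cabs z < 1 -> cabs (phi z) < 1.

Definition hardy_sq (f : C -> C) : \bar R :=
  ereal_sup [set (((2 * pi)^-1)%:E *
      \int[lebesgue_measure]_(t in `[0%R, (2 * pi)%R]%classic)
         ((cabs (f (cpt (r * cos t) (r * sin t)))) ^+ 2)%:E)%E
    | r in `[0%R, 1%R[%classic ].

Definition hardy_space (f : C -> C) : Prop :=
  analytic_disc f /\ (hardy_sq f < +oo)%E.

Definition disc2 : set (R * R) := [set p | p.1 ^+ 2 + p.2 ^+ 2 < 1].

Definition bergman_sq (sigma : R -> R) (f : C -> C) : \bar R :=
  (pi^-1)%:E *
  \int[(lebesgue_measure \x lebesgue_measure)%E]_(p in disc2)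
     ((cabs (f (cpt p.1 p.2))) ^+ 2 * sigma (Num.sqrt (p.1 ^+ 2 + p.2 ^+ 2)))%:E.

Definition bergman_space (sigma : R -> R) (f : C -> C) : Prop :=
  analytic_disc f /\ (bergman_sq sigma f < +oo)%E.

Definition comp_compact (X : (C -> C) -> Prop) (nsq : (C -> C) -> \bar R)
    (phi : C -> C) : Prop :=
  (forall f, X f -> X (f \o phi)) /\
  forall (u : nat -> C -> C) (M : R),
    (forall n, X (u n)) -> (forall n, (nsq (u n) <= M%:E)%E) ->
    exists (s : nat -> nat) (g : C -> C),
      {homo s : m n / (m < n)%N >-> (m < n)%N} /\ X g /\
      (nsq (fun z => u (s k) (phi z) - g z) @[k --> \oo] --> 0%E).

Definition C2_01 (w : R -> R) : Prop :=
  exists w1 w2 : R -> R,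
    (forall r : R, 0 < r < 1 -> is_derive r 1 w (w1 r) /\ is_derive r 1 w1 (w2 r)) /\
    {within `[0, 1[%classic, continuous w} /\
    {within `[0, 1[%classic, continuous w1} /\
    {within `[0, 1[%classic, continuous w2}.

Definition I_admissible (w : R -> R) : Prop :=
  (forall r : R, 0 <= r < 1 -> 0 < w r) /\
  lebesgue_measure.-integrable `[0, 1[%classic (EFin \o w) /\
  C2_01 w /\
  (forall r s : R, 0 <= r -> r <= s -> s < 1 -> w s <= w r) /\
  (exists delta : R, 0 < delta /\
     forall r s, 0 <= r -> r <= s -> s < 1 ->
       w r * (1 - r) `^ (- (1 + delta)) <= w s * (1 - s) `^ (- (1 + delta))) /\
  (w x @[x --> 1^'-] --> 0) /\
  (forall x y t : R, 0 <= x < 1 -> 0 <= y < 1 -> 0 <= t <= 1 ->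
     w (t * x + (1 - t) * y) <= t * w x + (1 - t) * w y) /\
  (derive1 w x @[x --> 1^'-] --> 0).

Definition omega_sigma (sigma : R -> R) (r : R) : R :=
  fine (\int[lebesgue_measure]_(t in `[r, 1%R[%classic) ((t - r) * sigma t)%:E)%E.

End Defs.

(* Main.v *)
(* Everything is read off Taylor coefficients. By Parseval, [H^2] and the weighted Bergman spaces
   are weighted [l^2] spaces, with weights [1] and [beta n = 2 \int_0^1 r^(2n+1) sigma r dr], and
   compactness of [C_phi] on the space with weights [beta] says that the operator norm of [C_phi]
   on polynomials with a zero of order [N] at [0] tends to [0] (this is [star beta phi]).
   Condition (W2) bounds [beta n] by a constant times [beta (2 n)]. With this doubling property,
   [star] applied to tails of reproducing kernels gives [|phi z| <= |z|^j] near the unit circle for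
   every [j] (this is [angular phi]), hence the limit in (ii).
   By Littlewood subordination, [angular] bounds the mean of [|f o phi|^2] on the circle of radius
   [r] by that of [|f|^2] on the circle of radius [r^j]; integrating against [2 r dr] gives [star]
   for the unweighted Bergman space. With [j = 2] and a fixed [r] it bounds [C_phi] on tails in the
   [l^2] space with weights [r^(2n)]; interpolating with the weights [1] of [H^2], for which [star]
   is the hypothesis of (i), one reaches every doubling weight. *)

Require Import Defs.
From HB Require Import structures.
From mathcomp Require Import all_boot all_order all_algebra.
From mathcomp Require Import all_classical all_reals all_analysis.
From mathcomp Require Import measurable_realfun complex.
From mathcomp Require Import ring lra zify.
Import Order.TTheory GRing.Theory Num.Theory.
Import numFieldNormedType.Exports.
Local Open Scope classical_set_scope.
Local Open Scope ring_scope.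
Set Implicit Arguments.
Unset Strict Implicit.
Unset Printing Implicit Defensive.

(** [analytic_disc] asks only for complex differentiability, so Taylor expansions have to come from
    Goursat's theorem. It is applied in the coordinates of z = exp (s + i t), where concentric
    circles become parallel sides of a rectangle; every contour integral is then a mean over a
    circle. In (i) a doubling weight need not lie between the weights 1 and th^n in any direct
    sense. But a decreasing weight is the sum of its decrements times the indicators of n <= m, and
    the indicator can be replaced by th^n / (th^n + th^m), the weight which optimal splitting
    between 1 and th^(n-m) produces. This weight is at least 1/2 where the indicator is 1, and the
    excess it adds for m < n is of order beta m * th^(n-m); doubling controls it for m near n, and
    the slow decay of the weight controls it for small m. In (ii) the smallness has another source:
    for the unweighted Bergman space, the exponent j of [angular] replaces 1 / (n+1) by 1 / (j n +
    1), a gain of order 1 / j. *)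

Section ComplexBasics.
Variable R : realType.
Local Notation C := (R[i]).
Implicit Types (z w : C) (x y : R).

Lemma cabsE z : cabs z = complex.Re `|z|.
Proof. by rewrite normc_def. Qed.

Lemma cabsC z : (cabs z)%:C%C = `|z|.
Proof. by rewrite normc_def. Qed.

Lemma cabs_ge0 z : 0 <= cabs z.
Proof. exact: sqrtr_ge0. Qed.

Lemma cabs0 : cabs (0 : C) = 0.
Proof. by rewrite cabsE normr0. Qed.

Lemma cabs1 : cabs (1 : C) = 1.
Proof. by rewrite cabsE normr1. Qed.

Lemma cabs_eq0 z : (cabs z == 0) = (z == 0).
Proof. by rewrite -(inj_eq (@complexI _)) cabsC normr_eq0. Qed.

Lemma cabs_gt0 z : (0 < cabs z) = (z != 0).
Proof. by rewrite lt_def cabs_ge0 cabs_eq0 andbT. Qed.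

Lemma cabsM z w : cabs (z * w) = cabs z * cabs w.
Proof. by apply: (@complexI R); rewrite (rmorphM (real_complex R)) /= !cabsC normrM. Qed.

Lemma cabsV z : cabs z^-1 = (cabs z)^-1.
Proof. by apply: (@complexI R); rewrite (fmorphV (real_complex R)) /= !cabsC normfV. Qed.

Lemma cabsX z n : cabs (z ^+ n) = cabs z ^+ n.
Proof. by apply: (@complexI R); rewrite (rmorphXn (real_complex R)) /= !cabsC normrX. Qed.

Lemma cabsN z : cabs (- z) = cabs z.
Proof. by rewrite !cabsE normrN. Qed.

Lemma cabsB z w : cabs (z - w) = cabs (w - z).
Proof. by rewrite -cabsN opprB. Qed.

Lemma ler_cabsD z w : cabs (z + w) <= cabs z + cabs w.
Proof. by rewrite -lecR (rmorphD (real_complex R)) /= !cabsC ler_normD. Qed.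

Lemma ler_cabsB z w : cabs (z - w) <= cabs z + cabs w.
Proof. by rewrite -(cabsN w) ler_cabsD. Qed.

Lemma ler_cabs_dist z w : cabs z <= cabs w + cabs (z - w).
Proof. by rewrite -{1}(subrK w z) addrC ler_cabsD. Qed.

Lemma ler_cabs_sum (I : Type) (s : seq I) (P : pred I) (F : I -> C) :
  cabs (\sum_(i <- s | P i) F i) <= \sum_(i <- s | P i) cabs (F i).
Proof.
elim/big_rec2 : _ => [|i x w Pi le_wx]; first by rewrite cabs0.
by rewrite (le_trans (ler_cabsD _ _))// lerD2l.
Qed.

Lemma cabs_real x : cabs x%:C%C = `|x|.
Proof. by rewrite /cabs /= expr0n addr0 sqrtr_sqr. Qed.

Lemma cabs_nat n : cabs (n%:R : C) = n%:R.
Proof. by rewrite -(rmorph_nat (real_complex R)) cabs_real ger0_norm. Qed.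

Lemma cabsJ z : cabs (z^*)%C = cabs z.
Proof. by rewrite !cabsE normcJ. Qed.

Lemma ler_Re_cabs z : `|complex.Re z| <= cabs z.
Proof. by rewrite -sqrtr_sqr ler_wsqrtr// lerDl sqr_ge0. Qed.

Lemma ler_Im_cabs z : `|complex.Im z| <= cabs z.
Proof. by rewrite -sqrtr_sqr ler_wsqrtr// lerDr sqr_ge0. Qed.

Lemma cabs_sqr z : cabs z ^+ 2 = complex.Re z ^+ 2 + complex.Im z ^+ 2.
Proof. by rewrite sqr_sqrtr// addr_ge0// sqr_ge0. Qed.

Lemma cabs_le_ReIm z : cabs z <= `|complex.Re z| + `|complex.Im z|.
Proof.
rewrite -(ler_pXn2r (n:=2)) ?nnegrE ?addr_ge0 ?cabs_ge0//.
rewrite cabs_sqr -(real_normK (num_real (complex.Re z))).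
rewrite -(real_normK (num_real (complex.Im z))) sqrrD lerD2r lerDl.
by rewrite mulrn_wge0// mulr_ge0.
Qed.

Lemma cReD z w : complex.Re (z + w) = complex.Re z + complex.Re w.
Proof. by case: z w => [? ?] []. Qed.

Lemma cImD z w : complex.Im (z + w) = complex.Im z + complex.Im w.
Proof. by case: z w => [? ?] []. Qed.

Lemma cReB z w : complex.Re (z - w) = complex.Re z - complex.Re w.
Proof. by case: z w => [? ?] []. Qed.

Lemma cImB z w : complex.Im (z - w) = complex.Im z - complex.Im w.
Proof. by case: z w => [? ?] []. Qed.

Lemma cReM z w : complex.Re (z * w) =
  complex.Re z * complex.Re w - complex.Im z * complex.Im w.
Proof. by case: z w => [? ?] []. Qed.

Lemma cImM z w : complex.Im (z * w) =
  complex.Re z * complex.Im w + complex.Im z * complex.Re w.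
Proof. by case: z w => [? ?] []. Qed.

Lemma cabs_sqrD z w : cabs (z + w) ^+ 2 =
  cabs z ^+ 2 + cabs w ^+ 2 + 2 * complex.Re (z * (w^*)%C).
Proof. by case: z w => [a b] [c d]; rewrite !cabs_sqr /=; ring. Qed.

Lemma mul_conj_cabs z : z * (z^*)%C = ((cabs z) ^+ 2)%:C%C.
Proof. by rewrite -sqr_normc -cabsC (rmorphXn (real_complex R)). Qed.

Definition cdiff (f : C -> C) z d := forall e, 0 < e -> exists2 dl : R, 0 < dl &
  forall w, cabs (w - z) < dl -> cabs (f w - f z - d * (w - z)) <= e * cabs (w - z).

Lemma choloP f z : cholo f z <-> exists d, cdiff f z d.
Proof.
split.
  move=> /cvg_ex [d]/= Hd; exists d => e e0.
  have /cvgrPdist_le/= /(_ e%:C%C) := Hd.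
  rewrite ltcR => /(_ e0) /= [dl /= dl0 Hdl].
  (* Radii of balls in the normed field are themselves complex; a positive one is real, and
     [complex.Re dl] is the radius wanted. *)
  have rdl : dl \is Num.real by rewrite realE ltW.
  have Edl : dl = (complex.Re dl)%:C%C by rewrite RRe_real.
  exists (complex.Re dl); first by rewrite -ltcR -Edl.
  move=> w; rewrite -ltcR cabsC -Edl => wz.
  have [->|wz0] := eqVneq w z.
    by rewrite !subrr mulr0 subrr cabs0 mulr0.
  have := Hdl (w - z); rewrite /= sub0r normrN => /(_ wz).
  rewrite subr_eq0 => /(_ wz0); rewrite /GRing.scale /=.
  rewrite mulr1 subrK -cabsC lecR => H.
  have -> : f w - f z - d * (w - z) = - (d - (w - z)^-1 * (f w - f z)) * (w - z).
    by rewrite mulNr mulrBl [_^-1 * _]mulrC divfK ?subr_eq0//; ring.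
  by rewrite cabsM cabsN ler_wpM2r// cabs_ge0.
move=> [d Hd]; apply/cvg_ex; exists d => /=.
apply/cvgrPdist_le => /= e e0.
have re : e \is Num.real by rewrite realE ltW.
have Ee : e = (complex.Re e)%:C%C by rewrite RRe_real.
have e0' : 0 < complex.Re e by rewrite -ltcR -Ee.
have [dl dl0 H] := Hd _ e0'.
exists dl%:C%C => /=; first by rewrite ltcR.
move=> h /=; rewrite sub0r normrN -cabsC ltcR => hd h0.
rewrite /GRing.scale /= mulr1 Ee -cabsC lecR.
have := H (h + z); rewrite addrK => /(_ hd).
have -> : f (h + z) - f z - d * h = - (d - h^-1 * (f (h + z) - f z)) * h.
  by rewrite mulNr mulrBl [_^-1 * _]mulrC divfK//; ring.
by rewrite cabsM cabsN ler_pM2r// cabs_gt0.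
Qed.

End ComplexBasics.

(** * Rules for complex derivatives; geometric series *)

Section PowerSeries.
Variable R : realType.
Local Notation C := (R[i]).
Implicit Types (z w : C) (x y : R) (f g : C -> C) (a b : nat -> C).

Lemma cholo_cst (c : C) z : cholo (fun=> c) z.
Proof. by apply/choloP; exists 0 => e e0; exists 1 => // w _; rewrite subrr mul0r subrr cabs0 mulr_ge0 ?cabs_ge0 ?ltW. Qed.

Lemma cholo_id z : cholo id z.
Proof. by apply/choloP; exists 1 => e e0; exists 1 => // w _; rewrite mul1r subrr cabs0 mulr_ge0 ?cabs_ge0 ?ltW. Qed.

Lemma choloD f g z : cholo f z -> cholo g z -> cholo (fun w => f w + g w) z.
Proof. exact: (@derivableD _ _ _ (f : C^o -> C^o) g). Qed.

Lemma choloB f g z : cholo f z -> cholo g z -> cholo (fun w => f w - g w) z.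
Proof. exact: (@derivableB _ _ _ (f : C^o -> C^o) g). Qed.

Lemma choloM f g z : cholo f z -> cholo g z -> cholo (fun w => f w * g w) z.
Proof. exact: (@derivableM _ _ (f : C^o -> C^o) g). Qed.

Lemma choloV f z : f z != 0 -> cholo f z -> cholo (fun w => (f w)^-1) z.
Proof. exact: (@derivableV _ _ (f : C^o -> C^o)). Qed.

Lemma choloX f n z : cholo f z -> cholo (fun w => f w ^+ n) z.
Proof.
move=> Hf; elim: n => [|n IH].
  by under eq_fun do rewrite expr0; exact: cholo_cst.
by under eq_fun do rewrite exprS; exact: (@choloM f (fun w => f w ^+ n)).
Qed.

Lemma cholo_sum n (F : nat -> C -> C) z : (forall i, cholo (F i) z) ->
  cholo (fun w => \sum_(i < n) F i w) z.
Proof.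
move=> HF; elim: n => [|n IH].
  by under eq_fun do rewrite big_ord0; exact: cholo_cst.
have -> : (fun w => \sum_(i < n.+1) F i w) =
    (fun w => (\sum_(i < n) F i w) + F n w).
  by apply/funext => w; rewrite big_ord_recr.
exact: choloD IH (HF n).
Qed.

Lemma cholo_near f g z (dl : R) : 0 < dl ->
  (forall w, cabs (w - z) < dl -> f w = g w) -> cholo f z -> cholo g z.
Proof.
move=> dl0 fg /choloP [d Hd]; apply/choloP; exists d => e e0.
have [dl' dl'0 H] := Hd e e0.
exists (Num.min dl dl') => [|w]; first by rewrite lt_min dl0.
by rewrite lt_min => /andP[? ?]; rewrite -!fg ?H// subrr cabs0.
Qed.

Lemma cdiff_lip f z d : cdiff f z d -> exists2 dl : R, 0 < dl &
  forall w, cabs (w - z) < dl -> cabs (f w - f z) <= (1 + cabs d) * cabs (w - z).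
Proof.
move=> Hd; have [dl dl0 H] := Hd 1 ltr01; exists dl => // w /H wd.
rewrite -[f w - f z](subrK (d * (w - z))) (le_trans (ler_cabsD _ _))//.
by rewrite cabsM mulrDl lerD2r.
Qed.

Lemma cholo_cont f z : cholo f z -> forall e : R, 0 < e -> exists2 dl : R, 0 < dl &
  forall w, cabs (w - z) < dl -> cabs (f w - f z) < e.
Proof.
move=> /choloP [d Hd] e e0; have [dl dl0 H] := cdiff_lip Hd.
have k0 : 0 < 1 + cabs d by rewrite ltr_wpDr// cabs_ge0.
exists (Num.min dl (e / (1 + cabs d))) => [|w].
  by rewrite lt_min dl0 divr_gt0.
by rewrite lt_min ltr_pdivlMr// mulrC => /andP[/H wd]; apply: le_lt_trans.
Qed.

Lemma cholo_comp f g z : cholo f z -> cholo g (f z) -> cholo (g \o f) z.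
Proof.
move=> Hf /choloP [d2 H2]; have /choloP [d1 H1] := Hf.
apply/choloP; exists (d2 * d1) => e e0.
have k1 : 0 < 1 + cabs d1 by rewrite ltr_wpDr// cabs_ge0.
have k2 : 0 < 1 + cabs d2 by rewrite ltr_wpDr// cabs_ge0.
have [l1 l10 L1] := H1 (e / 2 / (1 + cabs d2)) ltac:(by rewrite !divr_gt0).
have [l2 l20 L2] := H2 (e / 2 / (1 + cabs d1)) ltac:(by rewrite !divr_gt0).
have [l3 l30 L3] := cdiff_lip H1.
have [l4 l40 L4] := cholo_cont Hf l20.
exists (Num.min l1 (Num.min l3 l4)) => [|w]; first by rewrite !lt_min l10 l30.
rewrite !lt_min /= => /and3P[/L1 w1 /L3 w3 /L4/L2 w2].
have -> : g (f w) - g (f z) - d2 * d1 * (w - z) =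
  (g (f w) - g (f z) - d2 * (f w - f z)) + d2 * (f w - f z - d1 * (w - z)) by ring.
rewrite (le_trans (ler_cabsD _ _))// [e in leRHS]splitr mulrDl lerD//.
  have c0 : 0 <= e / 2 / (1 + cabs d1) by rewrite ltW// !divr_gt0.
  by rewrite (le_trans w2)// (le_trans (ler_wpM2l c0 w3))// mulrA divfK ?gt_eqF.
rewrite cabsM (le_trans (ler_wpM2l (cabs_ge0 _) w1))// mulrA ler_wpM2r ?cabs_ge0//.
rewrite mulrCA ger_pMr ?divr_gt0// ler_pdivrMr// mul1r lerDr.
by [].
Qed.

Lemma geo_sum_le x m n : 0 <= x < 1 -> \sum_(m <= i < n) x ^+ i <= x ^+ m / (1 - x).
Proof.
move=> /andP[x0 x1]; have x1' : 0 < 1 - x by rewrite subr_gt0.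
have [mn|nm] := leqP m n; last first.
  by rewrite big_geq ?mulr_ge0 ?exprn_ge0 ?invr_ge0 ?(ltW x1')// ltnW.
rewrite ler_pdivlMr//.
suff -> : (\sum_(m <= i < n) x ^+ i) * (1 - x) = x ^+ m - x ^+ n.
  by rewrite gerBl exprn_ge0.
rewrite mulrC -[RHS]opprB -(telescope_sumr (fun k => x ^+ k) mn) -sumrN mulr_sumr.
by apply: eq_bigr => i _; rewrite exprS; ring.
Qed.

Lemma expr_small x e : 0 <= x < 1 -> 0 < e ->
  exists N, forall n, (N <= n)%N -> x ^+ n < e.
Proof.
move=> /andP[x0 x1] e0.
have /cvgrPdist_lt/(_ e e0)[N _ H] := @cvg_expr _ x ltac:(by rewrite ger0_norm).
exists N => n Nn; have := H n Nn; rewrite /= sub0r normrN ger0_norm//.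
by rewrite exprn_ge0.
Qed.

Lemma geo_series (c : nat -> C) K y : 0 <= y < 1 ->
  (forall n, cabs (c n) <= K * y ^+ n) ->
  exists S : C, forall J, cabs (S - \sum_(n < J) c n) <= K * (y ^+ J / (1 - y)).
Proof.
move=> y01 Hc; have /andP[y0 y1] := y01.
have K0 : 0 <= K by have := Hc 0%N; rewrite expr0 mulr1; apply/le_trans/cabs_ge0.
have real_case (u : nat -> R) : (forall n, `|u n| <= K * y ^+ n) ->
    exists s : R, series u @ \oo --> s.
  move=> Hu; exists (limn (series u)); apply: normed_cvg.
  apply: (@series_le_cvg _ _ (geometric K y)).
  - by move=> n /=.
  - by move=> n; apply: mulr_ge0 => //; exact: exprn_ge0.
  - exact: Hu.
  - by apply: is_cvg_geometric_series; rewrite ger0_norm.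
have [s1 H1] := real_case (fun n => complex.Re (c n))
  (fun n => le_trans (ler_Re_cabs _) (Hc n)).
have [s2 H2] := real_case (fun n => complex.Im (c n))
  (fun n => le_trans (ler_Im_cabs _) (Hc n)).
have tail J J' : (J <= J')%N ->
    cabs (\sum_(n < J') c n - \sum_(n < J) c n) <= K * (y ^+ J / (1 - y)).
  move=> JJ'; rewrite -!(big_mkord xpredT c) (big_cat_nat (leq0n J) JJ')//= addrAC subrr add0r.
  rewrite (le_trans (ler_cabs_sum _ _ _))//.
  rewrite (le_trans (ler_sum_nat (fun i _ => Hc i)))//.
  by rewrite -mulr_sumr ler_wpM2l// geo_sum_le.
exists (Complex s1 s2) => J; apply/ler_addgt0Pr => e e0.
have e2 : 0 < e / 2 by rewrite divr_gt0.
have [N1 _ HN1] := (@cvgrPdist_lt _ _ _ _ _ _ _).1 H1 _ e2.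
have [N2 _ HN2] := (@cvgrPdist_lt _ _ _ _ _ _ _).1 H2 _ e2.
pose J' := maxn J (maxn N1 N2).
have {}HN1 := HN1 J' ltac:(by rewrite /J' /= !leq_max leqnn ?orbT).
have {}HN2 := HN2 J' ltac:(by rewrite /J' /= !leq_max leqnn ?orbT).
have -> : Complex s1 s2 - \sum_(n < J) c n =
  (\sum_(n < J') c n - \sum_(n < J) c n) + (Complex s1 s2 - \sum_(n < J') c n).
  by ring.
rewrite (le_trans (ler_cabsD _ _))// lerD ?tail ?leq_maxl//.
rewrite (le_trans (cabs_le_ReIm _))// cReB cImB /= (splitr e) lerD// ltW//.
  move: HN1; rewrite /series /= big_mkord.
  by rewrite (big_morph _ (@cReD R) (erefl : complex.Re (0 : C) = 0)).
move: HN2; rewrite /series /= big_mkord.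
by rewrite (big_morph _ (@cImD R) (erefl : complex.Im (0 : C) = 0)).
Qed.

End PowerSeries.

(** * Power series on the unit disc *)

Section Coefficients.
Variable R : realType.
Local Notation C := (R[i]).
Implicit Types (z w : C) (x y r : R) (f g : C -> C) (a b : nat -> C).

(** Only pointwise convergence on the disc is required; [coefs_tail] recovers a geometric rate on
    smaller discs. Values of [f] off the disc are unconstrained. *)
Definition coefs f a := forall z, cabs z < 1 -> forall e, 0 < e ->
  exists J0, forall J, (J0 <= J)%N -> cabs (f z - \sum_(n < J) a n * z ^+ n) <= e.

(** Radius of convergence at least 1, without a limit superior. *)
Definition disc_bounded a := forall r, 0 <= r < 1 ->
  exists2 K, 0 <= K & forall n, cabs (a n) * r ^+ n <= K.

Lemma coefs_bounded f a : coefs f a -> disc_bounded a.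
Proof.
move=> fa r /andP[r0 r1].
have [] := fa r%:C%C _ 1 ltr01; first by rewrite cabs_real ger0_norm.
move=> J0 HJ; exists (2 + \sum_(n < J0) cabs (a n) * r ^+ n).
  by rewrite addr_ge0// sumr_ge0// => i _; rewrite mulr_ge0 ?cabs_ge0 ?exprn_ge0.
move=> n; have t0 (k : nat) : 0 <= cabs (a k) * r ^+ k.
  by rewrite mulr_ge0 ?cabs_ge0 ?exprn_ge0.
have [nJ|Jn] := ltnP n J0.
  rewrite (bigD1 (Ordinal nJ))//= addrCA lerDl addr_ge0// sumr_ge0//.
rewrite (@le_trans _ _ 2)//; last by rewrite lerDl sumr_ge0.
have := HJ n.+1 (leqW Jn); have := HJ n Jn; rewrite big_ord_recr /=.
set S := \sum_(i < n) _; move=> H1 H2.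
have -> : cabs (a n) * r ^+ n = cabs (a n * r%:C%C ^+ n).
  by rewrite cabsM cabsX cabs_real ger0_norm.
have -> : a n * r%:C%C ^+ n = (f r%:C%C - S) - (f r%:C%C - (S + a n * r%:C%C ^+ n)).
  by ring.
by rewrite (le_trans (ler_cabsB _ _))// (lerD H1 H2).
Qed.

(** Boundedness at a radius [s] strictly between [r] and 1 gives decay with ratio r / s at [r]. *)
Lemma geo_tail a r : disc_bounded a -> 0 <= r < 1 -> exists K y,
  [/\ 0 <= K, 0 <= y < 1 & forall n, cabs (a n) * r ^+ n <= K * y ^+ n].
Proof.
move=> Ha /andP[r0 r1]; pose s := (1 + r) / 2.
have s0 : 0 < s by rewrite /s; lra.
have [|K K0 HK] := Ha s; first by rewrite /s; lra.
exists K, (r / s); split=> //.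
  by rewrite divr_ge0 ?(ltW s0)//= ltr_pdivrMr// mul1r /s; lra.
move=> n; rewrite expr_div_n mulrA ler_pdivlMr ?exprn_gt0// mulrAC.
by rewrite ler_wpM2r ?exprn_ge0.
Qed.

Lemma coefs_tail f a r : coefs f a -> 0 <= r < 1 -> exists K y,
  [/\ 0 <= K, 0 <= y < 1 & forall J z, cabs z <= r ->
    cabs (f z - \sum_(n < J) a n * z ^+ n) <= K * y ^+ J].
Proof.
move=> fa r01; have [K [y [K0 y01 HK]]] := geo_tail (coefs_bounded fa) r01.
have /andP[y0 y1] := y01; have /andP[r0 r1] := r01.
exists (K / (1 - y)), y; split=> //; first by rewrite divr_ge0// subr_ge0 ltW.
move=> J z zr; apply/ler_addgt0Pr => e e0.
have [J0 HJ] := fa z (le_lt_trans zr r1) e e0.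
pose J' := maxn J J0; have := HJ J' (leq_maxr _ _).
have JJ' : (J <= J')%N by exact: leq_maxl.
rewrite -!(big_mkord xpredT (fun n => a n * z ^+ n)) (big_cat_nat (leq0n J) JJ') /=.
set S := \sum_(0 <= i < J) _; set T := \sum_(J <= i < J') _ => H.
have -> : f z - S = T + (f z - (S + T)) by ring.
rewrite (le_trans (ler_cabsD _ _))// lerD// mulrAC -mulrA.
rewrite (le_trans (ler_cabs_sum _ _ _))//.
rewrite (le_trans _ (ler_wpM2l K0 (geo_sum_le J J' y01)))// mulr_sumr.
apply: ler_sum_nat => n _; rewrite cabsM cabsX (le_trans _ (HK n))//.
by rewrite ler_wpM2l ?cabs_ge0// lerXn2r// nnegrE cabs_ge0.
Qed.

Lemma disc_bounded_coefs a : disc_bounded a -> exists f, coefs f a.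
Proof.
move=> Ha.
have H z : exists s : C, cabs z < 1 -> forall e, 0 < e ->
    exists J0, forall J, (J0 <= J)%N -> cabs (s - \sum_(n < J) a n * z ^+ n) <= e.
  have [z1|] := boolP (cabs z < 1); last by exists 0.
  have [|K [y [K0 y01 HK]]] := @geo_tail a (cabs z) Ha; first by rewrite cabs_ge0.
  have [|s Hs] := @geo_series R (fun n => a n * z ^+ n) K y y01.
    by move=> n; rewrite cabsM cabsX.
  exists s => _ e e0; have /andP[y0 y1] := y01.
  have y1' : 0 < 1 - y by rewrite subr_gt0.
  have [|N HN] := @expr_small R y (e * (1 - y) / (K + 1)) y01.
    by rewrite !divr_gt0 ?mulr_gt0// ltr_wpDl.
  exists N => J /HN HJ; rewrite (le_trans (Hs J))// mulrA ler_pdivrMr//.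
  rewrite (le_trans (ler_wpM2l K0 (ltW HJ)))// mulrA ler_pdivrMr ?ltr_wpDl//.
  by rewrite mulrC ler_wpM2l ?lerDl// mulr_ge0 ?ltW.
have [f Hf] := choice H; by exists f.
Qed.

Lemma natr_geo x y : 0 <= x < y -> exists2 K, 0 <= K &
  forall n, n%:R * x ^+ n <= K * y ^+ n.
Proof.
move=> /andP[x0 xy]; have d0 : 0 < y - x by rewrite subr_gt0.
exists (x / (y - x)) => [|n]; first by rewrite divr_ge0// ltW.
rewrite mulrAC ler_pdivlMr//.
(* These are the first two terms of the binomial expansion of (x + (y - x))^n, times x; hence the
   constant x / (y - x). *)
suff: x ^+ n * (x + n%:R * (y - x)) <= x * y ^+ n.
  apply: le_trans.
  have -> : x ^+ n * (x + n%:R * (y - x)) = x ^+ n * x + n%:R * x ^+ n * (y - x).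
    by ring.
  by rewrite lerDr mulr_ge0 ?exprn_ge0.
elim: n => [|n IH]; first by rewrite !expr0 mul1r mulr1 mul0r addr0.
have y0 : 0 <= y by rewrite (le_trans x0)// ltW.
have H : x * (x + n.+1%:R * (y - x)) <= y * (x + n%:R * (y - x)).
  have n0 : 0 <= n%:R :> R by [].
  rewrite -natr1; set m := n%:R in n0 *.
  by have := mulr_ge0 n0 (sqr_ge0 (y - x)); nra.
rewrite exprSr -mulrA (le_trans (ler_wpM2l (exprn_ge0 n x0) H))//.
by rewrite mulrCA exprS [leRHS]mulrCA ler_wpM2l.
Qed.

(** The factor [r ^+ 2] on the left avoids an exponent n - 2 on the right, and n^2 is a crude bound
    for n (n - 1) / 2. The induction rests on the recursion [E] for the remainder. *)
Lemma taylor2 z w r n : cabs z <= r -> cabs w <= r ->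
  r ^+ 2 * cabs (z ^+ n - w ^+ n - n%:R * w ^+ n.-1 * (z - w)) <=
  n%:R ^+ 2 * r ^+ n * cabs (z - w) ^+ 2.
Proof.
move=> zr wr; have r0 : 0 <= r := le_trans (cabs_ge0 z) zr.
elim: n => [|n IH].
  by rewrite !expr0 subrr sub0r mul0r mul0r oppr0 cabs0 mulr0 expr0n !mul0r.
have E : z ^+ n.+1 - w ^+ n.+1 - n.+1%:R * w ^+ n * (z - w) =
  z * (z ^+ n - w ^+ n - n%:R * w ^+ n.-1 * (z - w)) +
  n%:R * w ^+ n.-1 * (z - w) ^+ 2.
  case: n {IH} => [|n /=]; first by rewrite !expr0 !expr1; ring.
  by rewrite !exprS -!natr1; ring.
rewrite /= E; set h := cabs (z - w) in IH *.
rewrite (le_trans (ler_wpM2l (sqr_ge0 _) (ler_cabsD _ _)))// mulrDr.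
apply: (@le_trans _ _ (r * (n%:R ^+ 2 * r ^+ n * h ^+ 2) + n%:R * r ^+ n.+1 * h ^+ 2)).
  apply: lerD.
    rewrite cabsM mulrCA (le_trans (ler_wpM2r _ zr))// ?mulr_ge0 ?exprn_ge0 ?cabs_ge0//.
    by rewrite ler_wpM2l.
  rewrite !cabsM !cabsX cabs_nat -/h -expr2 mulrA ler_wpM2r ?exprn_ge0 ?cabs_ge0//.
  case: n {IH E} => [|n]; first by rewrite !mul0r mulr0.
  rewrite mulrCA ler_wpM2l// (exprD r 2 n : r ^+ n.+2 = _) ler_wpM2l ?exprn_ge0//=.
  by rewrite lerXn2r// nnegrE cabs_ge0.
rewrite (_ : r * _ + _ = (n%:R ^+ 2 + n%:R) * (r ^+ n.+1 * h ^+ 2)); last first.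
  by rewrite (exprS r n); ring.
rewrite -mulrA ler_wpM2r ?mulr_ge0 ?exprn_ge0 ?cabs_ge0//.
by rewrite -natr1; have : 0 <= n%:R :> R by []; nra.
Qed.

Lemma coefs_analytic f a : coefs f a -> analytic_disc f.
Proof.
move=> fa w w1; apply/choloP.
pose r := (1 + cabs w) / 2; have w0 := cabs_ge0 w.
have r0 : 0 < r by rewrite /r; lra.
have r1 : r < 1 by rewrite /r; lra.
have wr : cabs w < r by rewrite /r; lra.
have [|K [y [K0 /andP[y0 y1] HK]]] := @geo_tail a r (coefs_bounded fa).
  by rewrite ltW.
(* Each factor n is absorbed by a larger ratio: y < y2 < y3 < 1 makes room for the n^2 of
   [taylor2]. *)
pose y2 := (1 + y) / 2; pose y3 := (1 + y2) / 2.
have [|K1 K10 H1] := @natr_geo y y2; first by rewrite /y2; lra.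
have [|K2 K20 H2] := @natr_geo y2 y3; first by rewrite /y3 /y2; lra.
have y30 : 0 <= y3 < 1 by rewrite /y3 /y2; lra.
pose B := K * K1 * K2 / r ^+ 2.
have nn n : n%:R ^+ 2 * cabs (a n) * r ^+ n <= K * K1 * K2 * y3 ^+ n.
  rewrite -mulrA (le_trans (ler_wpM2l (sqr_ge0 _) (HK n)))//.
  have -> : n%:R ^+ 2 * (K * y ^+ n) = K * n%:R * (n%:R * y ^+ n) by ring.
  rewrite (le_trans (ler_wpM2l _ (H1 n))) ?mulr_ge0//.
  have -> : K * n%:R * (K1 * y2 ^+ n) = K * K1 * (n%:R * y2 ^+ n) by ring.
  by rewrite -[leRHS]mulrA ler_wpM2l ?mulr_ge0.
have [|D HD] := @geo_series R (fun n => n%:R * a n * w ^+ n.-1)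
    (K * K1 * K2 / r) y3 y30.
  move=> n; rewrite [leRHS]mulrAC ler_pdivlMr// (le_trans _ (nn n))//.
  rewrite !cabsM cabsX cabs_nat.
  case: n => [|n]; first by rewrite !mul0r expr0n !mul0r.
  rewrite /= -[leLHS]mulrA.
  have -> : n.+1%:R ^+ 2 * cabs (a n.+1) * r ^+ n.+1 =
    n.+1%:R * cabs (a n.+1) * (n.+1%:R * r ^+ n.+1) by ring.
  rewrite ler_wpM2l ?mulr_ge0 ?cabs_ge0//.
  rewrite -[leLHS]mul1r; apply: ler_pM => //.
  - by rewrite mulr_ge0 ?exprn_ge0 ?cabs_ge0 ?(ltW r0).
  - by rewrite ler1n.
  by rewrite exprSr ler_pM2r// lerXn2r ?nnegrE ?cabs_ge0 ?(ltW r0) ?(ltW wr).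
have /andP[_ y31] := y30; have y3' : 0 < 1 - y3 by rewrite subr_gt0.
have B0 : 0 <= B / (1 - y3).
  by rewrite divr_ge0 ?(ltW y3')// divr_ge0 ?sqr_ge0// !mulr_ge0.
(* The remainder is quadratic in v - w, uniformly in v. This is proved on partial sums; the
   truncation errors contribute e/4, e/4 and, since |v - w| <= 2, e/2. *)
have quad v : cabs v <= r ->
    cabs (f v - f w - D * (v - w)) <= B / (1 - y3) * cabs (v - w) ^+ 2.
  move=> vr; apply/ler_addgt0Pr => e e0.
  have e4 : 0 < e / 4 by rewrite divr_gt0.
  have [J1 HJ1] := fa v (le_lt_trans vr r1) _ e4.
  have [J2 HJ2] := fa w w1 _ e4.
  have K40 : 0 <= K * K1 * K2 / r by rewrite divr_ge0 ?(ltW r0)// !mulr_ge0.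
  have [|J3 HJ3] := @expr_small R y3 (e / 4 * (1 - y3) / (K * K1 * K2 / r + 1)) y30.
    by rewrite divr_gt0 ?ltr_wpDl// mulr_gt0.
  pose J := maxn J1 (maxn J2 J3).
  have {}HJ1 := HJ1 J ltac:(by rewrite /J /= !leq_max leqnn ?orbT).
  have {}HJ2 := HJ2 J ltac:(by rewrite /J /= !leq_max leqnn ?orbT).
  have {}HJ3 := HJ3 J ltac:(by rewrite /J /= !leq_max leqnn ?orbT).
  have {HJ3}HJ3 : cabs (D - \sum_(n < J) n%:R * a n * w ^+ n.-1) <= e / 4.
    rewrite (le_trans (HD J))// mulrA ler_pdivrMr//.
    rewrite (le_trans (ler_wpM2l K40 (ltW HJ3)))// mulrA ler_pdivrMr ?ltr_wpDl//.
    by rewrite mulrC ler_wpM2l ?lerDl// mulr_ge0 ?(ltW e4)// ltW.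
  have HT : cabs (\sum_(n < J) a n * v ^+ n - \sum_(n < J) a n * w ^+ n -
      (\sum_(n < J) n%:R * a n * w ^+ n.-1) * (v - w)) <=
      B / (1 - y3) * cabs (v - w) ^+ 2.
    rewrite mulr_suml -!sumrB (le_trans (ler_cabs_sum _ _ _))//.
    apply: (@le_trans _ _ (\sum_(n < J) B * y3 ^+ n * cabs (v - w) ^+ 2)).
      apply: ler_sum => n _.
      have -> : a n * v ^+ n - a n * w ^+ n - n%:R * a n * w ^+ n.-1 * (v - w) =
        a n * (v ^+ n - w ^+ n - n%:R * w ^+ n.-1 * (v - w)) by ring.
      rewrite cabsM -(ler_pM2l (exprn_gt0 2 r0)) mulrCA.
      rewrite (le_trans (ler_wpM2l (cabs_ge0 _) (taylor2 n vr (ltW wr))))//.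
      rewrite [leLHS]mulrA [leRHS]mulrA ler_wpM2r ?exprn_ge0 ?cabs_ge0//.
      rewrite mulrA [cabs (a n) * _]mulrC (le_trans (nn n))//.
      by rewrite /B [r ^+ 2 * _]mulrA [r ^+ 2 * _]mulrC divfK// gt_eqF// exprn_gt0.
    rewrite -mulr_suml ler_wpM2r ?exprn_ge0 ?cabs_ge0// -mulr_sumr.
    rewrite ler_wpM2l ?divr_ge0 ?sqr_ge0 ?mulr_ge0//.
    rewrite -(big_mkord xpredT (fun n => y3 ^+ n)) (le_trans (geo_sum_le _ _ y30))//.
    by rewrite expr0 mul1r.
  set Sv := \sum_(n < J) a n * v ^+ n in HJ1 HT.
  set Sw := \sum_(n < J) a n * w ^+ n in HJ2 HT.
  set SD := \sum_(n < J) n%:R * a n * w ^+ n.-1 in HJ3 HT.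
  have -> : f v - f w - D * (v - w) = (Sv - Sw - SD * (v - w)) +
    ((f v - Sv) - (f w - Sw) - (D - SD) * (v - w)) by ring.
  rewrite (le_trans (ler_cabsD _ _))// lerD//.
  rewrite (le_trans (ler_cabsB _ _))//.
  have : cabs ((D - SD) * (v - w)) <= e / 2.
    rewrite cabsM (_ : e / 2 = e / 4 * 2); last by field.
    rewrite ler_pM ?cabs_ge0// (le_trans (ler_cabsB _ _))//.
    by have := ltW w1; have := ltW (le_lt_trans vr r1); lra.
  by have := ler_cabsB (f v - Sv) (f w - Sw); lra.
exists D; move=> e e0.
have B1 : 0 < B / (1 - y3) + 1 by rewrite ltr_wpDl.
exists (Num.min (r - cabs w) (e / (B / (1 - y3) + 1))).
  by rewrite lt_min subr_gt0 wr divr_gt0.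
move=> v; rewrite lt_min ltr_pdivlMr// => /andP[vw1 vw2].
rewrite (le_trans (quad v _))//.
  by rewrite (le_trans (ler_cabs_dist v w))//; lra.
rewrite expr2 mulrA ler_wpM2r ?cabs_ge0// mulrC ltW//.
by rewrite (le_lt_trans _ vw2)// ler_wpM2l ?cabs_ge0// lerDl.
Qed.

End Coefficients.

(** * Integrals of continuous functions over segments *)

Section IntervalIntegral.
Variable R : realType.
Local Notation mu := (@lebesgue_measure R).
Implicit Types (f g : R -> R) (a b c : R).

Definition itv_int f a b : R := \int[mu]_(x in `[a, b]) f x.

Definition cont_on f a b := forall x, a <= x <= b -> forall e, 0 < e ->
  exists2 dl, 0 < dl & forall y, a <= y <= b -> `|y - x| < dl -> `|f y - f x| < e.

Lemma cont_on_within f a b : cont_on f a b -> {within `[a, b], continuous f}.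
Proof.
move=> Hf; apply/subspace_continuousP => x /=; rewrite in_itv /= => xab.
apply/cvgrPdist_lt => e e0; have [dl dl0 H] := Hf x xab e e0.
rewrite /within /=; exists dl => //= y /= xy yab.
by rewrite distrC H// distrC.
Qed.

Lemma cont_on_integrable f a b : cont_on f a b ->
  mu.-integrable `[a, b] (EFin \o f).
Proof.
move=> Hf; apply: continuous_compact_integrable; first exact: segment_compact.
exact: cont_on_within.
Qed.

Lemma cont_on_sub f a b a' b' : a <= a' -> b' <= b -> cont_on f a b -> cont_on f a' b'.
Proof.
move=> aa bb Hf x xab e e0; have [|dl dl0 H] := Hf x _ e e0; first by lra.
by exists dl => // y yab; apply: H; lra.
Qed.

Lemma cont_onB f g a b : cont_on f a b -> cont_on g a b -> cont_on (fun x => f x - g x) a b.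
Proof.
move=> Hf Hg x xab e e0; have e2 : 0 < e / 2 by rewrite divr_gt0.
have [d1 d10 H1] := Hf x xab _ e2; have [d2 d20 H2] := Hg x xab _ e2.
exists (Num.min d1 d2) => [|y yab]; first by rewrite lt_min d10.
rewrite lt_min => /andP[/(H1 _ yab) h1 /(H2 _ yab) h2].
have -> : f y - g y - (f x - g x) = (f y - f x) - (g y - g x) by ring.
by rewrite (le_lt_trans (ler_normB _ _))// [e]splitr ltrD.
Qed.

Lemma itv_intD f g a b : cont_on f a b -> cont_on g a b ->
  itv_int (fun x => f x + g x) a b = itv_int f a b + itv_int g a b.
Proof. by move=> Hf Hg; rewrite /itv_int RintegralD//; exact: cont_on_integrable. Qed.

Lemma itv_intB f g a b : cont_on f a b -> cont_on g a b ->
  itv_int (fun x => f x - g x) a b = itv_int f a b - itv_int g a b.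
Proof. by move=> Hf Hg; rewrite /itv_int RintegralB//; exact: cont_on_integrable. Qed.

Lemma itv_intZ k f a b : cont_on f a b ->
  itv_int (fun x => k * f x) a b = k * itv_int f a b.
Proof. by move=> Hf; rewrite /itv_int RintegralZl//; exact: cont_on_integrable. Qed.

Lemma itv_int_cst k a b : a <= b -> itv_int (fun=> k) a b = k * (b - a).
Proof.
move=> ab; rewrite /itv_int Rintegral_cst//=.
rewrite lebesgue_measure_itv /= lte_fin; case: ifP => //= /negbT.
rewrite -leNgt => ba.
have -> : b = a by apply/le_anti; rewrite ab ba.
by rewrite subrr.
Qed.

Lemma cont_on_cst k a b : cont_on (fun=> k) a b.
Proof. by move=> x _ e e0; exists 1 => // y _ _; rewrite subrr normr0. Qed.

Lemma itv_int_le f g a b : cont_on f a b -> cont_on g a b ->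
  (forall x, a <= x <= b -> f x <= g x) -> itv_int f a b <= itv_int g a b.
Proof.
move=> Hf Hg fg; have mf := cont_on_integrable Hf; have mg := cont_on_integrable Hg.
by apply: le_Rintegral => // x /=; rewrite in_itv /=; exact: fg.
Qed.

Lemma itv_int_eq f g a b : (forall x, a <= x <= b -> f x = g x) ->
  itv_int f a b = itv_int g a b.
Proof.
move=> fg; apply: eq_Rintegral => x; rewrite inE /= in_itv /=; exact: fg.
Qed.

Lemma itv_int_near f m E a b : a <= b -> cont_on f a b ->
  (forall x, a <= x <= b -> `|f x - m| <= E) ->
  `|itv_int f a b - m * (b - a)| <= E * (b - a).
Proof.
move=> ab Hf HE; have Hm := @cont_on_cst m a b; have HEc := @cont_on_cst E a b.
rewrite ler_distl -(itv_int_cst m ab) -(itv_int_cst E ab) -itv_intB// -itv_intD//.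
apply/andP; split; apply: itv_int_le => //.
- exact: cont_onB.
- by move=> x /HE; rewrite ler_distl => /andP[].
- rewrite -(opprK E); exact: (cont_onB Hm (@cont_on_cst (- E) a b)).
- by move=> x /HE; rewrite ler_distl => /andP[].
Qed.

Lemma itv_int_split f a b c : a <= c -> c <= b -> cont_on f a b ->
  itv_int f a b = itv_int f a c + itv_int f c b.
Proof.
move=> ac cb Hf; have Hi := cont_on_integrable Hf.
have := @Rintegral_itvB R f (BLeft a) (BRight b) c Hi.
rewrite !bnd_simp => /(_ ac cb) H.
rewrite /itv_int -[X in _ = _ + X]Rintegral_itv_obnd_cbnd -?H ?subrKC//.
apply: integrableS Hi => // x /=; rewrite !in_itv /= => /andP[cx ->].
by rewrite andbT ltW// (le_lt_trans ac).
Qed.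

End IntervalIntegral.

(** * Goursat's theorem on rectangles *)

Section Goursat.
Variable R : realType.
Implicit Types (P Q : R -> R -> R) (a b c d x y : R).

(** First-order expansions of the form P dx + Q dy at each point. The same [q] serves as the
    y-derivative of P and the x-derivative of Q: this is closedness, with no continuity of the
    derivatives. *)
Definition closed_form P Q a b c d := forall x y, a <= x <= b -> c <= y <= d ->
  exists p q q' : R, forall e, 0 < e -> exists2 dl : R, 0 < dl &
  forall x' y', a <= x' <= b -> c <= y' <= d -> `|x' - x| < dl -> `|y' - y| < dl ->
    `|P x' y' - P x y - p * (x' - x) - q * (y' - y)| <= e * (`|x' - x| + `|y' - y|) /\
    `|Q x' y' - Q x y - q * (x' - x) - q' * (y' - y)| <= e * (`|x' - x| + `|y' - y|).

(** Integral of P dx + Q dy along the boundary, counterclockwise, with opposite sides paired. *)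
Definition circulation P Q a b c d : R :=
  itv_int (fun x => P x c - P x d) a b + itv_int (fun y => Q b y - Q a y) c d.

Lemma nested_limit (u : nat -> R) w : 0 <= w ->
  (forall n, u n <= u n.+1 <= u n + w / 2 ^+ n.+1) ->
  exists x, forall n, u n <= x <= u n + w / 2 ^+ n.
Proof.
move=> w0 Hu.
have mono n m : (n <= m)%N -> u n <= u m.
  move=> /subnK <-; elim: (m - n)%N => [|k IH]//=.
  by rewrite (le_trans IH)//; have /andP[] := Hu (k + n)%N.
have up n m : (n <= m)%N -> u m + w / 2 ^+ m <= u n + w / 2 ^+ n.
  move=> /subnK <-; elim: (m - n)%N => [|k IH]//=.
  apply: le_trans IH; have /andP[_] := Hu (k + n)%N.
  set v := u _; set v' := u _ => H.
  have -> : w / 2 ^+ (k + n) = w / 2 ^+ (k.+1 + n) + w / 2 ^+ (k.+1 + n).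
    by rewrite addSn exprS; field; rewrite ?expf_neq0.
  by rewrite addrA lerD2r.
have wn n : 0 <= w / 2 ^+ n by rewrite divr_ge0 ?exprn_ge0.
have ub n m : u m <= u n + w / 2 ^+ n.
  have [nm|/ltnW mn] := leqP n m.
    by apply: le_trans (up _ _ nm); rewrite lerDl.
  by rewrite (le_trans (mono _ _ mn))// lerDl.
have hs : has_sup (range u).
  split; first by exists (u 0%N), 0%N.
  by exists (u 0%N + w / 2 ^+ 0); move=> _ [m _ <-].
exists (sup (range u)) => n; apply/andP; split.
  by apply: ub_le_sup; [exact: hs.2|exists n].
by apply: ge_sup; [exact: hs.1|move=> _ [m _ <-]].
Qed.

Section Rectangle.
Variables (P Q : R -> R -> R) (a b c d : R).
Hypothesis PQ : closed_form P Q a b c d.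

Lemma lin_bound (e dx dy p q t : R) : 0 < e -> `|t - p * dx - q * dy| <= `|dx| + `|dy| ->
  `|dx| < e / 2 / (1 + `|p| + `|q|) -> `|dy| < e / 2 / (1 + `|p| + `|q|) -> `|t| < e.
Proof.
move=> e0 H; have k0 : 0 < 1 + `|p| + `|q|.
  by have := normr_ge0 p; have := normr_ge0 q; lra.
rewrite !ltr_pdivlMr// => Hx Hy.
have -> : t = (t - p * dx - q * dy) + p * dx + q * dy by ring.
apply: (le_lt_trans (ler_normD _ _)); rewrite normrM.
apply: (@le_lt_trans _ _ (`|dx| + `|dy| + `|p| * `|dx| + `|q| * `|dy|)).
  by rewrite lerD2r (le_trans (ler_normD _ _))// normrM lerD2r.
have := normr_ge0 p; have := normr_ge0 q; have := normr_ge0 dx; have := normr_ge0 dy.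
by move=> *; nra.
Qed.

Lemma closed_form_contP x y : a <= x <= b -> c <= y <= d ->
  forall e, 0 < e -> exists2 dl : R, 0 < dl & forall x' y', a <= x' <= b -> c <= y' <= d ->
  `|x' - x| < dl -> `|y' - y| < dl -> `|P x' y' - P x y| < e /\ `|Q x' y' - Q x y| < e.
Proof.
move=> xab ycd e e0; have [p [q [q' H]]] := PQ xab ycd.
have [dl dl0 {}H] := H 1 ltr01.
have kp : 0 < 1 + `|p| + `|q| by have := normr_ge0 p; have := normr_ge0 q; lra.
have kq : 0 < 1 + `|q| + `|q'| by have := normr_ge0 q'; have := normr_ge0 q; lra.
exists (Num.min dl (Num.min (e / 2 / (1 + `|p| + `|q|)) (e / 2 / (1 + `|q| + `|q'|)))).
  by rewrite !lt_min dl0 !divr_gt0.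
move=> x' y' xab' ycd'; rewrite !lt_min => /and3P[hx1 hx2 hx3] /and3P[hy1 hy2 hy3].
have [H1 H2] := H x' y' xab' ycd' hx1 hy1; rewrite !mul1r in H1 H2.
by split; [exact: lin_bound H1 _ _|exact: lin_bound H2 _ _].
Qed.

Lemma cont_P y : c <= y <= d -> cont_on (P^~ y) a b.
Proof.
move=> ycd x xab e e0; have [dl dl0 H] := closed_form_contP xab ycd e0.
by exists dl => // x' xab' xx'; have [] := H x' y xab' ycd xx'; rewrite ?subrr ?normr0.
Qed.

Lemma cont_Q x : a <= x <= b -> cont_on (Q x) c d.
Proof.
move=> xab y ycd e e0; have [dl dl0 H] := closed_form_contP xab ycd e0.
by exists dl => // y' ycd' yy'; have [] := H x y' xab ycd' _ yy'; rewrite ?subrr ?normr0.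
Qed.

Lemma circulation_hsplit a' b' c' d' m : a <= a' -> a' <= m -> m <= b' -> b' <= b ->
  c <= c' -> c' <= d' -> d' <= d ->
  circulation P Q a' b' c' d' = circulation P Q a' m c' d' + circulation P Q m b' c' d'.
Proof.
move=> h1 h2 h3 h4 h5 h6 h7; rewrite /circulation (@itv_int_split _ _ a' b' m)//; last first.
  by apply: (cont_on_sub h1 h4); apply: cont_onB; apply: cont_P; lra.
have HQ x : a <= x <= b -> cont_on (Q x) c' d'.
  by move=> xab; apply: (cont_on_sub h5 h7); exact: cont_Q.
have [Ha Hm Hb] : [/\ a <= a' <= b, a <= m <= b & a <= b' <= b] by split; lra.
rewrite (itv_intB (HQ _ Hb) (HQ _ Ha)) (itv_intB (HQ _ Hm) (HQ _ Ha)).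
by rewrite (itv_intB (HQ _ Hb) (HQ _ Hm)); ring.
Qed.

Lemma circulation_vsplit a' b' c' d' m : a <= a' -> a' <= b' -> b' <= b ->
  c <= c' -> c' <= m -> m <= d' -> d' <= d ->
  circulation P Q a' b' c' d' = circulation P Q a' b' c' m + circulation P Q a' b' m d'.
Proof.
move=> h1 h2 h3 h4 h5 h6 h7.
rewrite /circulation (@itv_int_split _ (fun y => Q b' y - Q a' y) c' d' m)//; last first.
  by apply: (cont_on_sub h4 h7); apply: cont_onB; apply: cont_Q; lra.
have HP y : c <= y <= d -> cont_on (P^~ y) a' b'.
  by move=> ycd; apply: (cont_on_sub h1 h3); exact: cont_P.
have [Hc Hm Hd] : [/\ c <= c' <= d, c <= m <= d & c <= d' <= d] by split; lra.
rewrite (itv_intB (HP _ Hc) (HP _ Hd)) (itv_intB (HP _ Hc) (HP _ Hm)).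
by rewrite (itv_intB (HP _ Hm) (HP _ Hd)); ring.
Qed.

Lemma norm_sum4 (A B C D r : R) : r <= `|A + B + (C + D)| ->
  [\/ r / 4 <= `|A|, r / 4 <= `|B|, r / 4 <= `|C| | r / 4 <= `|D|].
Proof.
move=> H; have [|hA] := leP (r / 4) `|A|; first by constructor 1.
have [|hB] := leP (r / 4) `|B|; first by constructor 2.
have [|hC] := leP (r / 4) `|C|; first by constructor 3.
have [|hD] := leP (r / 4) `|D|; first by constructor 4.
have := ler_normD (A + B) (C + D); have := ler_normD A B; have := ler_normD C D.
by move=> *; exfalso; lra.
Qed.

Lemma bisection_step a' c' w h r : 0 <= w -> 0 <= h -> a <= a' -> a' + w <= b ->
  c <= c' -> c' + h <= d -> r <= `|circulation P Q a' (a' + w) c' (c' + h)| ->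
  exists a2 c2, [/\ a' <= a2 <= a' + w / 2, c' <= c2 <= c' + h / 2 &
    r / 4 <= `|circulation P Q a2 (a2 + w / 2) c2 (c2 + h / 2)|].
Proof.
move=> w0 h0 h1 h2 h3 h4.
rewrite (@circulation_hsplit _ _ _ _ (a' + w / 2)); [|lra..].
rewrite (@circulation_vsplit a' _ _ _ (c' + h / 2)); [|lra..].
rewrite (@circulation_vsplit (a' + w / 2) _ _ _ (c' + h / 2)); [|lra..].
have E (t u : R) : t + u = t + u / 2 + u / 2 by lra.
rewrite (E a' w) (E c' h) => /norm_sum4[] H.
- by exists a', c'; split=> //; lra.
- by exists a', (c' + h / 2); split=> //; lra.
- by exists (a' + w / 2), c'; split=> //; lra.
- by exists (a' + w / 2), (c' + h / 2); split=> //; lra.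
Qed.

(** Repeated bisection keeps a quarter of the circulation at each stage, so at least r / 4^n. Near
    the limit point the affine part of the form has zero circulation, and the remainder contributes
    at most a small multiple of the squared size, which also scales as 1 / 4^n. *)
Lemma goursat : a <= b -> c <= d -> circulation P Q a b c d = 0.
Proof.
move=> ab cd; apply/eqP; apply/negPn/negP => /eqP/eqP; rewrite -normr_gt0.
set r := `|_| => r0; pose w := b - a; pose h := d - c.
have w0 : 0 <= w by rewrite /w; lra.
have h0 : 0 <= h by rewrite /h; lra.
pose good n (p : R * R) := [/\ a <= p.1, p.1 + w / 2 ^+ n <= b, c <= p.2,
   p.2 + h / 2 ^+ n <= d & r / 4 ^+ n <=
   `|circulation P Q p.1 (p.1 + w / 2 ^+ n) p.2 (p.2 + h / 2 ^+ n)|].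
(* The invariant is a premise inside the existential, so that [choice] gives a selection function
   defined on all pairs. *)
have step (np : nat * (R * R)) : exists p' : R * R, good np.1 np.2 ->
  [/\ good np.1.+1 p', np.2.1 <= p'.1 <= np.2.1 + w / 2 ^+ np.1.+1 &
      np.2.2 <= p'.2 <= np.2.2 + h / 2 ^+ np.1.+1].
  case: np => n p /=; have [[g1 g2 g3 g4 g5]|] := pselect (good n p); last by exists p.
  have E (t : R) : t / 2 ^+ n.+1 = t / 2 ^+ n / 2.
    by rewrite exprS; field; rewrite expf_neq0.
  have E2 (t : R) : t / 4 ^+ n.+1 = t / 4 ^+ n / 4.
    by rewrite exprS; field; rewrite expf_neq0.
  have wn : 0 <= w / 2 ^+ n by rewrite divr_ge0 ?exprn_ge0.
  have hn : 0 <= h / 2 ^+ n by rewrite divr_ge0 ?exprn_ge0.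
  have [a2 [c2 [k1 k2 k3]]] := bisection_step wn hn g1 g2 g3 g4 g5.
  exists (a2, c2) => _; rewrite /good /= !E !E2; split=> //; split=> //; lra.
have [F HF] := choice step.
pose s := fix s n := if n is m.+1 then F (m, s m) else (a, c).
have sg n : good n (s n).
  elim: n => [|n IH]; last by have [] := HF (n, s n) IH.
  rewrite /good /= !expr0 !divr1 /w /h !subrKC; split=> //.
have [x Hx] := @nested_limit (fun n => (s n).1) w w0
  (fun n => let: And3 _ H _ := HF (n, s n) (sg n) in H).
have [y Hy] := @nested_limit (fun n => (s n).2) h h0
  (fun n => let: And3 _ _ H := HF (n, s n) (sg n) in H).
have xab : a <= x <= b.
  by have := Hx 0%N; rewrite /= expr0 divr1 /w; lra.
have ycd : c <= y <= d.
  by have := Hy 0%N; rewrite /= expr0 divr1 /h; lra.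
have [p [q [q' H]]] := PQ xab ycd.
(* The summand 1 keeps [W] positive for degenerate rectangles. With the tolerance r / (4 W^2), the
   final bound 2 e (W / 2^n)^2 is half of r / 4^n. *)
pose W := w + h + 1; have W0 : 0 < W by rewrite /W; lra.
have [|dl dl0 {}H] := H (r / (4 * W ^+ 2)).
  by rewrite divr_gt0// mulr_gt0// exprn_gt0.
have [n Hn] : exists n, W / 2 ^+ n < dl.
  have [||n Hn] := @expr_small R (1 / 2) (dl / W); [lra|by rewrite divr_gt0|].
  exists n; have := Hn n (leqnn n); rewrite expr_div_n expr1n ltr_pdivlMr//.
  by rewrite mulrC mul1r.
have /= [g1 g2 g3 g4] := sg n; apply/negP; rewrite -ltNge.
have /= := Hx n; have /= := Hy n.
set a' := (s n).1; set c' := (s n).2; set wn := w / 2 ^+ n; set hn := h / 2 ^+ n.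
move=> yn xn; rewrite -/a' -/c' -/wn -/hn in g1 g2 g3 g4.
have p2 : 0 < 2 ^+ n :> R by rewrite exprn_gt0.
have wn0 : 0 <= wn by rewrite divr_ge0// ltW.
have hn0 : 0 <= hn by rewrite divr_ge0// ltW.
have EW : W / 2 ^+ n = wn + hn + 1 / 2 ^+ n by rewrite /W /wn /hn !mulrDl.
have i2 : 0 < 1 / 2 ^+ n :> R by rewrite divr_gt0.
clearbody wn hn a' c'; clear p2 xab ycd w0 h0.
set e := r / (4 * W ^+ 2) in H.
have e0 : 0 < e by rewrite divr_gt0// mulr_gt0// exprn_gt0.
have near x' y' : a' <= x' <= a' + wn -> c' <= y' <= c' + hn ->
    `|P x' y' - P x y - p * (x' - x) - q * (y' - y)| <= e * (wn + hn) /\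
    `|Q x' y' - Q x y - q * (x' - x) - q' * (y' - y)| <= e * (wn + hn).
  move=> hx' hy'.
  have dx : `|x' - x| <= wn by clear -xn hx'; rewrite ler_norml; lra.
  have dy : `|y' - y| <= hn by clear -yn hy'; rewrite ler_norml; lra.
  have wd : wn < dl by clear -Hn EW hn0 i2; lra.
  have hd : hn < dl by clear -Hn EW wn0 i2; lra.
  have xab' : a <= x' <= b by clear -g1 g2 hx'; lra.
  have ycd' : c <= y' <= d by clear -g3 g4 hy'; lra.
  have [H1 H2] := H x' y' xab' ycd' (le_lt_trans dx wd) (le_lt_trans dy hd).
  have le : e * (`|x' - x| + `|y' - y|) <= e * (wn + hn) by apply: ler_wpM2l; [exact: ltW|exact: lerD].
  by split; [exact: le_trans H1 le|exact: le_trans H2 le].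
(* The affine part contributes -q hn per unit length on the horizontal pair of sides and q wn on the
   vertical pair; times the lengths wn and hn these cancel. *)
have B1 : `|itv_int (fun x' => P x' c' - P x' (c' + hn)) a' (a' + wn) -
   (- q * hn) * (a' + wn - a')| <= e * (wn + hn) * 2 * (a' + wn - a').
  apply: itv_int_near; first by rewrite lerDl.
    by apply: (cont_on_sub g1 g2); apply: cont_onB; apply: cont_P; clear -g3 g4 hn0; lra.
  move=> x' hx'; have [|N1 _] := near x' c' hx'; first by rewrite lexx lerDl.
  have [|N2 _] := near x' (c' + hn) hx'; first by rewrite lexx lerDl hn0.
  have -> : P x' c' - P x' (c' + hn) - - q * hn =
    (P x' c' - P x y - p * (x' - x) - q * (c' - y)) -
    (P x' (c' + hn) - P x y - p * (x' - x) - q * (c' + hn - y)) by ring.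
  by rewrite (le_trans (ler_normB _ _))//; clear -N1 N2; lra.
have B2 : `|itv_int (fun y' => Q (a' + wn) y' - Q a' y') c' (c' + hn) -
   (q * wn) * (c' + hn - c')| <= e * (wn + hn) * 2 * (c' + hn - c').
  apply: itv_int_near; first by rewrite lerDl.
    by apply: (cont_on_sub g3 g4); apply: cont_onB; apply: cont_Q; clear -g1 g2 wn0; lra.
  move=> y' hy'; have [|_ N1] := near a' y' _ hy'; first by rewrite lexx lerDl.
  have [|_ N2] := near (a' + wn) y' _ hy'; first by rewrite lexx lerDl wn0.
  have -> : Q (a' + wn) y' - Q a' y' - q * wn =
    (Q (a' + wn) y' - Q x y - q * (a' + wn - x) - q' * (y' - y)) -
    (Q a' y' - Q x y - q * (a' - x) - q' * (y' - y)) by ring.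
  by rewrite (le_trans (ler_normB _ _))//; clear -N1 N2; lra.
rewrite /circulation; set I1 := itv_int _ _ _ in B1 *; set I2 := itv_int _ _ _ in B2 *.
have -> : I1 + I2 = (I1 - (- q * hn) * (a' + wn - a')) + (I2 - q * wn * (c' + hn - c')).
  by ring.
apply: (le_lt_trans (ler_normD _ _)); apply: (le_lt_trans (lerD B1 B2)).
have -> : e * (wn + hn) * 2 * (a' + wn - a') + e * (wn + hn) * 2 * (c' + hn - c') =
  2 * e * (wn + hn) ^+ 2 by ring.
have E4 : (4 : R) ^+ n = 2 ^+ n ^+ 2 by rewrite -exprM mulnC exprM expr2 -natrM.
apply: (@le_lt_trans _ _ (2 * e * (W / 2 ^+ n) ^+ 2)).
  apply: ler_wpM2l; first by rewrite mulr_ge0// ltW.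
  rewrite EW.
  by apply: lerXn2r; rewrite ?nnegrE; clear -wn0 hn0 i2; lra.
have -> : 2 * e * (W / 2 ^+ n) ^+ 2 = r / 4 ^+ n / 2.
  rewrite E4 /e; field; rewrite ?gt_eqF//.
have : 0 < r / 4 ^+ n by rewrite divr_gt0// exprn_gt0.
by clear; set t := r / _; lra.
Qed.

End Rectangle.
End Goursat.

(** * Circles in logarithmic coordinates *)

Section CircleIntegral.
Variable R : realType.
Local Notation C := (R[i]).
Implicit Types (z w : C) (x y r s t : R) (f g : C -> C) (a b : nat -> C).

Definition circ r t : C := cpt (r * cos t) (r * sin t).

Lemma circE r t : circ r t = r%:C%C * circ 1 t.
Proof. by apply/eqP; rewrite eq_complex /=; apply/andP; split; apply/eqP; ring. Qed.

Lemma cabs_circ r t : cabs (circ r t) = `|r|.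
Proof.
by rewrite /cabs /= !exprMn -mulrDr cos2Dsin2 mulr1 sqrtr_sqr.
Qed.

Lemma circM r r' t t' : circ r t * circ r' t' = circ (r * r') (t + t').
Proof.
by apply/eqP; rewrite eq_complex /= cosD sinD; apply/andP; split; apply/eqP; ring.
Qed.

Lemma circ_2pi r : circ r (2 * pi) = circ r 0.
Proof. by rewrite /circ mulr_natl cos2pi sin2pi cos0 sin0. Qed.

Lemma derive_eps (f : R -> R) x d : is_derive x 1 f d -> forall e, 0 < e ->
  exists2 dl : R, 0 < dl & forall h, `|h| < dl -> `|f (x + h) - f x - d * h| <= e * `|h|.
Proof.
move=> [Hf Hd] e e0; move: Hf => /cvg_ex [l Hl].
have ld : l = d by rewrite -Hd; apply/esym/cvg_lim.
have /cvgrPdist_le/(_ e e0) [dl /= dl0 H] := Hl.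
exists dl => // h hd; have [->|h0] := eqVneq h 0.
  by rewrite addr0 mulr0 !subrr normr0 mulr0.
have := H h; rewrite /= sub0r normrN => /(_ hd h0).
rewrite /GRing.scale /= mulr1 ld addrC [h + x]addrC => H1.
have -> : f (x + h) - f x - d * h = (- d + h^-1 * (f (x + h) - f x)) * h.
  by rewrite mulrDl mulNr [h^-1 * _]mulrC divfK//; ring.
rewrite normrM ler_wpM2r//; move: H1; congr (_ <= _).
by rewrite -normrN; congr (`|_|); ring.
Qed.

(** [circ (expR x) y] is exp (x + i y); this is its derivative at 0, which multiplicativity
    ([circM]) carries to every point. *)
Lemma circ_exp_near1 e : 0 < e -> exists2 dl : R, 0 < dl & forall x y,
  `|x| < dl -> `|y| < dl ->
  cabs (circ (expR x) y - 1 - Complex x y) <= e * (`|x| + `|y|).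
Proof.
move=> e0; have e8 : 0 < e / 8 by rewrite divr_gt0.
have [d1 d10 H1] := derive_eps (is_derive_expR (0 : R)) e8.
have [d2 d20 H2] := derive_eps (is_derive_cos (0 : R)) e8.
have [d3 d30 H3] := derive_eps (is_derive_sin (0 : R)) e8.
have [d4 d40 H4] := derive_eps (is_derive_expR (0 : R)) (ltr01 : 0 < 1 :> R).
exists (Num.min (Num.min d1 d2) (Num.min d3 (Num.min d4 (Num.min 1 (e / 8))))).
  by rewrite !lt_min d10 d20 d30 d40 ltr01.
move=> x y; rewrite !lt_min => /and3P[/andP[x1 x2] x3 /and3P[x4 x5 x6]].
move=> /and3P[/andP[y1 y2] y3 /and3P[y4 y5 y6]].
have {}H1 := H1 x x1; have {}H2 := H2 y y2; have {}H3 := H3 y y3; have {}H4 := H4 x x4.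
rewrite !add0r expR0 ?cos0 ?sin0 ?mul1r ?subr0 ?oppr0 ?mul0r in H1 H2 H3 H4.
rewrite subr0 in H2.
have ex : 0 < expR x := expR_gt0 x.
have ex4 : `|expR x - 1| <= 2 * `|x|.
  have -> : expR x - 1 = (expR x - 1 - x) + x by ring.
  by rewrite (le_trans (ler_normD _ _))//; lra.
have ex3 : expR x <= 3.
  have : expR x - 1 <= `|expR x - 1| by exact: ler_norm.
  by lra.
have Re_le : `|expR x * cos y - 1 - x| <= e / 8 * `|x| + 3 * (e / 8 * `|y|).
  have -> : expR x * cos y - 1 - x = (expR x - 1 - x) + expR x * (cos y - 1) by ring.
  rewrite (le_trans (ler_normD _ _))// lerD// normrM (gtr0_norm ex).
  by rewrite ler_pM// ltW.
have Im_le : `|expR x * sin y - y| <= 3 * (e / 8 * `|y|) + e / 4 * `|y|.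
  have -> : expR x * sin y - y = expR x * (sin y - y) + (expR x - 1) * y by ring.
  rewrite (le_trans (ler_normD _ _))// lerD//.
    by rewrite normrM (gtr0_norm ex) ler_pM// ltW.
  by rewrite normrM ler_wpM2r// (le_trans ex4)//; lra.
rewrite (le_trans (cabs_le_ReIm _))//=.
rewrite subr0 (le_trans (lerD Re_le Im_le))//.
have := normr_ge0 x; have := normr_ge0 y; move: (`|x|) (`|y|) => X Y Y0 X0.
by clear -X0 Y0 e0; nra.
Qed.

Lemma circ_exp_diff s t e : 0 < e -> exists2 dl : R, 0 < dl & forall s' t',
  `|s' - s| < dl -> `|t' - t| < dl ->
  cabs (circ (expR s') t' - circ (expR s) t - circ (expR s) t * Complex (s' - s) (t' - t))
   <= e * (`|s' - s| + `|t' - t|).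
Proof.
move=> e0; have es := expR_gt0 s.
have [dl dl0 H] := circ_exp_near1 (divr_gt0 e0 es).
exists dl => // s' t' hs ht; have := H _ _ hs ht.
have -> : circ (expR s') t' = circ (expR s) t * circ (expR (s' - s)) (t' - t).
  by rewrite circM -expRD !subrKC.
have E z w u : z * w - z - z * u = z * (w - 1 - u) by ring.
rewrite E; set w := _ - _ - _ => Hw; rewrite cabsM cabs_circ gtr0_norm//.
by rewrite (le_trans (ler_wpM2l (ltW es) Hw))// mulrA mulrCA divff ?mulr1// gt_eqF.
Qed.

Lemma cholo_circ_exp f s t d : cdiff f (circ (expR s) t) d -> forall e, 0 < e ->
  exists2 dl : R, 0 < dl & forall s' t', `|s' - s| < dl -> `|t' - t| < dl ->
  cabs (f (circ (expR s') t') - f (circ (expR s) t) -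
    d * circ (expR s) t * Complex (s' - s) (t' - t)) <= e * (`|s' - s| + `|t' - t|).
Proof.
move=> Hf e e0; have es := expR_gt0 s; have kd : 0 < 1 + cabs d.
  by rewrite ltr_wpDr// cabs_ge0.
set z0 := circ (expR s) t in Hf *.
have ks : 0 < 1 + expR s by rewrite addr_gt0.
have [d1 d10 H1] := circ_exp_diff s t (divr_gt0 (divr_gt0 e0 (ltr0n R 2)) kd).
have [d2 d20 H2] := circ_exp_diff s t (ltr01 : 0 < 1 :> R).
have [d3 d30 H3] := Hf _ (divr_gt0 (divr_gt0 e0 (ltr0n R 2)) ks).
exists (Num.min (Num.min d1 d2) (d3 / 2 / (1 + expR s))).
  by rewrite !lt_min d10 d20 !divr_gt0.
move=> s' t'; rewrite !lt_min => /andP[/andP[s1 s2] s3] /andP[/andP[t1 t2] t3].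
have {}H1 := H1 _ _ s1 t1; have {}H2 := H2 _ _ s2 t2.
rewrite -/z0 in H1 H2; set z := circ (expR s') t' in H1 H2 *.
set u := Complex _ _ in H1 H2 *; set N := `|s' - s| + `|t' - t| in H1 H2 *.
have uN : cabs u <= N by rewrite (le_trans (cabs_le_ReIm _)).
have zz : cabs (z - z0) <= (1 + expR s) * N.
  have -> : z - z0 = (z - z0 - z0 * u) + z0 * u by ring.
  rewrite (le_trans (ler_cabsD _ _))// mulrDl lerD// cabsM cabs_circ gtr0_norm//.
  by rewrite ler_pM2l.
have zd : cabs (z - z0) < d3.
  rewrite (le_lt_trans zz)// -ltr_pdivlMl//; rewrite !ltr_pdivlMr// in s3 t3 *.
  by rewrite mulrC ltr_pdivlMr// /N mulrDl; lra.
have -> : f z - f z0 - d * z0 * u = (f z - f z0 - d * (z - z0)) + d * (z - z0 - z0 * u).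
  by ring.
rewrite (le_trans (ler_cabsD _ _))// [e]splitr mulrDl lerD//.
  rewrite (le_trans (H3 _ zd))// (le_trans (ler_wpM2l _ zz))//.
    by rewrite ltW// !divr_gt0.
  by rewrite mulrA divfK// gt_eqF.
rewrite cabsM (le_trans (ler_wpM2l (cabs_ge0 _) H1))// mulrA ler_wpM2r//.
  by rewrite addr_ge0.
by rewrite mulrC mulrAC ler_pdivrMr// ler_pM2l ?lerDr// divr_gt0.
Qed.

End CircleIntegral.

(** * Means over circles and their independence of the radius *)

Section CircleMean.
Variable R : realType.
Local Notation C := (R[i]).
Implicit Types (z w : C) (x y r s t : R) (f g : C -> C) (a b : nat -> C).

Definition ccont g z := forall e : R, 0 < e -> exists2 dl : R, 0 < dl &
  forall w, cabs (w - z) < dl -> cabs (g w - g z) < e.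

Lemma circ_exp_cont g s t : ccont g (circ (expR s) t) -> forall e, 0 < e ->
  exists2 dl : R, 0 < dl & forall s' t', `|s' - s| < dl -> `|t' - t| < dl ->
  cabs (g (circ (expR s') t') - g (circ (expR s) t)) < e.
Proof.
move=> Hg e e0; have [d1 d10 H1] := Hg e e0; have es := expR_gt0 s.
have ks : 0 < 1 + expR s by rewrite addr_gt0.
have [d2 d20 H2] := circ_exp_diff s t (ltr01 : 0 < 1 :> R).
exists (Num.min d2 (d1 / 2 / (1 + expR s))); first by rewrite lt_min d20 !divr_gt0.
move=> s' t'; rewrite !lt_min => /andP[s1 s2] /andP[t1 t2]; apply: H1.
have := H2 _ _ s1 t1; rewrite mul1r.
set z := circ (expR s') t'; set z0 := circ (expR s) t; set u := Complex _ _ => H.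
have -> : z - z0 = (z - z0 - z0 * u) + z0 * u by ring.
rewrite (le_lt_trans (ler_cabsD _ _))// cabsM cabs_circ gtr0_norm//.
have uN : cabs u <= `|s' - s| + `|t' - t| by rewrite (le_trans (cabs_le_ReIm _)).
rewrite !ltr_pdivlMr// in s2 t2.
by have := ler_pM2l es (cabs u) (`|s' - s| + `|t' - t|); rewrite uN => H'; nra.
Qed.

Definition circ_cont g r := cont_on (fun t => complex.Re (g (circ r t))) 0 (2 * pi) /\
  cont_on (fun t => complex.Im (g (circ r t))) 0 (2 * pi).

Lemma ccont_circ g r : 0 < r -> (forall z, cabs z = r -> ccont g z) -> circ_cont g r.
Proof.
move=> r0 Hg; have rE : r = expR (ln r) by rewrite lnK.
have H t e : 0 < e -> exists2 dl : R, 0 < dl & forall t', `|t' - t| < dl ->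
    cabs (g (circ r t') - g (circ r t)) < e.
  move=> e0; have Ht : ccont g (circ (expR (ln r)) t).
    by rewrite -rE; apply: Hg; rewrite cabs_circ gtr0_norm.
  have [dl dl0 H] := circ_exp_cont Ht e0; exists dl => // t' tt'.
  by have := H (ln r) t'; rewrite -rE subrr normr0; apply.
split=> t _ e e0; have [dl dl0 Hd] := H t e e0; exists dl => // t' _ /Hd.
  by rewrite -cReB; exact: le_lt_trans (ler_Re_cabs _).
by rewrite -cImB; exact: le_lt_trans (ler_Im_cabs _).
Qed.

Lemma cholo_circ g r : 0 < r -> (forall z, cabs z = r -> cholo g z) -> circ_cont g r.
Proof. by move=> r0 Hg; apply: ccont_circ => // z zr; apply/cholo_cont/Hg. Qed.

(** Equal to the contour integral of g(z) dz / (2 pi i z), so that Cauchy integrals become means. *)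
Definition cmean r g : C :=
  Complex ((2 * pi)^-1 * itv_int (fun t => complex.Re (g (circ r t))) 0 (2 * pi))
          ((2 * pi)^-1 * itv_int (fun t => complex.Im (g (circ r t))) 0 (2 * pi)).

Lemma eq_cmean r f g : (forall z, cabs z = `|r| -> f z = g z) -> cmean r f = cmean r g.
Proof.
move=> fg; rewrite /cmean; congr (Complex (_ * _) (_ * _)); apply: itv_int_eq => t _.
  by rewrite fg// cabs_circ.
by rewrite fg// cabs_circ.
Qed.

Let pi2 : 0 < 2 * pi :> R. Proof. by rewrite mulr_gt0// pi_gt0. Qed.

Lemma cmeanD r f g : circ_cont f r -> circ_cont g r ->
  cmean r (fun z => f z + g z) = cmean r f + cmean r g.
Proof.
move=> [f1 f2] [g1 g2]; rewrite /cmean.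
under itv_int_eq do rewrite cReD; under [X in Complex _ (_ * X)]itv_int_eq do rewrite cImD.
by rewrite !itv_intD//; apply/eqP; rewrite eq_complex /= !mulrDr !eqxx.
Qed.

Lemma cont_onD (u v : R -> R) (x0 y0 : R) : cont_on u x0 y0 -> cont_on v x0 y0 ->
  cont_on (fun x => u x + v x) x0 y0.
Proof.
move=> Hu Hv x xab e e0; have e2 : 0 < e / 2 by rewrite divr_gt0.
have [d1 d10 H1] := Hu x xab _ e2; have [d2 d20 H2] := Hv x xab _ e2.
exists (Num.min d1 d2) => [|y yab]; first by rewrite lt_min d10.
rewrite lt_min => /andP[/(H1 _ yab) h1 /(H2 _ yab) h2].
by rewrite opprD addrACA (le_lt_trans (ler_normD _ _))// [e]splitr ltrD.
Qed.

Lemma cont_onZ k (u : R -> R) (x0 y0 : R) : cont_on u x0 y0 ->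
  cont_on (fun x => k * u x) x0 y0.
Proof.
move=> Hu x xab e e0; have k0 : 0 < `|k| + 1 by rewrite ltr_wpDl.
have [dl dl0 H] := Hu x xab _ (divr_gt0 e0 k0); exists dl => // y yab /(H _ yab).
rewrite ltr_pdivlMr// mulrC -mulrBr normrM; apply: le_lt_trans.
by rewrite ler_wpM2r// lerDl.
Qed.

Lemma circ_contD r f g : circ_cont f r -> circ_cont g r ->
  circ_cont (fun z => f z + g z) r.
Proof.
move=> [f1 f2] [g1 g2]; split.
  by under eq_fun do rewrite cReD; exact: cont_onD.
by under eq_fun do rewrite cImD; exact: cont_onD.
Qed.

Lemma circ_contZ r (c : C) f : circ_cont f r -> circ_cont (fun z => c * f z) r.
Proof.
move=> [f1 f2]; split.
  under eq_fun do rewrite cReM -mulNr; exact: cont_onD (cont_onZ _ f1) (cont_onZ _ f2).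
under eq_fun do rewrite cImM; exact: cont_onD (cont_onZ _ f2) (cont_onZ _ f1).
Qed.

Lemma circ_cont_cst r (c : C) : circ_cont (fun=> c) r.
Proof. by split; exact: cont_on_cst. Qed.

Lemma circ_cont_sum r n (F : nat -> C -> C) : (forall i, circ_cont (F i) r) ->
  circ_cont (fun z => \sum_(i < n) F i z) r.
Proof.
move=> HF; elim: n => [|n IH].
  by under eq_fun do rewrite big_ord0; exact: circ_cont_cst.
have -> : (fun z => \sum_(i < n.+1) F i z) = (fun z => (\sum_(i < n) F i z) + F n z).
  by apply/funext => z; rewrite big_ord_recr.
exact: circ_contD.
Qed.

Lemma cmeanZ r (c : C) f : circ_cont f r -> cmean r (fun z => c * f z) = c * cmean r f.
Proof.
move=> [f1 f2]; apply/eqP; rewrite eq_complex /= cReM cImM /=.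
under itv_int_eq do rewrite cReM; under [X in _ && (_ * X == _)]itv_int_eq do rewrite cImM.
rewrite itv_intB ?itv_intD ?itv_intZ//; try exact: cont_onZ.
by apply/andP; split; apply/eqP; ring.
Qed.

Lemma cmean_cst r (c : C) : cmean r (fun=> c) = c.
Proof.
apply/eqP; rewrite eq_complex /= !itv_int_cst ?(ltW pi2)// subr0.
have E k : (2 * pi)^-1 * (k * (2 * pi)) = k :> R.
  by rewrite mulrCA mulVf ?mulr1 ?gt_eqF.
by rewrite !E !eqxx.
Qed.

Lemma cmean_sum r n (F : nat -> C -> C) : (forall i, circ_cont (F i) r) ->
  cmean r (fun z => \sum_(i < n) F i z) = \sum_(i < n) cmean r (F i).
Proof.
move=> HF; elim: n => [|n IH].
  by under eq_fun do rewrite big_ord0; rewrite cmean_cst big_ord0.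
have -> : (fun z => \sum_(i < n.+1) F i z) = (fun z => (\sum_(i < n) F i z) + F n z).
  by apply/funext => z; rewrite big_ord_recr.
by rewrite cmeanD ?IH ?big_ord_recr//; exact: circ_cont_sum.
Qed.

(** The factor 2 comes from bounding the real and imaginary parts separately. *)
Lemma cmean_bound r f M : circ_cont f r -> (forall t, 0 <= t <= 2 * pi -> cabs (f (circ r t)) <= M) ->
  cabs (cmean r f) <= 2 * M.
Proof.
move=> [f1 f2] HM; have i2 : 0 < (2 * pi)^-1 :> R by rewrite invr_gt0.
have H (u : R -> R) : cont_on u 0 (2 * pi) -> (forall t, 0 <= t <= 2 * pi -> `|u t| <= M) ->
    `|(2 * pi)^-1 * itv_int u 0 (2 * pi)| <= M.
  move=> Hu uM; have := @itv_int_near R u 0 M 0 (2 * pi) (ltW pi2) Hu.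
  rewrite mul0r !subr0 normrM (gtr0_norm i2) => Hn.
  rewrite mulrC ler_pdivrMr//; apply: Hn => t ht; rewrite subr0; exact: uM.
have -> : 2 * M = M + M by ring.
rewrite (le_trans (cabs_le_ReIm _))//= lerD// H// => t ht.
  by rewrite (le_trans (ler_Re_cabs _))// HM.
by rewrite (le_trans (ler_Im_cabs _))// HM.
Qed.

Let K g s t := g (circ (expR s) t).

(* In the coordinates [z = exp (s + i t)], [g dz / z] is a closed form on a rectangle, whose two sides
   [t = 0] and [t = 2 pi] cancel by periodicity. *)
Lemma cmean_const g r1 r2 : 0 < r1 -> r1 <= r2 ->
  (forall z, r1 <= cabs z <= r2 -> cholo g z) -> cmean r1 g = cmean r2 g.
Proof.
move=> r10 r12 Hg; have r20 : 0 < r2 := lt_le_trans r10 r12.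
pose s1 := ln r1; pose s2 := ln r2.
have [E1 E2] : expR s1 = r1 /\ expR s2 = r2 by rewrite !lnK.
have s12 : s1 <= s2 by rewrite -ler_expR E1 E2.
have Hd s t : s1 <= s <= s2 -> exists k : C, forall e : R, 0 < e -> exists2 dl : R, 0 < dl &
    forall s' t', `|s' - s| < dl -> `|t' - t| < dl ->
    cabs (K g s' t' - K g s t - k * Complex (s' - s) (t' - t)) <= e * (`|s' - s| + `|t' - t|).
  move=> /andP[h1 h2]; have [|d Hd] := (@choloP R g (circ (expR s) t)).1.
    by apply: Hg; rewrite cabs_circ gtr0_norm ?expR_gt0// -E1 -E2 !ler_expR h1.
  by exists (d * circ (expR s) t); exact: cholo_circ_exp Hd.
(* With G = g (exp (s + i t)), the form is G (ds + i dt). Here is minus its real part, and then its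
   imaginary part; a complex-linear derivative k makes the mixed coefficients agree. *)
have HRe : closed_form (fun s t => - complex.Re (K g s t)) (fun s t => complex.Im (K g s t))
    s1 s2 0 (2 * pi).
  move=> s t sab _; have [k Hk] := Hd s t sab.
  exists (- complex.Re k), (complex.Im k), (complex.Re k) => e e0.
  have [dl dl0 H] := Hk e e0; exists dl => // s' t' _ _ hs ht; have {}H := H _ _ hs ht.
  split; apply: le_trans H.
    rewrite (le_trans _ (ler_Re_cabs _))// !cReB cReM /= -normrN le_eqVlt; apply/orP; left.
    by apply/eqP; congr (`|_|); ring.
  rewrite (le_trans _ (ler_Im_cabs _))// !cImB cImM /= le_eqVlt; apply/orP; left.
  by apply/eqP; congr (`|_|); ring.
have HIm : closed_form (fun s t => complex.Im (K g s t)) (fun s t => complex.Re (K g s t))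
    s1 s2 0 (2 * pi).
  move=> s t sab _; have [k Hk] := Hd s t sab.
  exists (complex.Im k), (complex.Re k), (- complex.Im k) => e e0.
  have [dl dl0 H] := Hk e e0; exists dl => // s' t' _ _ hs ht; have {}H := H _ _ hs ht.
  split; apply: le_trans H.
    rewrite (le_trans _ (ler_Im_cabs _))// !cImB cImM /= le_eqVlt; apply/orP; left.
    by apply/eqP; congr (`|_|); ring.
  rewrite (le_trans _ (ler_Re_cabs _))// !cReB cReM /= le_eqVlt; apply/orP; left.
  by apply/eqP; congr (`|_|); ring.
have Kper s : K g s 0 = K g s (2 * pi) by rewrite /K circ_2pi.
have zero (u : R -> R -> R) : (forall x, u x 0 = u x (2 * pi)) ->
    itv_int (fun x => u x 0 - u x (2 * pi)) s1 s2 = 0.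
  by move=> Hu; under itv_int_eq do rewrite Hu subrr; rewrite itv_int_cst// mul0r.
have b1 : s1 <= s1 <= s2 by rewrite lexx.
have b2 : s1 <= s2 <= s2 by rewrite lexx andbT.
apply/eqP; rewrite eq_complex /=; apply/andP; split; apply/eqP; congr (_ * _).
  have := goursat HIm s12 (ltW pi2).
  rewrite /circulation (zero (fun s t => complex.Im (K g s t))); last first.
    by move=> x; rewrite Kper.
  rewrite add0r (itv_intB (cont_Q HIm b2) (cont_Q HIm b1)) /K E1 E2.
  by move/eqP; rewrite subr_eq0 => /eqP ->.
have := goursat HRe s12 (ltW pi2).
rewrite /circulation (zero (fun s t => - complex.Re (K g s t))); last first.
  by move=> x; rewrite Kper.
rewrite add0r (itv_intB (cont_Q HRe b2) (cont_Q HRe b1)) /K E1 E2.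
by move/eqP; rewrite subr_eq0 => /eqP ->.
Qed.

End CircleMean.

(** * Cauchy's formula for the difference quotient *)

Section CauchyFormula.
Variable R : realType.
Local Notation C := (R[i]).
Local Notation mu := (@lebesgue_measure R).
Implicit Types (z w : C) (r s t : R) (f g : C -> C).

Lemma rect_bounded (G : R -> R -> R) (a b c d : R) :
  (forall x y, a <= x <= b -> c <= y <= d -> forall e, 0 < e ->
    exists2 dl : R, 0 < dl & forall x' y', `|x' - x| < dl -> `|y' - y| < dl ->
    `|G x' y' - G x y| < e) ->
  exists M, forall x y, a <= x <= b -> c <= y <= d -> `|G x y| <= M.
Proof.
move=> HG; pose F (p : R * R) := G p.1 p.2.
pose A : set (R * R) := `[a, b]%classic `*` `[c, d]%classic.
have cA : compact A by apply: compact_setX; exact: segment_compact.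
have cF : {within A, continuous F}.
  apply/subspace_continuousP => -[x y] [/=]; rewrite !in_itv /= => xab ycd.
  apply/cvgrPdist_lt => e e0; have [dl dl0 H] := HG x y xab ycd e e0.
  rewrite /within /=; exists (ball x dl, ball y dl); first by split; exact: nbhsx_ballx.
  move=> [x' y'] /= [hx hy] _; rewrite distrC; apply: H; rewrite distrC.
    exact: hx.
  exact: hy.
have /compact_bounded [M [_ HM]] := continuous_compact cF cA.
exists (M + 1) => x y xab ycd; apply: (HM (M + 1)); first by rewrite ltrDl.
by exists (x, y) => //; split; rewrite /= in_itv.
Qed.

Lemma cmean_exp_cont k s : (forall z, cabs z < 1 -> ccont k z) -> s < 0 ->
  forall e, 0 < e -> exists2 dl : R, 0 < dl & forall s', `|s' - s| < dl ->
  cabs (cmean (expR s') k - cmean (expR s) k) < e.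
Proof.
move=> Hk s0.
have Hk' s' t : s' < 0 -> ccont k (circ (expR s') t).
  by move=> s'0; apply: Hk; rewrite cabs_circ gtr0_norm ?expR_gt0// expR_lt1.
have circ_k s' : s' < 0 -> circ_cont k (expR s').
  move=> s'0; apply: ccont_circ => [|z zr]; first exact: expR_gt0.
  by apply: Hk; rewrite zr expR_lt1.
have part (p : C -> R) : (forall z w, p (z - w) = p z - p w) ->
    (forall z, `|p z| <= cabs z) ->
    (forall s', s' < 0 -> cont_on (fun t => p (k (circ (expR s') t))) 0 (2 * pi)) ->
    forall e, 0 < e -> exists2 dl : R, 0 < dl & forall s', `|s' - s| < dl ->
    `|itv_int (fun t => p (k (circ (expR s') t))) 0 (2 * pi) -
      itv_int (fun t => p (k (circ (expR s) t))) 0 (2 * pi)| < e.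
  move=> pB pc Hc e e0.
  (* Since s < 0, all log-radii in [s - 1, s / 2] are negative: the circles stay in the disc, and a
     constant dominates the integrand. *)
  have [|M HM] := @rect_bounded (fun s t => p (k (circ (expR s) t))) (s - 1) (s / 2) 0 (2 * pi).
    move=> x y hx hy e' e'0; have [|dl dl0 H] := @circ_exp_cont _ k x y _ e' e'0.
      by apply: Hk'; lra.
    by exists dl => // x' y' hx' hy'; rewrite -pB (le_lt_trans (pc _))// H.
  have cI : {in `]s - 1, s / 2[%classic, continuous (fun l =>
      \int[mu]_(t in `[0, 2 * pi]) p (k (circ (expR l) t)))}.
    apply: (@continuity_under_integral R _ _ mu (fun s t => p (k (circ (expR s) t)))
      `[0, 2 * pi]%classic (measurable_itv _) (s - 1) (s / 2) _ _ (fun=> M)).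
    - by move=> x /=; rewrite in_itv /= => hx; apply/cont_on_integrable/Hc; lra.
    - apply: aeW => t _ x /set_mem; rewrite /= in_itv /= => hx.
      apply/cvgrPdist_lt => e' e'0; have [|dl dl0 H] := @circ_exp_cont _ k x t _ e' e'0.
        by apply: Hk'; lra.
      exists dl => //= y hy; rewrite distrC -pB (le_lt_trans (pc _))// H//.
        by rewrite distrC.
      by rewrite subrr normr0.
    - exact/cont_on_integrable/cont_on_cst.
    - by move=> x /=; rewrite in_itv /= => hx; apply: aeW => t /=; rewrite in_itv /= => ht; apply: HM; lra.
  have /cvgrPdist_lt/(_ e e0) [dl /= dl0 H] := cI s ltac:(by rewrite inE /= in_itv /=; lra).
  by exists dl => // s' hs; rewrite distrC; apply: H; rewrite /= distrC.
move=> e e0; have e2 : 0 < e * pi by rewrite mulr_gt0// pi_gt0.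
have p2 : 0 < 2 * pi :> R by rewrite mulr_gt0// pi_gt0.
have [d1 d10 H1] := part (@complex.Re R) (@cReB R) (@ler_Re_cabs R)
  (fun s' h => (circ_k s' h).1) _ e2.
have [d2 d20 H2] := part (@complex.Im R) (@cImB R) (@ler_Im_cabs R)
  (fun s' h => (circ_k s' h).2) _ e2.
exists (Num.min d1 d2) => [|s']; first by rewrite lt_min d10.
rewrite lt_min => /andP[/H1 {}H1 /H2 {}H2].
rewrite (le_lt_trans (cabs_le_ReIm _))// cReB cImB /= -!mulrBr !normrM -mulrDr.
rewrite gtr0_norm ?invr_gt0// ltr_pdivrMl// [2 * pi * e]mulrAC.
have -> : 2 * e * pi = e * pi + e * pi by ring.
exact: ltrD.
Qed.

Lemma cmean_small k r0 : 0 < r0 -> r0 < 1 -> (forall z, cabs z < 1 -> ccont k z) ->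
  (forall z, 0 < cabs z -> cabs z <= r0 -> cholo k z) ->
  (forall e : R, 0 < e -> exists2 dl : R, 0 < dl & forall z, cabs z < dl -> cabs (k z) <= e) ->
  cmean r0 k = 0.
Proof.
move=> r00 r01 ck Hk k0; apply/eqP; rewrite -cabs_eq0; apply/eqP/le_anti.
rewrite cabs_ge0 andbT; apply/ler_addgt0Pr => e e0; rewrite add0r.
have [dl dl0 H] := k0 _ (divr_gt0 e0 (ltr0n R 2)).
pose r := Num.min (dl / 2) r0.
have r_gt0 : 0 < r by rewrite lt_min divr_gt0.
have r_le : r <= r0 by rewrite ge_min lexx orbT.
have r_lt : r < dl by rewrite gt_min; apply/orP; left; lra.
rewrite -(@cmean_const _ k r r0)//; last first.
  by move=> z /andP[h1 h2]; apply: Hk => //; exact: lt_le_trans h1.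
have -> : e = 2 * (e / 2) by field.
apply: cmean_bound => [|t _]; last by apply: H; rewrite cabs_circ gtr0_norm.
by apply: ccont_circ => // z zr; apply: ck; rewrite zr (le_lt_trans r_le).
Qed.

(* The mean is independent of the radius on either side of the circle through [w], continuous across
   that circle, and tends to [0] with the radius. *)
Lemma cauchy_zero f w r : analytic_disc f -> cabs w < r -> r < 1 ->
  cmean r (fun z => z * ((f z - f w) / (z - w))) = 0.
Proof.
move=> Hf wr r1; have r0 : 0 < r := le_lt_trans (cabs_ge0 w) wr.
have w1 : cabs w < 1 := lt_trans wr r1.
have /choloP [d Hd] := Hf w w1.
pose q z := if z == w then d else (f z - f w) / (z - w).
pose k z := z * q z.
have far z (dl : R) : z != w -> dl = cabs (z - w) -> 0 < dl /\ forall v, cabs (v - z) < dl -> (f v - f w) / (v - w) = q v.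
  move=> zw ->; rewrite cabs_gt0 subr_eq0; split=> // v hv; rewrite /q ifN//.
  by apply: contraTneq hv => ->; rewrite cabsB ltxx.
have holo_q z : cabs z < 1 -> z != w -> cholo (fun v => (f v - f w) / (v - w)) z.
  move=> z1 zw.
  have h1 : cholo (fun v => f v - f w) z := choloB (Hf z z1) (@cholo_cst R (f w) z).
  have h2 : cholo (fun v => v - w) z := choloB (@cholo_id R z) (@cholo_cst R w z).
  have h3 : cholo (fun v => (v - w)^-1) z by apply: choloV => //; rewrite subr_eq0.
  exact: (choloM h1 h3).
have holo_k z : cabs z < 1 -> z != w -> cholo k z.
  move=> z1 zw; have [d0 Hq] := far z _ zw erefl.
  exact: (choloM (@cholo_id R z) (cholo_near d0 Hq (holo_q z z1 zw))).
have cont_q z : cabs z < 1 -> ccont q z.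
  move=> z1; have [->|zw] := eqVneq z w; last first.
    have [d0 Hq] := far z _ zw erefl; apply: cholo_cont.
    exact: (cholo_near d0 Hq (holo_q z z1 zw)).
  move=> e e0; have [dl dl0 H] := Hd _ (divr_gt0 e0 (ltr0n R 2)).
  exists dl => // v hv; rewrite /q eqxx; have [_|vw] := eqVneq v w.
    by rewrite subrr cabs0.
  have v0 : 0 < cabs (v - w) by rewrite cabs_gt0 subr_eq0.
  apply: (@le_lt_trans _ _ (e / 2)); last by lra.
  rewrite -(ler_pM2r v0) -cabsM mulrBl divfK ?subr_eq0//; exact: H.
have cont_k z : cabs z < 1 -> ccont k z.
  move=> z1 e e0; have [dq dq0 Hq1] := cont_q z z1 1 ltr01.
  have kq : 0 < cabs (q z) + 1 by rewrite ltr_wpDl ?cabs_ge0.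
  have [d2 d20 Hq2] := cont_q z z1 _ (divr_gt0 e0 (ltr0n R 2)).
  exists (Num.min dq (Num.min d2 (e / 2 / (cabs (q z) + 1)))).
    by rewrite !lt_min dq0 d20 !divr_gt0.
  move=> v; rewrite !lt_min => /and3P[/Hq1 h1 /Hq2 h2]; rewrite ltr_pdivlMr// => h3.
  have -> : k v - k z = (v - z) * q v + z * (q v - q z) by rewrite /k; ring.
  rewrite (le_lt_trans (ler_cabsD _ _))// !cabsM [e]splitr ltr_leD//.
    apply: le_lt_trans h3; rewrite ler_wpM2l ?cabs_ge0//.
    by rewrite (le_trans (ler_cabs_dist _ (q z)))// lerD2l ltW.
  by rewrite -[leRHS]mul1r ler_pM ?cabs_ge0// ltW.
have k_small e : 0 < e -> exists2 dl : R, 0 < dl & forall z, cabs z < dl -> cabs (k z) <= e.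
  move=> e0; have [|dl dl0 H] := cont_k 0 _ e e0; first by rewrite cabs0.
  exists dl => // z hz; have := H z; rewrite subr0 => /(_ hz).
  by rewrite {2}/k mul0r subr0 => /ltW.
transitivity (cmean r k).
  by apply: eq_cmean => z; rewrite gtr0_norm// => zr; rewrite /k /q ifN//; apply: contraTneq wr => <-; rewrite zr ltxx.
have inner t : 0 < t -> t < 1 -> (t < cabs w \/ w = 0) -> cmean t k = 0.
  move=> t0 t1 tw; apply: (@cmean_small k t) => // z z0 zt; apply: holo_k.
    exact: le_lt_trans t1.
  case: tw => [tw|w0]; last by rewrite w0 -cabs_gt0.
  by apply: contraTneq tw => <-; rewrite -leNgt.
have [w0|w0] := eqVneq w 0; first by apply: inner => //; right.
have cw0 : 0 < cabs w by rewrite cabs_gt0.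
pose s := ln (cabs w); have Es : expR s = cabs w by rewrite lnK.
have s0 : s < 0 by rewrite -expR_lt1 Es.
have zero_w : cmean (cabs w) k = 0.
  apply/eqP; rewrite -cabs_eq0; apply/eqP/le_anti; rewrite cabs_ge0 andbT.
  apply/ler_addgt0Pr => e e0; rewrite add0r.
  have [dl dl0 H] := cmean_exp_cont cont_k s0 e0.
  have := H (s - dl / 2); rewrite Es inner; last 3 first.
  - exact: expR_gt0.
  - by rewrite expR_lt1; lra.
  - by left; rewrite -Es ltr_expR; lra.
  by rewrite sub0r cabsN => h; apply/ltW/h; rewrite ltr_norml; lra.
apply/eqP; rewrite -cabs_eq0; apply/eqP/le_anti; rewrite cabs_ge0 andbT.
apply/ler_addgt0Pr => e e0; rewrite add0r.
have [dl dl0 H] := cmean_exp_cont cont_k s0 e0.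
have sr : s < ln r by rewrite -ltr_expR Es lnK.
pose s' := Num.min (s + dl / 2) (ln r).
have s's : s < s' by rewrite lt_min sr andbT; lra.
have s'r : s' <= ln r by rewrite ge_min lexx orbT.
have s'd : s' <= s + dl / 2 by rewrite ge_min lexx.
have := H s'; rewrite Es zero_w subr0 (@cmean_const _ k (expR s') r) ?expR_gt0//.
- by move=> h; apply/ltW/h; rewrite ltr_norml; lra.
- by rewrite -[leRHS]lnK// ler_expR.
- move=> z /andP[h1 h2]; apply: holo_k; first exact: le_lt_trans r1.
  by apply: contraTneq h1 => ->; rewrite -ltNge -Es ltr_expR.
Qed.

End CauchyFormula.

(** * Taylor expansion of analytic functions *)

Section Taylor.
Variable R : realType.
Local Notation C := (R[i]).
Implicit Types (z w : C) (r s t : R) (f g : C -> C) (a b : nat -> C).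

Lemma cont_on_bounded (u : R -> R) (a b : R) : cont_on u a b ->
  exists M, forall x, a <= x <= b -> `|u x| <= M.
Proof.
move=> Hu; have /compact_bounded [M [_ HM]] :=
  continuous_compact (cont_on_within Hu) (segment_compact (a:=a) (b:=b)).
exists (M + 1) => x xab; apply: (HM (M + 1)); first by rewrite ltrDl.
by exists x => //; rewrite /= in_itv.
Qed.

Lemma circ_cont_bounded f r : circ_cont f r ->
  exists M, forall t, 0 <= t <= 2 * pi -> cabs (f (circ r t)) <= M.
Proof.
move=> [/cont_on_bounded [M1 H1] /cont_on_bounded [M2 H2]]; exists (M1 + M2) => t ht.
by rewrite (le_trans (cabs_le_ReIm _))// lerD ?H1 ?H2.
Qed.

Lemma analytic_cst (c : C) : analytic_disc (fun=> c).
Proof. by move=> z _; exact: cholo_cst. Qed.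

Lemma analytic_monom n : analytic_disc (fun z : C => z ^+ n).
Proof. by move=> z _; apply: (@choloX R id); exact: cholo_id. Qed.

Lemma analyticB f g : analytic_disc f -> analytic_disc g ->
  analytic_disc (fun z => f z - g z).
Proof. by move=> Hf Hg z z1; exact: (choloB (Hf z z1) (Hg z z1)). Qed.

Lemma analyticM f g : analytic_disc f -> analytic_disc g ->
  analytic_disc (fun z => f z * g z).
Proof. by move=> Hf Hg z z1; exact: (choloM (Hf z z1) (Hg z z1)). Qed.

Lemma analytic_sum n (F : nat -> C -> C) : (forall i, analytic_disc (F i)) ->
  analytic_disc (fun z => \sum_(i < n) F i z).
Proof. by move=> HF z z1; apply: cholo_sum => i; exact: HF. Qed.

Lemma analytic_circ_cont f r : analytic_disc f -> 0 <= r < 1 -> circ_cont f r.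
Proof.
move=> Hf /andP[]; rewrite le_eqVlt => /predU1P[<- _|r0 r1]; last first.
  by apply: cholo_circ => // z zr; apply: Hf; rewrite zr.
have E t : circ 0 t = 0 by rewrite /circ !mul0r.
by split; under eq_fun do rewrite E; exact: cont_on_cst.
Qed.

Lemma cmean_value f r : analytic_disc f -> 0 < r -> r < 1 -> cmean r f = f 0.
Proof.
move=> Hf r0 r1; have := @cauchy_zero R f 0 r Hf; rewrite cabs0 => /(_ r0 r1) H.
have r01 : 0 <= r < 1 by rewrite ltW.
have Hd : analytic_disc (fun z => f z - f 0).
  exact: (analyticB Hf (@analytic_cst (f 0))).
transitivity (cmean r (fun z => (f z - f 0) + f 0)).
  by apply: eq_cmean => z _; rewrite subrK.
rewrite cmeanD ?cmean_cst; [|exact: analytic_circ_cont|exact: circ_cont_cst].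
rewrite -[RHS]add0r; congr (_ + _); rewrite -[RHS]H.
apply: eq_cmean => z; rewrite gtr0_norm// => zr.
by rewrite subr0 mulrC divfK// -cabs_gt0 zr.
Qed.

(** Doubling the radius multiplies this mean by 2^-n, yet the mean does not depend on the radius;
    for n > 0 it must vanish. *)
Lemma cmean_monom_inv r n : 0 < r -> cmean r (fun z => z ^- n) = (n == 0)%:R.
Proof.
move=> r0; have [->|n0] := eqVneq n 0%N.
  by under eq_fun do rewrite expr0 invr1; rewrite cmean_cst.
have H z : z != 0 -> cholo (fun z : C => z ^- n) z.
  move=> z0; have := @choloX R id n z (@cholo_id R z) => Hn.
  exact: (@choloV R (fun z => z ^+ n) z (expf_neq0 n z0) Hn).
have cc s : 0 < s -> circ_cont (fun z : C => z ^- n) s.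
  by move=> s0; apply: cholo_circ => // z zs; apply: H; rewrite -cabs_gt0 zs.
have E : cmean r (fun z => z ^- n) = cmean (2 * r) (fun z => z ^- n).
  apply: cmean_const => //; first by rewrite ler_peMl ?(ltW r0)// ler1n.
  by move=> z /andP[h _]; apply: H; rewrite -cabs_gt0 (lt_le_trans r0).
have E2 : cmean (2 * r) (fun z => z ^- n) = 2 ^- n * cmean r (fun z => z ^- n).
  rewrite -cmeanZ; last exact: cc.
  rewrite /cmean; congr (Complex (_ * _) (_ * _)); apply: itv_int_eq => t _.
    by rewrite circE rmorphM /= [circ r t]circE -mulrA exprMn invfM !rmorph_nat.
  by rewrite circE rmorphM /= [circ r t]circE -mulrA exprMn invfM !rmorph_nat.
have /eqP := E; rewrite E2 -subr_eq0 -{1}[cmean r _]mul1r -mulrBl mulf_eq0.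
case/orP => [|/eqP -> //]; rewrite subr_eq0 eq_sym invr_eq1 => /eqP h.
have : cabs ((2 : C) ^+ n) = 1 by rewrite h cabs1.
rewrite cabsX cabs_nat => h2; have h3 : (1 : R) < 2 by rewrite ltr1n.
have h4 : 1 < (2 : R) ^+ n by rewrite (exprn_egt1 n h3).
by case/negP: (lt_irreflexive (1 : R)); rewrite -[X in _ < X]h2.
Qed.

(** The mean of (f z - f w) z / (z - w) is zero; expanding z / (z - w) in powers of w / z turns this
    into the Taylor formula. The coefficients are taken at the fixed radius 1/2, as they may not
    depend on w, and then moved to a radius beyond |w|. *)
Theorem analytic_coefs f : analytic_disc f -> exists a, coefs f a.
Proof.
move=> Hf; pose a n := cmean (1 / 2) (fun z => f z * z ^- n).
exists a => w w1 e e0; have w0 := cabs_ge0 w.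
pose r := (1 + cabs w) / 2.
have [wr r1 r2] : [/\ cabs w < r, r < 1 & 1 / 2 <= r] by rewrite /r; split; lra.
have r0 : 0 < r by rewrite /r; lra.
have Hn n z : z != 0 -> cholo (fun z : C => z ^- n) z.
  move=> z0; have := @choloX R id n z (@cholo_id R z) => Hn.
  exact: (@choloV R (fun z => z ^+ n) z (expf_neq0 n z0) Hn).
have Hfn n z : cabs z < 1 -> z != 0 -> cholo (fun z => f z * z ^- n) z.
  by move=> z1 z0; exact: (choloM (Hf z z1) (Hn n z z0)).
have nz z : cabs z = r -> z != 0 by move=> zr; rewrite -cabs_gt0 zr.
have aE n : a n = cmean r (fun z => f z * z ^- n).
  apply: cmean_const => [||z /andP[h1 h2]]; [lra|lra|apply: Hfn].
    exact: le_lt_trans r1.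
  by rewrite -cabs_gt0; lra.
have c1 n : circ_cont (fun z => f z * z ^- n) r.
  by apply: cholo_circ => // z zr; apply: Hfn (nz _ zr); rewrite zr.
have c2 n : circ_cont (fun z : C => z ^- n) r.
  by apply: cholo_circ => // z zr; apply: Hn (nz _ zr).
pose k z := z * ((f z - f w) / (z - w)).
have nw z : cabs z = r -> z - w != 0.
  by move=> zr; rewrite subr_eq0; apply: contraTneq wr => <-; rewrite zr ltxx.
have Hk z : cabs z = r -> cholo k z.
  move=> zr; have z1 : cabs z < 1 by rewrite zr.
  have h1 : cholo (fun v => f v - f w) z := choloB (Hf z z1) (@cholo_cst R (f w) z).
  have h2 : cholo (fun v => v - w) z := choloB (@cholo_id R z) (@cholo_cst R w z).
  have h3 : cholo (fun v => (v - w)^-1) z by apply: choloV => //; exact: nw.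
  exact: (choloM (@cholo_id R z) (choloM h1 h3)).
(* What is left after J terms of the geometric expansion; it carries the factor (w / z)^J, of
   modulus (|w| / r)^J. *)
pose rem J z := w ^+ J * (z ^- J * k z).
have crem J : circ_cont (rem J) r.
  have cr1 : circ_cont (fun z => z ^- J * k z) r.
    apply: (cholo_circ r0) => z zr.
    exact: (@choloM R (fun z => z ^- J) k z (Hn J z (nz z zr)) (Hk z zr)).
  exact: (@circ_contZ R r (w ^+ J) (fun z => z ^- J * k z) cr1).
pose T n z := w ^+ n * (f z * z ^- n) + (- f w * w ^+ n) * z ^- n.
have cT1 n := @circ_contZ R r (w ^+ n) _ (c1 n).
have cT2 n := @circ_contZ R r (- f w * w ^+ n) _ (c2 n).
have cT n : circ_cont (T n) r := circ_contD (cT1 n) (cT2 n).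
have kE J z : cabs z = r -> k z = \sum_(n < J) T n z + rem J z.
  move=> zr; have z0 := nz z zr; have zw := nw z zr.
  elim: J => [|J IH]; first by rewrite big_ord0 add0r /rem !expr0 invr1 !mul1r.
  rewrite big_ord_recr /= {}IH -addrA; congr (_ + _).
  rewrite /rem /T /k !exprS; field.
  by rewrite zw expf_neq0 ?z0.
have mT n : cmean r (T n) = w ^+ n * a n - f w * w ^+ n * (n == 0)%:R.
  rewrite (cmeanD (cT1 n) (cT2 n)) (cmeanZ _ (c1 n)) (cmeanZ _ (c2 n)).
  by rewrite aE cmean_monom_inv// !mulNr.
(* At least one term is kept, since the term of index 0 is the one that produces f w. *)
have fE m : f w - \sum_(n < m.+1) a n * w ^+ n = cmean r (rem m.+1).
  have H0 : \sum_(n < m.+1) (w ^+ n * a n - f w * w ^+ n * (n == 0)%:R) +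
      cmean r (rem m.+1) = 0.
    under eq_bigr do rewrite -mT.
    rewrite -cmean_sum// -cmeanD//; last exact: circ_cont_sum.
    rewrite -[RHS](cauchy_zero Hf wr r1).
    by apply: eq_cmean => z; rewrite gtr0_norm// => /(kE m.+1).
  have S2 : \sum_(n < m.+1) f w * w ^+ n * (n == 0%N :> nat)%:R = f w.
    rewrite big_ord_recl /= expr0 !mulr1 big1 ?addr0// => i _.
    by rewrite /= mulr0.
  move/eqP: H0; rewrite addrC addr_eq0 => /eqP ->.
  rewrite sumrB S2 opprB; congr (_ - _).
  by apply: eq_bigr => n _; rewrite mulrC.
have [M HM] := circ_cont_bounded (cholo_circ r0 Hk).
have M0 : 0 <= M by rewrite (le_trans (cabs_ge0 _) (HM 0 _))// lexx mulr_ge0// pi_ge0.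
have y01 : 0 <= cabs w / r < 1 by rewrite divr_ge0 ?(ltW r0)//= ltr_pdivrMr// mul1r.
have M1 : 0 < 2 * (M + 1) by rewrite mulr_gt0// ltr_wpDl.
have [J0 HJ] := expr_small y01 (divr_gt0 e0 M1).
exists J0.+1 => -[//|m] J0m; rewrite fE.
have -> : e = 2 * (e / 2) by field.
apply: cmean_bound => // t ht; rewrite /rem cabsM [X in _ * X]cabsM cabsX cabsV cabsX cabs_circ gtr0_norm//.
rewrite mulrA -expr_div_n (le_trans (ler_wpM2l _ (HM t ht)))//.
  by rewrite exprn_ge0//; have /andP[] := y01.
have := HJ m.+1 (leqW J0m); rewrite ltr_pdivlMr// => /ltW.
have : 0 <= (cabs w / r) ^+ m.+1 by rewrite exprn_ge0//; have /andP[] := y01.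
by set y := _ ^+ _ => *; nra.
Qed.

End Taylor.

(** * Parseval's formula and Cauchy's estimates *)

Section Parseval.
Variable R : realType.
Local Notation C := (R[i]).
Implicit Types (z w : C) (r s t : R) (f g : C -> C) (a b : nat -> C).

Definition M2 r f : R :=
  (2 * pi)^-1 * itv_int (fun t => cabs (f (circ r t)) ^+ 2) 0 (2 * pi).

Let pi2 : 0 < 2 * pi :> R. Proof. by rewrite mulr_gt0// pi_gt0. Qed.
Let ipi2 : 0 < (2 * pi)^-1 :> R. Proof. by rewrite invr_gt0. Qed.

Lemma cont_on_sqr (u : R -> R) (x0 y0 : R) : cont_on u x0 y0 ->
  cont_on (fun x => u x ^+ 2) x0 y0.
Proof.
move=> Hu x xab e e0; have [d1 d10 H1] := Hu x xab _ ltr01.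
have k0 : 0 < 2 * `|u x| + 1 by rewrite ltr_wpDl// mulr_ge0.
have [d2 d20 H2] := Hu x xab _ (divr_gt0 e0 k0).
exists (Num.min d1 d2) => [|y yab]; first by rewrite lt_min d10.
rewrite lt_min => /andP[/(H1 _ yab) h1 /(H2 _ yab)]; rewrite ltr_pdivlMr//.
apply: le_lt_trans; rewrite subr_sqr normrM ler_wpM2l//.
have -> : u y + u x = (u y - u x) + 2 * u x by ring.
by rewrite (le_trans (ler_normD _ _))// normrM [`|2|]ger0_norm// addrC lerD2l ltW.
Qed.

Lemma circ_cont_cabs2 f r : circ_cont f r ->
  cont_on (fun t => cabs (f (circ r t)) ^+ 2) 0 (2 * pi).
Proof.
move=> [f1 f2]; under eq_fun do rewrite cabs_sqr.
by apply: cont_onD; exact: cont_on_sqr.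
Qed.

Lemma M2_ge0 r f : 0 <= M2 r f.
Proof.
rewrite mulr_ge0 ?(ltW ipi2)//; apply: Rintegral_ge0 => t _; exact: sqr_ge0.
Qed.

Lemma eq_M2 r f g : (forall z, cabs z = `|r| -> f z = g z) -> M2 r f = M2 r g.
Proof.
move=> fg; rewrite /M2; congr (_ * _); apply: itv_int_eq => t _.
by rewrite fg// cabs_circ.
Qed.

Lemma M2_le f g r K : circ_cont f r -> circ_cont g r ->
  (forall t, 0 <= t <= 2 * pi -> cabs (f (circ r t)) <= K * cabs (g (circ r t))) ->
  M2 r f <= K ^+ 2 * M2 r g.
Proof.
move=> Hf Hg fg; rewrite /M2 mulrCA ler_pM2l// -itv_intZ; last exact: circ_cont_cabs2.
apply: itv_int_le; [exact: circ_cont_cabs2|exact/cont_onZ/circ_cont_cabs2|].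
move=> t ht; rewrite -exprMn lerXn2r ?nnegrE ?cabs_ge0 ?fg//.
by rewrite (le_trans (cabs_ge0 (f (circ r t))))// fg.
Qed.

Lemma M2_cst r (c : C) : M2 r (fun=> c) = cabs c ^+ 2.
Proof.
by rewrite /M2 itv_int_cst ?(ltW pi2)// subr0 mulrCA mulVf ?mulr1// gt_eqF.
Qed.

Lemma M2_sup f r K : circ_cont f r -> 0 <= K ->
  (forall t, 0 <= t <= 2 * pi -> cabs (f (circ r t)) <= K) -> M2 r f <= K ^+ 2.
Proof.
move=> Hf K0 fK; rewrite -[leRHS]mulr1.
have <- : M2 r (fun=> 1) = 1 by rewrite M2_cst cabs1 expr1n.
apply: M2_le => // [|t ht]; first exact: circ_cont_cst.
by rewrite cabs1 mulr1 fK.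
Qed.

Lemma circ_conj_monom r t n m : (n <= m)%N ->
  (circ r t ^+ n)^*%C * circ r t ^+ m = (r ^+ (2 * n))%:C%C * circ r t ^+ (m - n).
Proof.
move=> nm; rewrite -{1}(subnKC nm) exprD mulrA; congr (_ * _).
by rewrite mulrC mul_conj_cabs cabsX cabs_circ -exprM mulnC exprM real_normK ?num_real// exprM.
Qed.

Lemma poly_analytic J a : analytic_disc (fun z => \sum_(n < J) a n * z ^+ n).
Proof.
apply: (@analytic_sum R J (fun n z => a n * z ^+ n)) => n.
exact: (analyticM (@analytic_cst R (a n)) (@analytic_monom R n)).
Qed.

(** Induction on the degree: on the circle, the cross term between a_J z^J and the lower terms is
    twice the real part of a polynomial [H] vanishing at 0, whose mean is 0 by the mean value
    property. *)
Lemma M2_poly r a J : 0 <= r < 1 ->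
  M2 r (fun z => \sum_(n < J) a n * z ^+ n) = \sum_(n < J) cabs (a n) ^+ 2 * r ^+ (2 * n).
Proof.
move=> r01; elim: J => [|J IH].
  under eq_M2 do rewrite big_ord0.
  by rewrite M2_cst cabs0 big_ord0 expr0n.
pose P z := \sum_(n < J) a n * z ^+ n.
pose Q z := a J * z ^+ J.
pose H z := \sum_(n < J) ((a n)^*%C * a J * (r ^+ (2 * n))%:C%C) * z ^+ (J - n).
have HP : circ_cont P r := analytic_circ_cont (@poly_analytic J a) r01.
have HQ : circ_cont Q r.
  apply: analytic_circ_cont => //.
  exact: (analyticM (@analytic_cst R (a J)) (@analytic_monom R J)).
have aH : analytic_disc H.
  apply: (@analytic_sum R J (fun n z => ((a n)^*%C * a J * (r ^+ (2 * n))%:C%C) * z ^+ (J - n))).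
  move=> n; exact: (analyticM (@analytic_cst R _) (@analytic_monom R (J - n))).
have E t : cabs (P (circ r t) + Q (circ r t)) ^+ 2 =
    (cabs (P (circ r t)) ^+ 2 + cabs (Q (circ r t)) ^+ 2) + 2 * complex.Re (H (circ r t)).
  rewrite addrC cabs_sqrD [_ + cabs (P _) ^+ 2]addrC; congr (_ + _ * complex.Re _).
  rewrite /H /P /Q rmorph_sum mulr_sumr; apply: eq_bigr => n _.
  rewrite rmorphM /= mulrACA [a J * _]mulrC -[RHS]mulrA -circ_conj_monom; last first.
    exact: ltnW (ltn_ord n).
  by congr (_ * _); rewrite mulrC.
have cH := analytic_circ_cont aH r01.
have cP2 := circ_cont_cabs2 HP; have cQ2 := circ_cont_cabs2 HQ.
rewrite big_ord_recr /= -IH /M2.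
under itv_int_eq do rewrite big_ord_recr /= -/(P _) -/(Q _) E.
rewrite itv_intD; [|exact: cont_onD|exact/cont_onZ/cH.1].
rewrite itv_intD// itv_intZ; last exact: cH.1.
rewrite mulrDr mulrCA.
have -> : (2 * pi)^-1 * itv_int (fun t => complex.Re (H (circ r t))) 0 (2 * pi) =
    complex.Re (H 0).
  have [r0|r0] := eqVneq r 0.
    rewrite (@itv_int_eq R _ (fun=> complex.Re (H 0))); last first.
      by move=> t _; rewrite r0 /circ !mul0r.
    by rewrite itv_int_cst ?(ltW pi2)// subr0 mulrCA mulVf ?mulr1// gt_eqF.
  have /andP[r0' r1] := r01.
  by rewrite -(cmean_value aH _ r1)// lt_def r0.
have -> : H 0 = 0.
  apply: big1 => n _; rewrite expr0n subn_eq0 leqNgt ltn_ord mulr0//.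
rewrite /= mulr0 addr0 mulrDr; congr (_ + _).
have -> : itv_int (fun t => cabs (Q (circ r t)) ^+ 2) 0 (2 * pi) =
    itv_int (fun=> cabs (a J) ^+ 2 * r ^+ (2 * J)) 0 (2 * pi).
  apply: itv_int_eq => t _; rewrite /Q cabsM cabsX cabs_circ exprMn -exprM mulnC exprM.
  by rewrite real_normK ?num_real// -exprM.
by rewrite itv_int_cst ?(ltW pi2)// subr0 mulrCA mulVf ?mulr1// gt_eqF.
Qed.

Theorem parseval f a r : coefs f a -> 0 <= r < 1 -> forall e, 0 < e ->
  exists J0, forall J, (J0 <= J)%N ->
  `|M2 r f - \sum_(n < J) cabs (a n) ^+ 2 * r ^+ (2 * n)| <= e.
Proof.
move=> fa r01 e e0; have aF := coefs_analytic fa.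
have [K [y [K0 y01 H]]] := coefs_tail fa r01.
have cf := analytic_circ_cont aF r01.
have [M HM] := circ_cont_bounded cf.
have M0 : 0 <= M by rewrite (le_trans (cabs_ge0 _) (HM 0 _))// lexx ltW.
have /andP[r0 r1] := r01; have /andP[y0 y1] := y01.
have k0 : 0 < (K + 1) * (2 * M + K + 1) by rewrite mulr_gt0// ltr_wpDl// addr_ge0// mulr_ge0.
have [J0 HJ] := expr_small y01 (divr_gt0 e0 k0).
exists J0 => J /HJ; rewrite -M2_poly//; set P := fun z => \sum_(n < J) _ => yJ.
have cP : circ_cont P r := analytic_circ_cont (@poly_analytic J a) r01.
have yJ1 : y ^+ J <= 1 by rewrite exprn_ile1// ltW.
have yJ0 : 0 <= y ^+ J by rewrite exprn_ge0.
rewrite /M2 -mulrBr normrM gtr0_norm// -itv_intB; [|exact: circ_cont_cabs2..].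
rewrite mulrC ler_pdivrMr//.
have := @itv_int_near R _ 0 e 0 (2 * pi) (ltW pi2)
  (cont_onB (circ_cont_cabs2 cf) (circ_cont_cabs2 cP)).
rewrite mul0r !subr0; apply => t ht; rewrite subr0 subr_sqr normrM.
have hfP : cabs (f (circ r t) - P (circ r t)) <= K * y ^+ J.
  by apply: H; rewrite cabs_circ ger0_norm.
have h1 : `|cabs (f (circ r t)) - cabs (P (circ r t))| <= K * y ^+ J.
  rewrite ler_norml; have := ler_cabs_dist (f (circ r t)) (P (circ r t)).
  by have := ler_cabs_dist (P (circ r t)) (f (circ r t)); rewrite cabsB; lra.
have h2 : `|cabs (f (circ r t)) + cabs (P (circ r t))| <= 2 * M + K.
  rewrite ger0_norm ?addr_ge0 ?cabs_ge0//.
  have := ler_cabs_dist (P (circ r t)) (f (circ r t)); rewrite cabsB.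
  have : K * y ^+ J <= K by rewrite ler_piMr.
  by have := HM t ht; lra.
rewrite (le_trans (ler_pM _ _ h1 h2))//.
move: yJ; rewrite ltr_pdivlMr// => /ltW; apply: le_trans.
rewrite -mulrA mulrCA ler_wpM2l// ler_pM ?addr_ge0 ?mulr_ge0// ?lerDl//.
Qed.

Lemma coefs_le_M2 f a r : coefs f a -> 0 <= r < 1 -> forall J,
  \sum_(n < J) cabs (a n) ^+ 2 * r ^+ (2 * n) <= M2 r f.
Proof.
move=> fa r01 J; apply/ler_addgt0Pr => e e0.
have [J0 HJ] := parseval fa r01 e0; have /andP[r0 _] := r01.
have := HJ (maxn J J0) (leq_maxr _ _); rewrite ler_distl => /andP[_ _].
have := HJ (maxn J J0) (leq_maxr _ _); rewrite ler_distlC => /andP[_ h].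
apply: le_trans h.
rewrite -!(big_mkord xpredT (fun n => cabs (a n) ^+ 2 * r ^+ (2 * n))).
rewrite (big_cat_nat (leq0n J) (leq_maxl J J0)) /= lerDl sumr_ge0// => n _.
by rewrite mulr_ge0 ?sqr_ge0 ?exprn_ge0.
Qed.

Lemma M2_le_coefs f a r B : coefs f a -> 0 <= r < 1 ->
  (forall J, \sum_(n < J) cabs (a n) ^+ 2 * r ^+ (2 * n) <= B) -> M2 r f <= B.
Proof.
move=> fa r01 HB; apply/ler_addgt0Pr => e e0.
have [J0 /(_ J0 (leqnn _))] := parseval fa r01 e0.
by rewrite ler_distl => /andP[_]; have := HB J0; lra.
Qed.

(** Cauchy's estimate: a single Parseval term is at most the mean square, which is at most K^2. *)
Lemma coef_le_sup f a r K : coefs f a -> 0 <= r < 1 ->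
  (forall t, 0 <= t <= 2 * pi -> cabs (f (circ r t)) <= K) ->
  forall n, cabs (a n) * r ^+ n <= K.
Proof.
move=> fa r01 fK n; have /andP[r0 r1] := r01.
have K0 : 0 <= K by rewrite (le_trans (cabs_ge0 (f (circ r 0))))// fK// lexx ltW.
have cf := analytic_circ_cont (coefs_analytic fa) r01.
rewrite -(ler_pXn2r (ltn0Sn 1)) ?nnegrE ?mulr_ge0 ?cabs_ge0 ?exprn_ge0//.
apply: (@le_trans _ _ (M2 r f)); last first.
  exact: M2_sup.
apply: le_trans (coefs_le_M2 fa r01 n.+1).
rewrite big_ord_recr /= exprMn -exprM [(n * 2)%N]mulnC lerDr sumr_ge0// => i _.
by rewrite mulr_ge0 ?sqr_ge0 ?exprn_ge0.
Qed.

Lemma coefsD f g a b : coefs f a -> coefs g b ->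
  coefs (fun z => f z + g z) (fun n => a n + b n).
Proof.
move=> fa gb z z1 e e0; have e2 := divr_gt0 e0 (ltr0n R 2).
have [J1 H1] := fa z z1 _ e2; have [J2 H2] := gb z z1 _ e2.
exists (maxn J1 J2) => J; rewrite geq_max => /andP[/H1 {}H1 /H2 {}H2].
under eq_bigr do rewrite mulrDl.
by rewrite big_split opprD addrACA (le_trans (ler_cabsD _ _))// [e]splitr lerD.
Qed.

Lemma coefsZ (c : C) f a : coefs f a -> coefs (fun z => c * f z) (fun n => c * a n).
Proof.
move=> fa z z1 e e0; have k0 : 0 < cabs c + 1 by rewrite ltr_wpDl ?cabs_ge0.
have [J1 H1] := fa z z1 _ (divr_gt0 e0 k0); exists J1 => J /H1.
under [in X in _ -> X]eq_bigr do rewrite -mulrA.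
rewrite -mulr_sumr -mulrBr cabsM ler_pdivlMr// mulrC; apply: le_trans.
by rewrite ler_wpM2r ?cabs_ge0// lerDl.
Qed.

Lemma coefsB f g a b : coefs f a -> coefs g b ->
  coefs (fun z => f z - g z) (fun n => a n - b n).
Proof.
move=> fa gb; have := coefsD fa (coefsZ (- 1) gb).
under eq_fun do rewrite mulN1r.
by under [X in coefs _ X]eq_fun do rewrite mulN1r.
Qed.

Lemma eq_coefs f g a : (forall z, cabs z < 1 -> f z = g z) -> coefs f a -> coefs g a.
Proof. by move=> fg fa z z1 e e0; rewrite -fg//; exact: fa. Qed.

Lemma coefs_poly d a : (forall n, (d <= n)%N -> a n = 0) ->
  coefs (fun z => \sum_(n < d) a n * z ^+ n) a.
Proof.
move=> ad z _ e e0; exists d => J dJ.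
rewrite -!(big_mkord xpredT (fun n => a n * z ^+ n)) (big_cat_nat (leq0n d) dJ) /=.
have -> : \sum_(d <= n < J) a n * z ^+ n = 0.
  rewrite big_nat_cond; apply: big1 => n /andP[/andP[dn _] _].
  by rewrite ad// mul0r.
by rewrite addr0 subrr cabs0 ltW.
Qed.

Lemma coefs_inj f a b : coefs f a -> coefs f b -> a =1 b.
Proof.
move=> fa fb n.
have H : coefs (fun=> 0) (fun n => a n - b n).
  by apply: eq_coefs (coefsB fa fb) => z _; rewrite subrr.
have h : 0 <= (1 / 2 : R) < 1 by rewrite divr_ge0 ?ltr_pdivrMr ?mul1r ?ltr1n.
have h0 t : 0 <= t <= 2 * pi -> cabs (0 : C) <= 0 by rewrite cabs0.
have := coef_le_sup H h h0 n; rewrite pmulr_lle0 ?exprn_gt0 ?divr_gt0//.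
by rewrite le_eqVlt ltNge cabs_ge0 orbF cabs_eq0 subr_eq0 => /eqP.
Qed.

End Parseval.

(** * Affine change of variable for the Lebesgue integral *)

Section AffineSubstitution.
Variable R : realType.
Local Notation mu := (@lebesgue_measure R).
Local Open Scope ereal_scope.

Lemma measurable_affine (c d : R) :
  measurable_fun [set: R] (fun x : R => (c * x + d)%R : measurableTypeR R).
Proof. by apply: measurable_funD => //; exact: measurable_funM. Qed.

Lemma affine_preimage (c d a b : R) : c != 0%R ->
  lebesgue_measure ((fun x : R => (c * x + d)%R) @^-1` `]a, b]%classic) =
  `|c|^-1%:E * lebesgue_measure (`]a, b]%classic : set R).
Proof.
move=> c0; have [cpos|cneg|ceq] := ltgtP 0%R c; last by rewrite ceq eqxx in c0.
  have -> : (fun x : R => (c * x + d)%R) @^-1` `]a, b]%classic =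
      `]((a - d) / c)%R, ((b - d) / c)%R]%classic.
    apply/seteqP; split=> x /=; rewrite !in_itv /= ltr_pdivrMr// ler_pdivlMr//.
      by rewrite ltrBlDr lerBrDr mulrC.
    by rewrite ltrBlDr lerBrDr mulrC.
  rewrite !lebesgue_measure_itv /= !lte_fin ltr_pM2r ?invr_gt0// ltrD2r.
  case: ifP => _; last by rewrite mule0.
  by rewrite -!EFinD -EFinM (gtr0_norm cpos); congr EFin; field; rewrite gt_eqF.
have -> : (fun x : R => (c * x + d)%R) @^-1` `]a, b]%classic =
    `[((b - d) / c)%R, ((a - d) / c)%R[%classic.
  apply/seteqP; split=> x /=; rewrite !in_itv /= ler_ndivrMr// ltr_ndivlMr//.
    by rewrite ltrBlDr lerBrDr mulrC andbC.
  by rewrite ltrBlDr lerBrDr mulrC andbC.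
rewrite !lebesgue_measure_itv /= !lte_fin ltr_nM2r ?invr_lt0// ltrD2r.
case: ifP => _; last by rewrite mule0.
by rewrite -!EFinD -EFinM (ltr0_norm cneg); congr EFin; field; rewrite lt_eqF.
Qed.

(** The push-forward of Lebesgue measure under x -> c x + d, scaled by |c|, agrees with Lebesgue
    measure on half-open intervals, hence everywhere by uniqueness. *)
Lemma affine_subst (c d : R) (h : R -> \bar R) : c != 0%R ->
  measurable_fun [set: R] h -> (forall x, 0 <= h x) ->
  \int[mu]_x h x = \int[mu]_x (`|c|%:E * h (c * x + d)%R).
Proof.
move=> c0 mh h0; pose phi : R -> measurableTypeR R := fun x => (c * x + d)%R.
have mphi : measurable_fun [set: R] phi := measurable_affine c d.
have nc : (0 <= `|c|)%R by [].
pose pm : {measure set (measurableTypeR R) -> \bar R} :=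
  measure_function_pushforward__canonical__measure_function_Measure mu mphi.
have E A : measurable A -> mu A = mscale (NngNum nc) pm A.
  move=> mA; apply: lebesgue_measure_unique => //= _ [[a b]] _ <-.
  rewrite /mscale /= /pushforward affine_preimage// muleA -EFinM mulfV ?mul1e//.
  by rewrite normr_eq0.
transitivity (\int[mscale (NngNum nc) pm]_x h x).
  by apply: eq_measure_integral => A mA _; exact: E.
rewrite ge0_integral_mscale//= ge0_integral_pushforward// preimage_setT.
rewrite -ge0_integralZl//.
  by apply: measurableT_comp.
by move=> x _; exact: h0.
Qed.

End AffineSubstitution.

(** * Polar coordinates *)

Section PolarFormula.
Variable R : realType.
Local Notation mu := (@lebesgue_measure R).
Local Open Scope ereal_scope.

(* Polar coordinates by substitutions in one variable: [y = x s], then [x = r * kappa s], and finally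
   [s = tan t]. *)
Definition kappa (s : R) : R := cos (atan s).

Lemma kappa_gt0 s : (0 < kappa s)%R.
Proof. by rewrite /kappa cos_atan invr_gt0 sqrtr_gt0 ltr_pwDl// sqr_ge0. Qed.

Lemma kappa_sqr s : (kappa s ^+ 2 = (1 + s ^+ 2)^-1)%R.
Proof. by rewrite /kappa cos_atan exprVn sqr_sqrtr// addr_ge0// sqr_ge0. Qed.

Lemma measurable_kappa : measurable_fun [set: R] kappa.
Proof.
apply: continuous_measurable_fun => x; apply: continuous_comp.
  exact: continuous_atan.
exact: continuous_cos.
Qed.

(** A line through the origin is given by its slope s, and r runs over all of R: its sign selects
    one of the two rays of the line. *)
Lemma polar_tonelli (g : R * R -> \bar R) :
  measurable_fun [set: R * R] g -> (forall p, 0 <= g p) ->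
  measurable_fun [set: R]
    (fun r => \int[mu]_s ((kappa s ^+ 2 * `|r|)%:E * g (kappa s * r, kappa s * r * s)%R)) /\
  \int[(mu \x mu)%E]_p g p =
  \int[mu]_r \int[mu]_s ((kappa s ^+ 2 * `|r|)%:E * g (kappa s * r, kappa s * r * s)%R).
Proof.
move=> mg g0.
pose g1 (p : R * R) : \bar R := `|p.1|%:E * g (p.1, p.1 * p.2)%R.
have m1 : measurable_fun [set: R * R] (fun p : R * R => (p.1, p.1 * p.2)%R).
  by apply: measurable_fun_pair => //; exact: measurable_funM.
have mg1 : measurable_fun [set: R * R] g1.
  apply: emeasurable_funM; last exact: measurableT_comp mg m1.
  by apply/measurable_EFinP; apply: measurableT_comp.
have g10 p : 0 <= g1 p by rewrite mule_ge0// lee_fin.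
pose g2 (p : R * R) : \bar R :=
  (kappa p.2 ^+ 2 * `|p.1|)%:E * g (kappa p.2 * p.1, kappa p.2 * p.1 * p.2)%R.
have mk : measurable_fun [set: R * R] (fun p : R * R => kappa p.2).
  exact: measurableT_comp measurable_kappa measurable_snd.
have m2 : measurable_fun [set: R * R]
    (fun p : R * R => (kappa p.2 * p.1, kappa p.2 * p.1 * p.2)%R).
  by apply: measurable_fun_pair => //; do ?apply: measurable_funM.
have mg2 : measurable_fun [set: R * R] g2.
  apply: emeasurable_funM; last exact: measurableT_comp mg m2.
  apply/measurable_EFinP; apply: measurable_funM; last exact: measurableT_comp.
  exact: measurable_funX.
have g20 p : 0 <= g2 p by rewrite mule_ge0// lee_fin mulr_ge0// sqr_ge0.
split; first exact: (measurable_fun_fubini_tonelli_F (m2 := mu) g2 mg2 g20).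
transitivity (\int[mu]_x \int[mu]_s g1 (x, s)).
  rewrite (fubini_tonelli1 (m1 := mu) (m2 := mu) g mg g0).
  apply: ge0_ae_eq_integral; first exact: measurableT.
  - exact: measurable_fun_fubini_tonelli_F.
  - exact: (measurable_fun_fubini_tonelli_F (m2 := mu) g1 mg1 g10).
  - by move=> x _; exact: integral_ge0.
  - by move=> x _; exact: integral_ge0.
  (* The substitution y = x s degenerates only on the line x = 0, a null set. *)
  exists [set 0%R]; split => //; first exact: lebesgue_measure_set1.
  move=> x /= /not_implyP[_]; apply: contra_notP => /eqP x0.
  rewrite /fubini_F /g1 /= (@affine_subst _ x 0)//.
    by apply: eq_integral => s _; rewrite addr0.
  exact: (measurable_fun_pair2 x mg).
rewrite -(fubini_tonelli1 (m1 := mu) (m2 := mu) g1 mg1 g10).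
rewrite (fubini_tonelli2 (m1 := mu) (m2 := mu) g1 mg1 g10).
transitivity (\int[mu]_s \int[mu]_r g2 (r, s)).
  apply: eq_integral => s _; rewrite /fubini_G [LHS](@affine_subst _ (kappa s) 0) ?gt_eqF ?kappa_gt0//.
  - apply: eq_integral => r _; rewrite addr0 /g1 /g2 /= muleA; congr (_ * _).
    rewrite -EFinM; congr EFin; rewrite [`|_ * r|%R]normrM (gtr0_norm (kappa_gt0 s)); ring.
  - exact: (measurable_fun_pair1 s mg1).
by rewrite -[RHS](fubini_tonelli1 (m1 := mu) (m2 := mu) g2 mg2 g20)
  (fubini_tonelli2 (m1 := mu) (m2 := mu) g2 mg2 g20).
Qed.

End PolarFormula.

(** * From slopes to angles *)

Section AngularSubstitution.
Variable R : realType.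
Local Notation mu := (@lebesgue_measure R).
Implicit Types (u : R -> R) (a b c : R).

Lemma integral_fold (h : R -> \bar R) : measurable_fun [set: R] h -> (forall x, (0 <= h x)%E) ->
  (\int[mu]_x h x = \int[mu]_(x in `[0%R, +oo[) (h x + h (- x)%R))%E.
Proof.
move=> mh h0.
have mhN : measurable_fun [set: R] (fun x => h (- x)).
  by apply: measurableT_comp.
rewrite -(@setUv _ `]-oo, 0%R]%classic) ge0_integral_setU//=; last 3 first.
- exact: measurableC.
- by rewrite setUv.
- by rewrite /disj_set setICr.
rewrite ge0_integralD//; [|exact: measurable_funTS..].
rewrite addrC; congr (_ + _)%E.
  rewrite setCitvl -integral_itv_obnd_cbnd//; exact: measurable_funTS.
rewrite (@ge0_integration_by_substitution0 _ (fun x => h (- x)))//.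
by apply: eq_integral => x _; rewrite opprK.
Qed.

Lemma itv_int_affine u e c a b : e = 1 \/ e = - 1 -> continuous u -> (forall x, 0 <= u x) ->
  itv_int (fun x => u (c + e * x)) a b =
  itv_int u (c + e * (if e == 1 then a else b)) (c + e * (if e == 1 then b else a)).
Proof.
move=> he cu u0; have e0 : e != 0 by case: he => ->; rewrite ?oppr_eq0 oner_eq0.
have n1 : (- 1 : R) == 1 = false by apply/negbTE; rewrite -subr_eq0 -opprD oppr_eq0 gt_eqF.
rewrite /itv_int /Rintegral; congr fine; rewrite integral_mkcond [RHS]integral_mkcond.
set A := (X in _ = (\int[mu]_x (_ \_ X) x)%E).
have mu' : measurable_fun [set: R] (EFin \o u).
  by apply/measurable_EFinP; exact: continuous_measurable_fun.
rewrite [RHS](@affine_subst _ e c)//; last 2 first.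
- by apply: (measurable_restrictT _ _).1; [exact: measurable_itv|exact: (measurable_funTS mu')].
- by move=> x; rewrite patchE; case: ifP => // _; rewrite lee_fin.
apply: eq_integral => x _.
have -> : `|e| = 1 by case: he => ->; rewrite ?normrN normr1.
rewrite mul1e !patchE; congr (if _ then _ else _); last by rewrite /= [e * x + c]addrC.
apply/idP/idP; rewrite !inE /A /= !in_itv /=; case: he => ->; rewrite ?eqxx ?n1; lra.
Qed.

Lemma atan_weight_cont u : continuous u -> continuous (fun s : R => (1 + s ^+ 2)^-1 * u (atan s)).
Proof.
move=> cu x; have h1 : {for x, continuous (fun s : R => (1 + s ^+ 2)^-1)}.
  apply: continuousV; first by rewrite gt_eqF// ltr_pwDl// sqr_ge0.
  by apply: continuousD; [exact: cst_continuous|exact: exprn_continuous].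
have h2 : {for x, continuous (fun s : R => u (atan s))}.
  by apply: continuous_comp; [exact: continuous_atan|exact: cu].
exact: (continuousM h1 h2).
Qed.

Lemma atan_subst_half u : continuous u -> (forall x, 0 <= u x) ->
  (\int[mu]_(s in `[0%R, +oo[) ((1 + s ^+ 2)^-1 * u (atan s))%:E =
   (itv_int u 0 (pi / 2))%:E)%E.
Proof.
(* The base point -pi makes 0 and pi/2 interior points for the primitive, as differentiability at
   atan 0 and continuity at pi/2 are used. *)
move=> cu u0; pose F x := itv_int u (- pi) x.
have p0 := pi_gt0 R.
have dF x : - pi < x -> derivable F x 1 /\ derive1 F x = u x.
  move=> px; apply: (@continuous_FTC1_closed _ u (- pi) x (x + 1)).
  - by rewrite ltrDl.
  - apply: continuous_compact_integrable; first exact: segment_compact.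
    by apply: continuous_subspaceT => y; exact: cu.
  - exact: px.
  - exact: cu.
have cF x : - pi < x -> {for x, continuous F}.
  by move=> /dF[+ _] => /derivable1_diffP/differentiable_continuous.
have p2 : pi / 2 < pi :> R by rewrite ltr_pdivrMr// ltr_pMr// ltr1n.
have p2' : 0 < pi / 2 :> R by rewrite divr_gt0.
have pa (x : R) : - pi < atan x by rewrite (lt_trans _ (atan_gtNpi2 x))// ltrN2.
have dFa (x : R) : derivable (F \o atan) x 1.
  apply/derivable1_diffP/differentiable_comp; apply/derivable1_diffP.
    exact: derivable_atan.
  by have [] := dF _ (pa x).
rewrite (@ge0_continuous_FTC2y _ _ (F \o atan) 0 (F (pi / 2))).
- have cu' x y : cont_on u x y.
    move=> t _ e e0; have /cvgrPdist_lt/(_ e e0)[dl /= dl0 H] := cu t.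
    by exists dl => // t' _ ht; rewrite distrC; apply: H; rewrite /= distrC.
  rewrite /= atan0 -EFinB; congr EFin; rewrite /F (@itv_int_split _ u (- pi) (pi / 2) 0)//; rewrite ?oppr_le0 ?ltW//; ring.
- by move=> x _; rewrite mulr_ge0// invr_ge0 addr_ge0// sqr_ge0.
- by apply: continuous_subspaceT => x; exact: atan_weight_cont.
- apply: (@cvg_comp _ _ _ atan F _ (nbhs (pi / 2))); first exact: cvgy_atan.
  by apply: cF; rewrite (lt_trans _ p2')// oppr_lt0.
- by move=> x _; exact: dFa.
- apply: cvg_at_right_filter; exact/differentiable_continuous/derivable1_diffP/dFa.
- move=> x _; rewrite derive1_comp//; last by have [] := dF _ (pa x).
  by rewrite derive1_atan (dF _ (pa x)).2 mulrC.
Qed.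

Lemma atan_subst u : continuous u -> (forall x, 0 <= u x) ->
  (\int[mu]_s ((1 + s ^+ 2)^-1 * u (atan s))%:E = (itv_int u (- (pi / 2)) (pi / 2))%:E)%E.
Proof.
move=> cu u0; have k0 s : 0 <= (1 + s ^+ 2)^-1 * u (atan s) :> R.
  by rewrite mulr_ge0// invr_ge0 addr_ge0// sqr_ge0.
have cuN : continuous (fun x => u (- x)).
  by move=> x; apply: continuous_comp; [exact: continuousN|exact: cu].
have mk (v : R -> R) D : continuous v ->
    measurable_fun D (fun s : R => ((1 + s ^+ 2)^-1 * v (atan s))%:E).
  move=> cv; apply/measurable_EFinP. apply: measurable_funTS. apply: continuous_measurable_fun. exact: atan_weight_cont.
rewrite integral_fold; [|exact: mk|by move=> x; rewrite lee_fin].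
under eq_integral do rewrite sqrrN atanN.
rewrite ge0_integralD//; last 4 first.
- by move=> x _; rewrite lee_fin.
- exact: mk.
- by move=> x _; rewrite lee_fin mulr_ge0// invr_ge0 addr_ge0// sqr_ge0.
- exact: (mk (fun x => u (- x))).
rewrite atan_subst_half// (atan_subst_half cuN)// -EFinD; congr EFin.
have := @itv_int_affine u (- 1) 0 0 (pi / 2) (or_intror erefl) cu u0.
have -> : (- 1 : R) == 1 = false by apply/negbTE; rewrite -subr_eq0 -opprD oppr_eq0 gt_eqF.
rewrite mulr0 addr0 !add0r mulN1r => H.
have p0 := pi_gt0 R.
have cu' : cont_on u (- (pi / 2)) (pi / 2).
  move=> t _ e e0; have /cvgrPdist_lt/(_ e e0)[dl /= dl0 Hd] := cu t.
  by exists dl => // t' _ ht; rewrite distrC; apply: Hd; rewrite /= distrC.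
have p2 : 0 < pi / 2 :> R by rewrite divr_gt0.
have pn : - (pi / 2) <= 0 :> R by rewrite oppr_le0 ltW.
rewrite (itv_int_split pn (ltW p2) cu') -H addrC; congr (_ + _).
by apply: itv_int_eq => x _; rewrite add0r mulN1r.
Qed.

End AngularSubstitution.

(** * The weighted Bergman norm as a radial integral *)

Section BergmanNorm.
Variable R : realType.
Local Notation C := (R[i]).
Local Notation mu := (@lebesgue_measure R).
Implicit Types (z w : C) (r s t : R) (f g : C -> C) (a : nat -> C) (sigma : R -> R).

Lemma circ_sqr_cont f r : analytic_disc f -> `|r| < 1 ->
  continuous (fun t : R => cabs (f (circ r t)) ^+ 2).
Proof.
move=> Hf r1 t; apply: (@continuous_comp _ _ _ (fun t => cabs (f (circ r t))) (fun x => x ^+ 2)).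
  apply/cvgrPdist_lt => e e0.
  have [|dl dl0 H] := cholo_cont (Hf (circ r t) _) e0; first by rewrite cabs_circ.
  have d2 : 0 < dl / 2 by rewrite divr_gt0.
  have /cvgrPdist_lt/(_ _ d2) Hc := @continuous_cos R t.
  have /cvgrPdist_lt/(_ _ d2) Hs := @continuous_sin R t.
  near=> t'.
  have h : cabs (circ r t' - circ r t) < dl.
    rewrite (le_lt_trans (cabs_le_ReIm _))// cReB cImB /= -!mulrBr !normrM -mulrDr.
    rewrite (@le_lt_trans _ _ (`|cos t' - cos t| + `|sin t' - sin t|))//.
      by rewrite ler_piMl// ?addr_ge0// ltW.
    rewrite [dl]splitr ltrD// distrC; near: t'; [exact: Hc|exact: Hs].
  have := H _ h; have := ler_cabs_dist (f (circ r t')) (f (circ r t)).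
  have := ler_cabs_dist (f (circ r t)) (f (circ r t')); rewrite cabsB.
  by rewrite ltr_norml; lra.
exact: exprn_continuous.
Unshelve. all: by end_near. Qed.

Lemma circN r t : circ (- r) t = circ r (pi + t).
Proof.
by rewrite /circ addrC cosDpi sinDpi !mulrN !mulNr.
Qed.

Lemma circD2pi r t : circ r (2 * pi + t) = circ r t.
Proof. by rewrite /circ mulr_natl addrC cosD2pi sinD2pi. Qed.

(** The radius -r at angle t is the radius r at angle pi + t, so the two integrals cover the right
    and the left half of the circle. *)
Lemma M2_half f r : analytic_disc f -> 0 <= r < 1 ->
  itv_int (fun t => cabs (f (circ r t)) ^+ 2) (- (pi / 2)) (pi / 2) +
  itv_int (fun t => cabs (f (circ (- r) t)) ^+ 2) (- (pi / 2)) (pi / 2) =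
  2 * pi * M2 r f.
Proof.
move=> Hf /andP[r0 r1]; set u := fun t => cabs (f (circ r t)) ^+ 2.
have cu : continuous u by apply: circ_sqr_cont => //; rewrite ger0_norm.
have u0 x : 0 <= u x by exact: sqr_ge0.
have p0 : 0 < pi :> R := pi_gt0 R.
have cu' x y : cont_on u x y.
  move=> t _ e e0; have /cvgrPdist_lt/(_ e e0)[dl /= dl0 Hd] := cu t.
  by exists dl => // t' _ ht; rewrite distrC; apply: Hd; rewrite /= distrC.
have E2 : itv_int (fun t => cabs (f (circ (- r) t)) ^+ 2) (- (pi / 2)) (pi / 2) =
    itv_int u (pi / 2) (3 / 2 * pi).
  have := @itv_int_affine R u 1 pi (- (pi / 2)) (pi / 2) (or_introl erefl) cu u0.
  rewrite eqxx !mul1r => H.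
  have -> : pi / 2 = pi + - (pi / 2) :> R by field.
  have -> : 3 / 2 * pi = pi + pi / 2 :> R by field.
  have E : pi + - (pi / 2) = pi / 2 :> R by field.
  rewrite -H !E; apply: itv_int_eq => t _.
  by rewrite /u circN mul1r.
have E3 : itv_int u (3 / 2 * pi) (2 * pi) = itv_int u (- (pi / 2)) 0.
  have := @itv_int_affine R u 1 (2 * pi) (- (pi / 2)) 0 (or_introl erefl) cu u0.
  rewrite eqxx !mul1r addr0.
  have -> : 2 * pi + - (pi / 2) = 3 / 2 * pi :> R by field.
  move=> <-; apply: itv_int_eq => t _; by rewrite /u mul1r circD2pi.
rewrite /M2 mulrA mulfV ?mul1r; last by rewrite gt_eqF// mulr_gt0.
rewrite E2 (@itv_int_split _ u (- (pi / 2)) (pi / 2) 0)//; [|lra|lra].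
rewrite (@itv_int_split _ u 0 (2 * pi) (pi / 2))//; [|lra|lra].
rewrite (@itv_int_split _ u (pi / 2) (2 * pi) (3 / 2 * pi))//; [|lra|lra].
by rewrite E3 -addrA [LHS]addrC -addrA.
Qed.

Lemma measurable_disc2 : measurable (@disc2 R).
Proof.
have mf : measurable_fun [set: R * R] (fun p : R * R => p.1 ^+ 2 + p.2 ^+ 2).
  by apply: measurable_funD; apply: measurable_funX.
have := mf measurableT `]-oo, 1[%classic (measurable_itv _); rewrite setTI.
congr (measurable _); apply/seteqP; split=> p /=; rewrite in_itv//.
Qed.

Lemma measurable_cpt_poly J a :
  measurable_fun [set: R * R] (fun p : R * R => complex.Re (\sum_(n < J) a n * cpt p.1 p.2 ^+ n)) /\
  measurable_fun [set: R * R] (fun p : R * R => complex.Im (\sum_(n < J) a n * cpt p.1 p.2 ^+ n)).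
Proof.
have m1 : measurable_fun [set: R * R] (fun p : R * R => complex.Re (cpt p.1 p.2)).
  exact: measurable_fst.
have m2 : measurable_fun [set: R * R] (fun p : R * R => complex.Im (cpt p.1 p.2)).
  exact: measurable_snd.
have mX n : measurable_fun [set: R * R] (fun p : R * R => complex.Re (cpt p.1 p.2 ^+ n)) /\
    measurable_fun [set: R * R] (fun p : R * R => complex.Im (cpt p.1 p.2 ^+ n)).
  elim: n => [|n [IH1 IH2]].
    by split; under eq_fun do rewrite expr0; exact: measurable_cst.
  split; under eq_fun do rewrite exprS ?cReM ?cImM.
    by apply: (measurable_funB (measurable_funM m1 IH1) (measurable_funM m2 IH2)).
  by apply: (measurable_funD (measurable_funM m1 IH2) (measurable_funM m2 IH1)).
elim: J => [|J [IH1 IH2]].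
  by split; under eq_fun do rewrite big_ord0; exact: measurable_cst.
have [h1 h2] := mX J.
split; under eq_fun do rewrite big_ord_recr /= ?cReD ?cImD ?cReM ?cImM.
  apply: (measurable_funD IH1); apply: measurable_funB.
    exact: (measurable_funM (measurable_cst (complex.Re (a J))) h1).
  exact: (measurable_funM (measurable_cst (complex.Im (a J))) h2).
apply: (measurable_funD IH2); apply: measurable_funD.
  exact: (measurable_funM (measurable_cst (complex.Re (a J))) h2).
exact: (measurable_funM (measurable_cst (complex.Im (a J))) h1).
Qed.

(** On the disc [f] is a pointwise limit of polynomials, whose real and imaginary parts are
    measurable. *)
Lemma measurable_cabs2 f a : coefs f a ->
  measurable_fun (@disc2 R) (fun p : R * R => cabs (f (cpt p.1 p.2)) ^+ 2).
Proof.
move=> fa; apply: (@measurable_fun_cvg _ _ _ _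
   (fun J (p : R * R) => cabs (\sum_(n < J) a n * cpt p.1 p.2 ^+ n) ^+ 2)).
  move=> J; under eq_fun do rewrite cabs_sqr.
  have [h1 h2] := measurable_cpt_poly J a.
  by apply: measurable_funTS; apply: measurable_funD; apply: measurable_funX.
move=> [x y] /= xy1.
suff H : cabs (\sum_(n < J) a n * cpt x y ^+ n) @[J --> \oo] --> cabs (f (cpt x y)).
  by rewrite expr2; under eq_fun do rewrite expr2; exact: cvgM.
apply/cvgrPdist_lt => e e0.
have z1 : cabs (cpt x y) < 1.
  by rewrite -(ltr_pXn2r (ltn0Sn 1)) ?nnegrE ?cabs_ge0// cabs_sqr expr1n.
have [J0 HJ] := fa _ z1 _ (divr_gt0 e0 (ltr0n R 2)).
exists J0 => // J /= J0J; have := HJ J J0J.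
set P := \sum_(n < J) _; set F := f _ => h.
have := ler_cabs_dist F P; have := ler_cabs_dist P F; rewrite cabsB.
by rewrite ltr_norml; lra.
Qed.

Lemma measurable_within_itvco (sigma : R -> R) : {within `[0, 1[%classic, continuous sigma} ->
  measurable_fun (`[0, 1[%classic : set R) sigma.
Proof. by move=> cs; exact: subspace_continuous_measurable_fun. Qed.

Lemma measurable_radial (sigma : R -> R) : {within `[0, 1[%classic, continuous sigma} ->
  measurable_fun (@disc2 R) (fun p : R * R => sigma (Num.sqrt (p.1 ^+ 2 + p.2 ^+ 2))).
Proof.
move=> cs; have ms := measurable_within_itvco cs.
have mn : measurable_fun (@disc2 R) (fun p : R * R => Num.sqrt (p.1 ^+ 2 + p.2 ^+ 2)).
  apply: measurable_funTS; apply: (@measurableT_comp _ _ _ _ _ _ (@Num.sqrt R)).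
    by apply: continuous_measurable_fun; exact: sqrt_continuous.
  by apply: measurable_funD; apply: measurable_funX.
apply: (measurable_comp (measurable_itv _) _ ms mn).
  move=> _ [p p1 <-] /=; rewrite in_itv /= sqrtr_ge0 /=.
  by rewrite -(@ltr_pXn2r _ 2) ?nnegrE ?sqrtr_ge0// sqr_sqrtr ?addr_ge0 ?sqr_ge0// expr1n.
Qed.

Theorem bergman_radial sigma f a : coefs f a -> {within `[0, 1[%classic, continuous sigma} ->
  (forall r, 0 <= r < 1 -> 0 <= sigma r) ->
  bergman_sq sigma f = (\int[mu]_(r in `[0%R, 1%R[) (2 * r * sigma r * M2 r f)%:E)%E.
Proof.
move=> fa cs s0; have Hf := coefs_analytic fa.
rewrite /bergman_sq integral_mkcond.
set g := _ \_ _.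
have g0 p : (0 <= g p)%E.
  rewrite /g patchE; case: ifP => // /set_mem p1; rewrite lee_fin mulr_ge0 ?sqr_ge0 ?s0//.
  rewrite sqrtr_ge0 /= -(@ltr_pXn2r _ 2) ?nnegrE ?sqrtr_ge0//.
  by rewrite sqr_sqrtr ?addr_ge0 ?sqr_ge0// expr1n.
have mg : measurable_fun [set: R * R] g.
  have m0 := measurable_funM (measurable_cabs2 fa) (measurable_radial cs).
  exact: ((measurable_restrictT _ measurable_disc2).1 ((measurable_EFinP _ _).2 m0)).
have [mH ->] := polar_tonelli mg g0.
pose N r := itv_int (fun t => cabs (f (circ r t)) ^+ 2) (- (pi / 2)) (pi / 2).
(* Value of the inner integral over slopes, for signed r. Folding r with -r joins the two half
   circles into 2 pi times the mean. *)
pose H r : \bar R := if `|r| < 1 then (`|r| * sigma `|r| * N r)%:E else 0%E.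
have s0' (r : R) : `|r| < 1 -> 0 <= `|r| * sigma `|r|.
  by move=> r1; rewrite mulr_ge0// s0// normr_ge0.
have N0 r : 0 <= N r by apply: Rintegral_ge0 => t _; exact: sqr_ge0.
have HE r : (\int[mu]_s ((kappa s ^+ 2 * `|r|)%:E *
    g ((kappa s * r)%R, (kappa s * r * s)%R)))%E = H r.
  have rE s : (kappa s * r) ^+ 2 + (kappa s * r * s) ^+ 2 = r ^+ 2.
    have n0 : 1 + s ^+ 2 != 0 by rewrite gt_eqF// ltr_pwDl// sqr_ge0.
    rewrite !exprMn kappa_sqr; field; exact: n0.
  have r2 : (r ^+ 2 < 1) = (`|r| < 1).
    by rewrite -(real_normK (num_real r)) -[X in _ < X](expr1n R 2) ltr_pXn2r ?nnegrE.
  rewrite /H; case: ifPn => r1; last first.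
    apply: integral0_eq => s _; rewrite /g patchE ifN ?mule0//.
    by apply/negP => /set_mem; rewrite /disc2 /= rE r2 (negbTE r1).
  have E s : ((kappa s ^+ 2 * `|r|)%:E * g ((kappa s * r)%R, (kappa s * r * s)%R) =
      (`|r| * sigma `|r|)%:E * ((1 + s ^+ 2)^-1 * cabs (f (circ r (atan s))) ^+ 2)%:E)%E.
    rewrite /g patchE ifT; last by rewrite inE /disc2 /= rE r2.
    rewrite /= rE sqrtr_sqr kappa_sqr -!EFinM; congr EFin.
    have -> : cpt (kappa s * r) (kappa s * r * s) = circ r (atan s).
      rewrite /circ /cpt -/(kappa s) mulrC; congr Complex; rewrite -mulrA; congr (_ * _).
      rewrite -{2}(atanK s) /tan /kappa mulrCA mulfV ?mulr1//.
      by rewrite gt_eqF// kappa_gt0.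
    ring.
  under eq_integral do rewrite E.
  have cu : continuous (fun t : R => cabs (f (circ r t)) ^+ 2) by exact: circ_sqr_cont.
  rewrite ge0_integralZl//.
  - by rewrite (atan_subst cu)// => t; exact: sqr_ge0.
  - apply/measurable_EFinP; apply: continuous_measurable_fun.
    exact: (atan_weight_cont cu).
  - by move=> s _; rewrite lee_fin mulr_ge0 ?sqr_ge0// invr_ge0 addr_ge0// sqr_ge0.
  - by rewrite lee_fin s0'.
have HN : (fun r => \int[mu]_s ((kappa s ^+ 2 * `|r|)%:E *
    g ((kappa s * r)%R, (kappa s * r * s)%R)))%E = H by apply/funext => r; exact: HE.
rewrite HN in mH; under eq_integral do rewrite HE.
have H0 r : (0 <= H r)%E.
  by rewrite /H; case: ifP => // r1; rewrite lee_fin mulr_ge0// s0'.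
have mHN : measurable_fun [set: R] (fun r => H (- r)) by apply: measurableT_comp.
rewrite integral_fold//.
have -> : (\int[mu]_(r in `[0%R, +oo[) (H r + H (- r)%R) =
    \int[mu]_(r in `[0%R, 1%R[) (H r + H (- r)%R))%E.
  rewrite integral_mkcond [RHS]integral_mkcond; apply: eq_integral => r _.
  rewrite !patchE; case: ifPn => h1; case: ifPn => h2 //.
    have r1 : (`|r| < 1) = false.
      apply/negbTE/negP => r1; case/negP: h2; rewrite inE /= in_itv /=.
      by move: h1; rewrite inE /= in_itv /= andbT => h1; rewrite h1 -(ger0_norm h1).
    by rewrite /H normrN r1 adde0.
  by case/negP: h1; move: h2; rewrite !inE /= !in_itv /= => /andP[-> _].
rewrite -ge0_integralZl//; last 3 first.
- by apply: measurable_funTS; exact: emeasurable_funD.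
- by move=> r _; rewrite adde_ge0.
- by rewrite lee_fin invr_ge0 pi_ge0.
apply: eq_integral => r; rewrite inE /= in_itv /= => /andP[r0 r1].
rewrite /H normrN (ger0_norm r0) r1 -EFinD -EFinM; congr EFin.
rewrite -mulrDr /N (M2_half Hf); last by rewrite r0.
have p0 : pi != 0 :> R by rewrite gt_eqF ?pi_gt0.
by move: (M2 r f) p0 => m; generalize (@pi R) => p p0; field.
Qed.

End BergmanNorm.

(** * Bergman spaces as weighted sequence spaces *)

Section Weights.
Variable R : realType.
Local Notation C := (R[i]).
Local Notation mu := (@lebesgue_measure R).
Implicit Types (z w : C) (r s t : R) (f g : C -> C) (a : nat -> C) (sigma : R -> R).

Definition sq_le (beta : nat -> R) a (M : R) :=
  forall J, \sum_(n < J) beta n * cabs (a n) ^+ 2 <= M.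

Lemma nneseries_leP (c : nat -> R) (M : R) : (forall n, 0 <= c n) ->
  ((\sum_(n <oo) (c n)%:E <= M%:E)%E <-> forall J, \sum_(n < J) c n <= M).
Proof.
move=> c0; split=> [H J|H].
  rewrite -lee_fin (le_trans _ H)// -sumEFin -(big_mkord xpredT (fun n => (c n)%:E)).
  by apply: nneseries_lim_ge => n _ _; rewrite lee_fin.
apply: lime_le; first by apply: is_cvg_nneseries => n _ _; rewrite lee_fin.
by apply: nearW => J; rewrite big_mkord sumEFin lee_fin.
Qed.

Lemma M2_series f a r : coefs f a -> 0 <= r < 1 ->
  ((M2 r f)%:E = \sum_(n <oo) (cabs (a n) ^+ 2 * r ^+ (2 * n))%:E)%E.
Proof.
move=> fa r01; have /andP[r0 r1] := r01.
have c0 n : 0 <= cabs (a n) ^+ 2 * r ^+ (2 * n) by rewrite mulr_ge0 ?sqr_ge0 ?exprn_ge0.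
apply/le_anti/andP; split; last first.
  by apply/(nneseries_leP _ c0) => J; exact: coefs_le_M2.
case E : (\sum_(n <oo) (cabs (a n) ^+ 2 * r ^+ (2 * n))%:E)%E => [s| |].
- rewrite lee_fin; apply: (M2_le_coefs fa r01) => J.
  by move: J; apply/(nneseries_leP _ c0); rewrite E.
- exact: leey.
- suff : (0 <= \sum_(n <oo) (cabs (a n) ^+ 2 * r ^+ (2 * n))%:E)%E by rewrite E.
  by apply: nneseries_ge0 => n _ _; rewrite lee_fin.
Qed.

Definition beta sigma n : R := \int[mu]_(r in `[0, 1[) (2 * r ^+ (2 * n).+1 * sigma r).

Section BergmanWeights.
Variable sigma : R -> R.
Hypothesis cs : {within `[0, 1[%classic, continuous sigma}.
Hypothesis s_gt0 : forall r, 0 <= r < 1 -> 0 < sigma r.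
Hypothesis s_int : mu.-integrable `[0, 1[%classic (EFin \o sigma).

Let s_ge0 r : 0 <= r < 1 -> 0 <= sigma r. Proof. by move=> /s_gt0/ltW. Qed.

Lemma measurable_weight n (k : R) :
  measurable_fun (`[0, 1[%classic : set R) (fun r => k * r ^+ n * sigma r).
Proof.
apply: measurable_funM; last exact: measurable_within_itvco.
by apply: measurable_funM => //; exact: measurable_funX.
Qed.

Lemma weight_integrable n : mu.-integrable `[0, 1[%classic
  (EFin \o (fun r => 2 * r ^+ n * sigma r)).
Proof.
apply: (@le_integrable _ _ _ mu _ _ _ (EFin \o (fun r => 2 * sigma r))) => //.
- by apply/measurable_EFinP; exact: measurable_weight.
- move=> r; rewrite /= in_itv /= => /andP[r0 r1].
  have s0 : 0 <= sigma r by apply: s_ge0; rewrite r0.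
  rewrite lee_fin !ger0_norm ?mulr_ge0 ?exprn_ge0//.
  by rewrite ler_wpM2r// ler_piMr// exprn_ile1// ltW.
- have := @integrableZl _ _ _ mu _ (measurable_itv `[0%R, 1%R[) 2 _ s_int.
  by apply: eq_integrable => // r _; rewrite /= EFinM.
Qed.

Lemma beta_fin n :
  (\int[mu]_(r in `[0%R, 1%R[) (2 * r ^+ (2 * n).+1 * sigma r)%:E = (beta sigma n)%:E)%E.
Proof.
rewrite /beta /Rintegral fineK//.
by apply: integrable_fin_num => //; exact: weight_integrable.
Qed.

Lemma bergman_series f a : coefs f a ->
  (bergman_sq sigma f = \sum_(n <oo) (beta sigma n * cabs (a n) ^+ 2)%:E)%E.
Proof.
move=> fa; rewrite (bergman_radial fa cs s_ge0).
transitivity (\int[mu]_(r in `[0%R, 1%R[)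
   \sum_(n <oo) (cabs (a n) ^+ 2 * (2 * r ^+ (2 * n).+1 * sigma r))%:E)%E.
  apply: eq_integral => r; rewrite inE /= in_itv /= => r01; have /andP[r0 r1] := r01.
  have k0 : 0 <= 2 * r * sigma r by rewrite !mulr_ge0// s_ge0.
  rewrite EFinM (M2_series fa r01) -nneseriesZl//; last first.
    by move=> n _; rewrite lee_fin mulr_ge0 ?sqr_ge0 ?exprn_ge0.
  apply: eq_eseriesr => n _; rewrite -EFinM; congr EFin.
  by rewrite (exprS r); ring.
rewrite integral_nneseries//; last 2 first.
- move=> n; apply/measurable_EFinP; apply: measurable_funM => //; exact: measurable_weight.
- move=> n r; rewrite /= in_itv /= => r01; have /andP[r0 r1] := r01.
  by rewrite lee_fin mulr_ge0 ?sqr_ge0// !mulr_ge0 ?exprn_ge0 ?s_ge0.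
apply: eq_eseriesr => n _; under eq_integral do rewrite EFinM.
rewrite ge0_integralZl//.
- by rewrite beta_fin -EFinM mulrC.
- by apply/measurable_EFinP; exact: measurable_weight.
- move=> r; rewrite /= in_itv /= => r01; have /andP[r0 r1] := r01.
  by rewrite lee_fin !mulr_ge0 ?exprn_ge0 ?s_ge0.
- by rewrite lee_fin sqr_ge0.
Qed.

(** The weights decay more slowly than any geometric sequence: on a segment [s, t] with s^2 = y and
    t < 1 the density has a positive minimum, and r^(2n) >= y^n there. This makes coefficient
    sequences of finite norm power series on the whole disc. *)
Lemma beta_lower y : 0 < y < 1 -> exists2 c, 0 < c & forall n, c * y ^+ n <= beta sigma n.
Proof.
move=> /andP[y0 y1]; pose s := Num.sqrt y.
have s0 : 0 < s by rewrite sqrtr_gt0.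
have s2 : s ^+ 2 = y by rewrite sqr_sqrtr// ltW.
have s1 : s < 1 by rewrite -(@ltr_pXn2r _ 2) ?nnegrE ?ltW// s2 expr1n.
pose t := (1 + s) / 2.
have [st t1] : s < t /\ t < 1 by rewrite /t; split; lra.
have cst' : {within `[s, t], continuous sigma}.
  apply: continuous_subspaceW cs => r /=; rewrite !in_itv /= => /andP[h1 h2].
  by rewrite (le_trans (ltW s0) h1) (le_lt_trans h2).
have [c hc Hc] := EVT_min (ltW st) cst'.
move: hc; rewrite in_itv /= => /andP[c1 c2].
have m0 : 0 < sigma c by apply: s_gt0; rewrite (le_trans (ltW s0) c1) (le_lt_trans c2).
have k0 : 0 < t - s by lra.
exists (2 * s * sigma c * (t - s)); first by rewrite !mulr_gt0.
move=> n; rewrite -lee_fin -beta_fin.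
apply: (@le_trans _ _ (\int[mu]_(r in `[s, t]) (2 * r ^+ (2 * n).+1 * sigma r)%:E)%E); last first.
  apply: ge0_subset_integral => //.
  - by apply/measurable_EFinP; exact: measurable_weight.
  - move=> r; rewrite /= in_itv /= => r01; have /andP[r0 r1] := r01.
    by rewrite lee_fin !mulr_ge0 ?exprn_ge0 ?s_ge0.
  - move=> r /=; rewrite !in_itv /= => /andP[h1 h2].
    by rewrite (le_trans (ltW s0) h1) (le_lt_trans h2).
have -> : ((2 * s * sigma c * (t - s) * y ^+ n)%:E =
    \int[mu]_(r in `[s, t]) (cst (2 * s * sigma c * y ^+ n)%:E r))%E.
  rewrite integral_cst//= lebesgue_measure_itv /= lte_fin st -EFinB -EFinM.
  by congr EFin; ring.
apply: ge0_le_integral => //.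
- by move=> r _; rewrite lee_fin !mulr_ge0 ?(ltW s0) ?(ltW m0) ?exprn_ge0 ?(ltW y0).
- apply/measurable_EFinP; apply: measurable_funS (measurable_weight _ _) => //.
  move=> r /=; rewrite !in_itv /= => /andP[h1 h2].
  by rewrite (le_trans (ltW s0) h1) (le_lt_trans h2).
- move=> r /=; rewrite in_itv /= => /andP[h1 h2]; rewrite lee_fin.
  have r0 : 0 <= r by rewrite (le_trans (ltW s0)).
  rewrite -s2 -exprM.
  have -> : 2 * s * sigma c * s ^+ (2 * n) = 2 * s ^+ (2 * n).+1 * sigma c.
    by rewrite (exprS s); ring.
  rewrite -!mulrA ler_pM2l//; apply: ler_pM.
  - by rewrite exprn_ge0// ltW.
  - exact: ltW.
  - by rewrite lerXn2r ?nnegrE ?(ltW s0).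
  - by apply: Hc; rewrite in_itv /= h1.
Qed.

Lemma beta_gt0 n : 0 < beta sigma n.
Proof.
have [|c c0 Hc] := @beta_lower (1 / 2); first by lra.
by apply: lt_le_trans (Hc n); rewrite mulr_gt0// exprn_gt0.
Qed.

Lemma beta_dec m n : (m <= n)%N -> beta sigma n <= beta sigma m.
Proof.
move=> mn; apply: le_Rintegral => //; [exact: weight_integrable|exact: weight_integrable|].
move=> r; rewrite /= in_itv /= => /andP[r0 r1].
rewrite ler_wpM2r ?s_ge0 ?r0// ler_wpM2l//.
by rewrite ler_wiXn2l ?(ltW r1)// ltnS leq_mul2l mn orbT.
Qed.

Lemma bergmanP f a M : coefs f a ->
  ((bergman_sq sigma f <= M%:E)%E <-> sq_le (beta sigma) a M).
Proof.
move=> fa; rewrite (bergman_series fa); apply: nneseries_leP => n.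
by rewrite mulr_ge0 ?sqr_ge0 ?ltW ?beta_gt0.
Qed.

Lemma bergman_ge0 f a : coefs f a -> (0 <= bergman_sq sigma f)%E.
Proof.
move=> fa; rewrite (bergman_series fa); apply: nneseries_ge0 => n _ _.
by rewrite lee_fin mulr_ge0 ?sqr_ge0 ?ltW ?beta_gt0.
Qed.

End BergmanWeights.

End Weights.

(** * Doubling of the weights from condition (W2) *)

Section Doubling.
Variable R : realType.
Local Notation mu := (@lebesgue_measure R).
Local Notation C := (R[i]).

Lemma continuous_cont_on (u : R -> R) (x y : R) : continuous u -> cont_on u x y.
Proof.
move=> cu t _ e e0; have /cvgrPdist_lt/(_ e e0)[dl /= dl0 Hd] := cu t.
by exists dl => // t' _ ht; rewrite distrC; apply: Hd; rewrite /= distrC.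
Qed.

Lemma itv_int_monom (n : nat) (x : R) : 0 <= x ->
  itv_int (fun s => s ^+ n) 0 x = x ^+ n.+1 / n.+1%:R.
Proof.
rewrite le_eqVlt => /predU1P[<-|x0].
  by rewrite /itv_int set_itv1 Rintegral_set1 expr0n mul0r.
have cX (m : nat) : continuous (fun s : R => s ^+ m) by exact: exprn_continuous.
have dX (m : nat) (y : R) : derivable (fun s : R => s ^+ m) y 1 by exact: exprn_derivable.
have := @continuous_FTC2 R (fun s => n.+1%:R * s ^+ n) (fun s : R => s ^+ n.+1) 0 x x0.
have cf : continuous (fun s : R => n.+1%:R * s ^+ n).
  move=> s; have h1 : {for s, continuous (fun _ : R => n.+1%:R : R)} by exact: cst_continuous.
  exact: (continuousM h1 (cX n s)).
move=> /(_ (continuous_subspaceT cf)) H.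
have : (\int[mu]_(y in `[0%R, x]) (n.+1%:R * y ^+ n)%:E = (x ^+ n.+1 - 0 ^+ n.+1)%:E)%E.
  apply: H.
    split; first by move=> y _; exact: dX.
      by apply: cvg_at_right_filter; exact: cX.
    by apply: cvg_at_left_filter; exact: cX.
  by move=> y _; rewrite exp_derive1.
rewrite expr0n subr0 => H2.
have : itv_int (fun s => n.+1%:R * s ^+ n) 0 x = x ^+ n.+1 by rewrite /itv_int /Rintegral H2.
rewrite itv_intZ; last exact: continuous_cont_on.
by move=> <-; rewrite mulrC mulKf// pnatr_eq0.
Qed.

Lemma within_one : {within `[0, 1[%classic, continuous ((fun=> 1) : R -> R)}.
Proof. by apply: continuous_subspaceT => x; exact: cst_continuous. Qed.

Lemma integrable_one : mu.-integrable `[0, 1[%classic (EFin \o ((fun=> 1) : R -> R)).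
Proof.
apply: (@integrableS _ _ _ mu `[0, 1]%classic) => //.
  by move=> x /=; rewrite !in_itv /= => /andP[-> /ltW].
by apply/cont_on_integrable/cont_on_cst.
Qed.

Lemma beta_one n : beta ((fun=> 1) : R -> R) n = n.+1%:R^-1.
Proof.
rewrite /beta Rintegral_itv_bndo_bndc; last first.
  exact: (weight_integrable within_one (fun _ _ => ltr01) integrable_one).
transitivity (itv_int (fun r : R => 2 * r ^+ (2 * n).+1) 0 1).
  by apply: itv_int_eq => r _; rewrite mulr1.
rewrite itv_intZ; last by apply: continuous_cont_on; exact: exprn_continuous.
rewrite itv_int_monom// expr1n mul1r.
have -> : (2 * n).+2 = (2 * n.+1)%N by rewrite mulnS.
by rewrite natrM invfM mulrA mulfV ?mul1r.
Qed.

(* [t = rho ^+ m] turns the kernel [t - s ^+ m] into a polynomial on [0, rho]. *)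
Lemma kernel_integral (e m : nat) (rho : R) : (0 < m)%N -> 0 <= rho < 1 ->
  (\int[mu]_(s in `[0%R, 1%R[) (s ^+ e * Num.max (rho ^+ m - s ^+ m) 0)%:E =
   (rho ^+ (e + m).+1 * (e.+1%:R^-1 - (e + m).+1%:R^-1))%:E)%E.
Proof.
move=> m0 /andP[r0 r1]; pose h s := s ^+ e * (rho ^+ m - s ^+ m).
have hE : h = fun s => rho ^+ m * s ^+ e - s ^+ (e + m).
  by apply/funext => s; rewrite /h mulrBr exprD mulrC.
have cX (k : nat) : cont_on (fun s : R => s ^+ k) 0 rho.
  by apply: continuous_cont_on; exact: exprn_continuous.
have ch : cont_on h 0 rho by rewrite hE; apply: cont_onB => //; exact: cont_onZ.
transitivity (\int[mu]_(s in `[0%R, rho]) (h s)%:E)%E.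
  rewrite integral_mkcond [RHS]integral_mkcond; apply: eq_integral => s _.
  rewrite !patchE !mem_setE !in_itv /=.
  have [s0|s0] := boolP (0 <= s) => //=.
  have [sr|rs] := leP s rho.
    rewrite (le_lt_trans sr r1); congr EFin; rewrite /h max_l// subr_ge0.
    by rewrite lerXn2r ?nnegrE.
  case: ifP => // _; rewrite max_r ?mulr0// subr_le0.
  by rewrite lerXn2r ?nnegrE// ltW.
have -> : (\int[mu]_(s in `[0%R, rho]) (h s)%:E = (itv_int h 0 rho)%:E)%E.
  rewrite /itv_int /Rintegral fineK//; apply: integrable_fin_num => //.
  exact: cont_on_integrable.
congr EFin; rewrite hE itv_intB//; last exact: cont_onZ.
rewrite itv_intZ// !itv_int_monom//.
by rewrite mulrBr mulrA -exprD addnS [(m + e)%N]addnC.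
Qed.

Section Weight.
Variable sigma : R -> R.
Hypothesis cs : {within `[0, 1[%classic, continuous sigma}.
Hypothesis s_gt0 : forall r, 0 <= r < 1 -> 0 < sigma r.
Hypothesis s_int : mu.-integrable `[0, 1[%classic (EFin \o sigma).

Let A : set R := `[0, 1[%classic.
Let mA : measurable A. Proof. exact: measurable_itv. Qed.

(** Integrating in t gives s^e * omega (s^m); integrating in s gives a multiple of a power of t
    times sigma t. Exchanging the two expresses moments of omega through moments of sigma, with no
    differentiation. *)
Definition kernel_fun (e m : nat) (p : R * R) : \bar R :=
  ((fun p => (p.1 ^+ e * Num.max (p.2 - p.1 ^+ m) 0 * sigma p.2)%:E) \_ (A `*` A)) p.

Lemma kernel_ge0 e m p : (0 <= kernel_fun e m p)%E.
Proof.
rewrite /kernel_fun patchE; case: ifP => // /set_mem[]; rewrite /A /= !in_itv /=.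
move=> /andP[p1 _] p2; rewrite lee_fin !mulr_ge0 ?exprn_ge0//; last exact/ltW/s_gt0.
by rewrite le_max lexx orbT.
Qed.

Lemma measurable_kernel e m : measurable_fun [set: R * R] (kernel_fun e m).
Proof.
have mAA : measurable (A `*` A) by exact: measurableX.
apply: (measurable_restrictT _ mAA).1; apply/measurable_EFinP.
apply: measurable_funM.
  apply: measurable_funTS; apply: measurable_funM; first exact: measurable_funX.
  apply: measurable_maxr => //; apply: measurable_funB => //; exact: measurable_funX.
have h : snd @` (A `*` A) `<=` A by move=> _ [p [_ p2] <-].
exact: (measurable_comp mA h (measurable_within_itvco cs) (measurable_funTS measurable_snd)).
Qed.

Lemma omega_kernel e m s : (0 < m)%N -> 0 <= s < 1 ->
  (\int[mu]_t kernel_fun e m (s, t) = (s ^+ e * omega_sigma sigma (s ^+ m))%:E)%E.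
Proof.
move=> m0 s01; have /andP[s0 s1] := s01.
have sm : 0 <= s ^+ m < 1 by rewrite exprn_ge0//= exprn_ilt1// -lt0n.
have /andP[sm0 sm1] := sm.
pose B : set R := `[s ^+ m, 1%R[%classic.
have BA : B `<=` A.
  by move=> t; rewrite /A /B /= !in_itv /= => /andP[h1 h2]; rewrite h2 (le_trans sm0).
have mB : measurable B by exact: measurable_itv.
have iB : mu.-integrable B (EFin \o (fun t => (t - s ^+ m) * sigma t)).
  apply: (@le_integrable _ _ _ mu _ _ _ (EFin \o sigma)) => //.
  - apply/measurable_EFinP; apply: measurable_funM; first exact: measurable_funB.
    exact: (measurable_funS mA BA (measurable_within_itvco cs)).
  - move=> t; rewrite /B /= in_itv /= => /andP[t0 t1].
    have st : 0 < sigma t by apply: s_gt0; rewrite t1 (le_trans sm0).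
    rewrite lee_fin !ger0_norm ?mulr_ge0 ?subr_ge0 ?(ltW st)//.
    by rewrite ler_piMl ?(ltW st)//; lra.
  - exact: integrableS s_int.
rewrite EFinM /omega_sigma fineK; last exact: integrable_fin_num iB.
rewrite -ge0_integralZl//; last 3 first.
- by have /integrableP[] := iB.
- move=> t; rewrite /= in_itv /= => /andP[t0 t1]; rewrite lee_fin mulr_ge0 ?subr_ge0//.
  by apply/ltW/s_gt0; rewrite t1 (le_trans sm0).
- by rewrite lee_fin exprn_ge0.
rewrite [RHS]integral_mkcond; apply: eq_integral => t _.
have EA : ((s, t) \in A `*` A) = (0 <= t < 1).
  apply/idP/idP; rewrite inE /A /= !in_itv /=; first by case.
  by split.
rewrite /kernel_fun !patchE EA /B mem_setE in_itv /=.
have [t1|t1] := ltP t 1; last by rewrite !andbF.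
rewrite !andbT; have [st|ts] := leP (s ^+ m) t.
  by rewrite (le_trans sm0 st) max_l ?subr_ge0// -EFinM mulrA.
by case: ifP => // _; rewrite max_r ?subr_le0 ?ltW// mulr0 mul0r.
Qed.

(** With rho = t^(1/m) the inner integral is a multiple of rho^(e+m+1); the condition on [k] makes
    this the integral power t^k. *)
Lemma kernel_moment e m : (0 < m)%N -> forall k, ((e + m).+1 = m * k)%N ->
  (\int[mu]_s \int[mu]_t kernel_fun e m (s, t) =
   ((e.+1%:R^-1 - (e + m).+1%:R^-1) * \int[mu]_(t in `[0%R, 1%R[) (t ^+ k * sigma t))%:E)%E.
Proof.
move=> m0 k emk.
rewrite -(fubini_tonelli1 (m1 := mu) (m2 := mu) _ (measurable_kernel e m) (kernel_ge0 e m)).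
rewrite (fubini_tonelli2 (m1 := mu) (m2 := mu) _ (measurable_kernel e m) (kernel_ge0 e m)).
set c := _ - _.
have c0 : 0 <= c.
  by rewrite subr_ge0 lef_pV2 ?posrE ?ltr0n// ler_nat ltnS leq_addr.
transitivity (\int[mu]_(t in A) (c%:E * (t ^+ k * sigma t)%:E))%E.
  rewrite [RHS]integral_mkcond; apply: eq_integral => t _.
  rewrite /fubini_G patchE; case: ifPn => [/set_mem|]; last first.
    rewrite notin_setE => nA; apply: integral0_eq => s _; rewrite /kernel_fun patchE ifN//.
    by rewrite notin_setE => -[_ /= /nA].
  rewrite /A /= in_itv /= => t01; have /andP[t0 t1] := t01.
  have st := s_gt0 t01.
  pose rho := t `^ m%:R^-1.
  have rm : rho ^+ m = t.
    by rewrite -powR_mulrn ?powR_ge0// -powRrM mulVf ?powRr1// pnatr_eq0 -lt0n.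
  have r0 : 0 <= rho by exact: powR_ge0.
  have r1 : rho < 1 by rewrite ltNge; apply/negP => h; move: t1; rewrite -rm ltNge exprn_ege1.
  transitivity (\int[mu]_(s in A) ((sigma t)%:E * (s ^+ e * Num.max (rho ^+ m - s ^+ m) 0)%:E))%E.
    rewrite [RHS]integral_mkcond; apply: eq_integral => s _; rewrite /kernel_fun !patchE.
    have -> : ((s, t) \in A `*` A) = (s \in A).
      apply/idP/idP; rewrite !inE /=; first by case.
      by split => //; rewrite /A /= in_itv.
    by case: ifP => // _; rewrite -EFinM rm mulrC.
  rewrite ge0_integralZl//; last 3 first.
  - apply/measurable_EFinP; apply: measurable_funM => //.
    by apply: measurable_maxr => //; apply: measurable_funB.
  - by move=> s; rewrite /A /= in_itv /= => /andP[s0 _]; rewrite lee_fin mulr_ge0 ?exprn_ge0// le_max lexx orbT.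
  - by rewrite lee_fin ltW.
  rewrite kernel_integral ?r0// -!EFinM; congr EFin.
  by rewrite -/c emk exprM rm; ring.
have mtk : measurable_fun A (fun t => t ^+ k * sigma t).
  apply: measurable_funM; first exact: measurable_funX.
  exact: measurable_within_itvco.
rewrite ge0_integralZl//; last 2 first.
- exact/measurable_EFinP.
- move=> t; rewrite /A /= in_itv /= => t01; have /andP[t0 t1] := t01.
  by rewrite lee_fin mulr_ge0 ?exprn_ge0// ltW// s_gt0.
rewrite EFinM /Rintegral fineK//; apply: integrable_fin_num => //.
apply: (@le_integrable _ _ _ mu _ _ _ (EFin \o sigma)) => //.
- exact/measurable_EFinP.
- move=> t; rewrite /= in_itv /= => t01; have /andP[t0 t1] := t01; have st := s_gt0 t01.
  rewrite lee_fin !ger0_norm ?mulr_ge0 ?exprn_ge0 ?(ltW st)//.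
  by rewrite ler_piMl ?(ltW st)// exprn_ile1// ltW.
Qed.

Hypothesis w_ge0 : forall r, 0 <= r < 1 -> 0 <= omega_sigma sigma r.
Variable delta : R.
Hypothesis delta0 : 0 < delta.
Hypothesis W2 : forall r s, 0 <= r -> r <= s -> s < 1 ->
  omega_sigma sigma r * (1 - r) `^ (- (1 + delta)) <=
  omega_sigma sigma s * (1 - s) `^ (- (1 + delta)).

(** Condition (W2) at the points s^2 <= s costs the ratio (1 - s^2) / (1 - s) = 1 + s <= 2 to the
    power 1 + delta. *)
Lemma omega_sqr s : 0 <= s < 1 ->
  omega_sigma sigma (s ^+ 2) <= 2 `^ (1 + delta) * omega_sigma sigma s.
Proof.
move=> s01; have /andP[s0 s1] := s01; set q := 1 + delta.
have q0 : 0 < q by rewrite addr_gt0.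
have ss : s ^+ 2 <= s by rewrite expr2 ler_piMr// ltW.
have := W2 (sqr_ge0 s) ss s1; rewrite -/q.
have d0 : 0 < 1 - s by rewrite subr_gt0.
have E : 1 - s ^+ 2 = (1 - s) * (1 + s) by ring.
have k0 : 0 < (1 - s ^+ 2) `^ q by rewrite powR_gt0// E mulr_gt0// ltr_pwDl.
rewrite !powRN ler_pdivrMr// => /le_trans; apply.
have k1 : 0 < (1 - s) `^ q by exact: powR_gt0.
rewrite E powRM ?(ltW d0)//; last by rewrite addr_ge0.
rewrite mulrA divfK ?gt_eqF// mulrC ler_wpM2r ?w_ge0//.
by rewrite ge0_ler_powR ?(ltW q0)// ?nnegrE ?addr_ge0//; lra.
Qed.

(** [omega_sqr] is integrated against s^e with e + 1 = 4 p. Then omega (s^2) yields the moment of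
    order 2 p + 1, which is that of beta p, and omega s yields 4 p + 1, that of beta (2 p). The
    numerical factors satisfy c1 <= c2, which is the favourable direction. *)
Lemma beta_double p : (0 < p)%N -> beta sigma p <= 2 `^ (1 + delta) * beta sigma (2 * p).
Proof.
move=> p0; set Q := 2 `^ _; have Q0 : 0 < Q by exact: powR_gt0.
pose e := (4 * p).-1.
have e1 : e.+1 = (4 * p)%N by rewrite prednK// muln_gt0.
pose I k := \int[mu]_(t in `[0%R, 1%R[) (t ^+ k * sigma t).
have bI n : beta sigma n = 2 * I (2 * n).+1.
  rewrite /I -RintegralZl//; last first.
    apply: (@le_integrable _ _ _ mu _ _ _ (EFin \o sigma)) => //.
    - apply/measurable_EFinP; apply: measurable_funM; first exact: measurable_funX.
      exact: measurable_within_itvco.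
    - move=> t; rewrite /= in_itv /= => t01; have /andP[t0 t1] := t01; have st := s_gt0 t01.
      rewrite lee_fin !ger0_norm ?mulr_ge0 ?exprn_ge0 ?(ltW st)//.
      by rewrite ler_piMl ?(ltW st)// exprn_ile1// ltW.
  by apply: eq_Rintegral => t _; rewrite mulrA.
have K2 := @kernel_moment e 2 isT (2 * p).+1 ltac:(lia).
have K1 := @kernel_moment e 1 isT (4 * p).+1 ltac:(lia).
have mF m := measurable_fun_fubini_tonelli_F (m2 := mu) _ (measurable_kernel e m) (kernel_ge0 e m).
have : (\int[mu]_s \int[mu]_t kernel_fun e 2 (s, t) <=
    Q%:E * \int[mu]_s \int[mu]_t kernel_fun e 1 (s, t))%E.
  rewrite -ge0_integralZl//; last 3 first.
  - exact: mF.
  - by move=> s _; apply: integral_ge0 => t _; exact: kernel_ge0.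
  - by rewrite lee_fin ltW.
  apply: ge0_le_integral => //.
  - by move=> s _; apply: integral_ge0 => t _; exact: kernel_ge0.
  - exact: mF.
  - by apply: measurable_funeM; exact: mF.
  move=> s _; have [s01|s01] := boolP (0 <= s < 1).
    rewrite !omega_kernel// expr1 -EFinM lee_fin mulrCA ler_wpM2l ?omega_sqr//.
    by rewrite exprn_ge0//; have /andP[] := s01.
  rewrite !integral0_eq ?mule0// => t _; rewrite /kernel_fun patchE ifN//.
    by apply/negP; rewrite inE /A /= !in_itv /= => -[h _]; rewrite h in s01.
  by apply/negP; rewrite inE /A /= !in_itv /= => -[h _]; rewrite h in s01.
rewrite K2 K1 -EFinM lee_fin -/(I _) -/(I _) !bI => H.
have I0 k : 0 <= I k.
  apply: Rintegral_ge0 => t; rewrite /= in_itv /= => t01; have /andP[t0 t1] := t01.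
  by rewrite mulr_ge0 ?exprn_ge0// ltW// s_gt0.
set c2 := _ - _ in H; set c1 := e.+1%:R^-1 - (e + 1).+1%:R^-1 in H.
have c12 : c1 <= c2.
  by rewrite /c1 /c2 lerD2l lerN2 lef_pV2 ?posrE ?ltr0n// ler_nat; lia.
have c20 : 0 < c1 by rewrite /c1 subr_gt0 ltf_pV2 ?posrE ?ltr0n// ltr_nat; lia.
rewrite [leRHS]mulrCA ler_pM2l// -(ler_pM2l (lt_le_trans c20 c12)) (le_trans H)//.
have -> : (2 * (2 * p)).+1 = (4 * p).+1 by lia.
by rewrite [leRHS]mulrCA ler_pM2l// ler_wpM2r.
Qed.

End Weight.

(** The quotient n %/ m is used because kernel sums are later compared over blocks of m consecutive
    indices. *)
Definition doubling (beta : nat -> R) := forall m, (0 < m)%N ->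
  exists2 K, 0 < K & forall n, beta (n %/ m)%N <= K * beta n.

Lemma doubling_one : doubling (fun=> 1).
Proof. by move=> m _; exists 1 => // n; rewrite mulr1. Qed.

Lemma doubling_of_double (b : nat -> R) Q : 0 < Q -> (forall n, 0 < b n) ->
  (forall m n, (m <= n)%N -> b n <= b m) ->
  (forall p, (0 < p)%N -> b p <= Q * b (2 * p)%N) -> doubling b.
Proof.
(* With 2 m doublings, 2^i >= 2 m, so 2^i (n %/ m) >= n once n >= m. The second part of the constant
   serves n < m, where n %/ m = 0. *)
move=> Q0 b0 bdec bQ m m0; pose i := (2 * m)%N.
have iter p j : (0 < p)%N -> b p <= Q ^+ j * b (2 ^ j * p)%N.
  move=> p0; elim: j => [|j IH]; first by rewrite expr0 expn0 mul1n mul1r.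
  rewrite (le_trans IH)// exprSr -mulrA ler_pM2l ?exprn_gt0// expnS -mulnA bQ//.
  by rewrite muln_gt0 expn_gt0.
exists (Q ^+ i + b 0%N / b m) => [|n]; first by rewrite addr_gt0 ?exprn_gt0 ?divr_gt0.
have [nm|mn] := ltnP n m.
  rewrite divn_small// mulrDl (@le_trans _ _ (b 0%N / b m * b n))//; last first.
    by rewrite lerDr mulr_ge0 ?exprn_ge0 ?ltW.
  by rewrite mulrAC ler_pdivlMr// ler_pM2l// bdec// ltnW.
have p0 : (0 < n %/ m)%N by rewrite divn_gt0.
rewrite (le_trans (iter _ i p0))// mulrDl (@le_trans _ _ (Q ^+ i * b n))//; last first.
  by rewrite lerDl mulr_ge0 ?divr_ge0 ?ltW.
rewrite ler_pM2l ?exprn_gt0// bdec//.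
have h1 : (n < (n %/ m).+1 * m)%N by exact: ltn_ceil.
have h2 : (2 * m <= 2 ^ i)%N by rewrite ltnW// ltn_expl.
by nia.
Qed.

End Doubling.

(** * The Hardy norm, Cauchy-Schwarz and extraction of subsequences *)

Section Preliminaries.
Variable R : realType.
Local Notation mu := (@lebesgue_measure R).
Local Notation C := (R[i]).
Implicit Types (f g : C -> C) (a b : nat -> C).

Lemma hardy_sqE f : analytic_disc f ->
  hardy_sq f = ereal_sup [set (M2 r f)%:E | r in `[0%R, 1%R[%classic].
Proof.
move=> Hf; congr ereal_sup; apply/seteqP.
have E r : 0 <= r < 1 -> (((2 * pi)^-1)%:E * \int[mu]_(t in `[0%R, (2 * pi)%R])
    ((cabs (f (cpt (r * cos t) (r * sin t)))) ^+ 2)%:E = (M2 r f)%:E)%E.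
  move=> r01; rewrite /M2 /itv_int /Rintegral EFinM fineK//.
  apply: integrable_fin_num => //; apply: cont_on_integrable.
  exact/circ_cont_cabs2/analytic_circ_cont.
by split=> _ [r r01 <-]; exists r => //; [rewrite -E//|rewrite E//]; move: r01; rewrite /= in_itv.
Qed.

Lemma poly_le_of_lt1 (c : nat -> R) J (M : R) : (forall n, 0 <= c n) ->
  (forall r, 0 <= r < 1 -> \sum_(n < J) c n * r ^+ (2 * n) <= M) -> \sum_(n < J) c n <= M.
Proof.
move=> c0 H; pose p r := \sum_(n < J) c n * r ^+ (2 * n).
have cp : continuous p.
  rewrite /p; elim: J {H p} => [|J IH] r.
    by under eq_fun do rewrite big_ord0; exact: cst_continuous.
  under eq_fun do rewrite big_ord_recr /=.
  have h1 : {for r, continuous (fun _ : R => c J)} by exact: cst_continuous.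
  have h2 := continuousM h1 (@exprn_continuous _ (2 * J)%N r).
  exact: (continuousD (IH r) h2).
have p1 : p 1 = \sum_(n < J) c n by apply: eq_bigr => n _; rewrite expr1n mulr1.
rewrite -p1; apply/ler_addgt0Pr => e e0.
have /cvgrPdist_lt/(_ e e0)[dl /= dl0 Hd] := cp 1.
pose r := Num.max 0 (1 - dl / 2).
have r0 : 0 <= r by rewrite le_max lexx.
have r1 : r < 1 by rewrite gt_max ltr01 /=; lra.
have rd : 1 - dl < r by rewrite lt_max; apply/orP; right; lra.
have h1 : `|p 1 - p r| < e by apply: Hd => /=; rewrite ger0_norm; lra.
have h2 : p r <= M by apply: H; rewrite r0.
by move: h1; rewrite ltr_norml; lra.
Qed.

Lemma hardyP f a M : coefs f a -> ((hardy_sq f <= M%:E)%E <-> sq_le (fun=> 1) a M).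
Proof.
move=> fa; rewrite (hardy_sqE (coefs_analytic fa)); split=> [H J|H].
  under eq_bigr do rewrite mul1r; apply: (@poly_le_of_lt1 (fun n => cabs (a n) ^+ 2)) => [n|r r01].
    exact: sqr_ge0.
  rewrite -lee_fin (le_trans _ H)// (@le_trans _ _ (M2 r f)%:E)//.
    by rewrite lee_fin coefs_le_M2.
  by apply: ereal_sup_ubound; exists r.
apply: ge_ereal_sup => _ [r /= + <-]; rewrite in_itv /= => r01; rewrite lee_fin.
apply: (M2_le_coefs fa r01) => J; apply: le_trans (H J); apply: ler_sum => n _.
have /andP[r0 r1] := r01.
by rewrite mul1r ler_piMr ?sqr_ge0// exprn_ile1// ltW.
Qed.

Lemma hardy_ge0 f a : coefs f a -> (0 <= hardy_sq f)%E.
Proof.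
move=> fa; rewrite (hardy_sqE (coefs_analytic fa)).
apply: (@le_trans _ _ (M2 0 f)%:E); first by rewrite lee_fin M2_ge0.
by apply: ereal_sup_ubound; exists 0 => //=; rewrite in_itv /= lexx ltr01.
Qed.

Lemma cauchy_schwarz_sum (s : seq nat) (x y : nat -> R) :
  (\sum_(i <- s) x i * y i) ^+ 2 <= (\sum_(i <- s) x i ^+ 2) * (\sum_(i <- s) y i ^+ 2).
Proof.
set P := \sum_(i <- s) _; set A := \sum_(i <- s) x i ^+ 2; set B := \sum_(i <- s) y i ^+ 2.
have B0 : 0 <= B by apply: sumr_ge0 => i _; exact: sqr_ge0.
have H t : 0 <= A - 2 * t * P + t ^+ 2 * B.
  have -> : A - 2 * t * P + t ^+ 2 * B = \sum_(i <- s) (x i - t * y i) ^+ 2.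
    rewrite /A /P /B !mulr_sumr -sumrB -big_split; apply: eq_bigr => i _ /=; ring.
  by apply: sumr_ge0 => i _; exact: sqr_ge0.
have [B00|Bn] := eqVneq B 0.
  have [->|P0] := eqVneq P 0; first by rewrite B00 mulr0 expr0n.
  have := H ((A + 1) / (2 * P)); rewrite B00 mulr0 addr0.
  have -> : A - 2 * ((A + 1) / (2 * P)) * P = - 1 by field.
  lra.
have Bpos : 0 < B by rewrite lt_def Bn.
have := H (P / B); have -> : A - 2 * (P / B) * P + (P / B) ^+ 2 * B = A - P ^+ 2 / B.
  by field.
by rewrite subr_ge0 ler_pdivrMr.
Qed.

(** Norm of the evaluation at [w] on polynomials with a zero of order N: Cauchy-Schwarz against a
    tail of the reproducing kernel. *)
Lemma tail_eval (beta : nat -> R) (N d : nat) a (w : C) : (forall n, 0 < beta n) ->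
  (forall n, (n < N)%N -> a n = 0) ->
  cabs (\sum_(n < d) a n * w ^+ n) ^+ 2 <=
  (\sum_(n < d) beta n * cabs (a n) ^+ 2) * (\sum_(N <= n < d) cabs w ^+ (2 * n) / beta n).
Proof.
move=> b0 aN; pose x n := Num.sqrt (beta n) * cabs (a n).
pose y n := cabs w ^+ n / Num.sqrt (beta n).
have s0 n : 0 < Num.sqrt (beta n) by rewrite sqrtr_gt0.
have s2 n : Num.sqrt (beta n) ^+ 2 = beta n by rewrite sqr_sqrtr// ltW.
have tail (T : zmodType) (F : nat -> T) : (forall n, (n < N)%N -> F n = 0) ->
    \sum_(n < d) F n = \sum_(N <= n < d) F n.
  move=> F0; rewrite -(big_mkord xpredT F); have [dN|Nd] := leqP d N.
    rewrite [RHS]big_geq// big_nat big1// => n /= nd; apply: F0.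
    exact: leq_trans nd dN.
  rewrite (big_cat_nat (n := N))//=; last exact: ltnW.
  by rewrite big_nat big1 ?add0r// => n /= /F0.
rewrite (tail _ (fun n => a n * w ^+ n)); last by move=> n /aN ->; rewrite mul0r.
rewrite (tail _ (fun n => beta n * cabs (a n) ^+ 2)); last first.
  by move=> n /aN ->; rewrite cabs0 expr0n mulr0.
apply: (@le_trans _ _ ((\sum_(N <= n < d) x n * y n) ^+ 2)).
  have h n : cabs (a n * w ^+ n) = x n * y n.
    by rewrite cabsM cabsX /x /y; field; rewrite gt_eqF.
  rewrite lerXn2r ?nnegrE ?cabs_ge0 ?sumr_ge0//.
    by move=> i _; rewrite -h cabs_ge0.
  by rewrite -(eq_bigr _ (fun n _ => h n)); exact: ler_cabs_sum.
rewrite (le_trans (cauchy_schwarz_sum _ _ _))// le_eqVlt; apply/orP; left; apply/eqP.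
congr (_ * _); apply: eq_bigr => n _; rewrite exprMn ?exprVn s2//.
by rewrite -exprM mulnC.
Qed.

Lemma selfmap_circle_sup phi r : analytic_selfmap phi -> 0 <= r < 1 ->
  exists rho : R, 0 <= rho < 1 /\ forall t, 0 <= t <= 2 * pi -> cabs (phi (circ r t)) <= rho.
Proof.
move=> [Hphi phi1] r01; have /andP[r0 r1] := r01.
have p0 : 0 <= 2 * pi :> R by rewrite mulr_ge0// pi_ge0.
have cphi := cont_on_within (circ_cont_cabs2 (analytic_circ_cont Hphi r01)).
have [t0 ht0 Hmax] := EVT_max p0 cphi.
exists (cabs (phi (circ r t0))); rewrite cabs_ge0 phi1 ?cabs_circ ?ger0_norm//; split=> // t ht.
by rewrite -(@ler_pXn2r _ 2) ?nnegrE ?cabs_ge0// Hmax// in_itv.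
Qed.

Lemma fatou_finite (beta : nat -> R) (u : nat -> nat -> C) b J B :
  (forall k e, 0 < e -> exists D, forall d, (D <= d)%N -> cabs (u d k - b k) <= e) ->
  (forall d, \sum_(k < J) beta k * cabs (u d k) ^+ 2 <= B) ->
  \sum_(k < J) beta k * cabs (b k) ^+ 2 <= B.
Proof.
move=> ub HB.
have cv k : cabs (u d k) @[d --> \oo] --> cabs (b k).
  apply/cvgrPdist_le => e e0; have [D HD] := ub k e e0; exists D => // d /= /HD h.
  have := ler_cabs_dist (u d k) (b k); have := ler_cabs_dist (b k) (u d k).
  by rewrite [cabs (b k - _)]cabsB ler_norml; lra.
have cs : (\sum_(k < J) beta k * cabs (u d k) ^+ 2) @[d --> \oo] -->
    \sum_(k < J) beta k * cabs (b k) ^+ 2.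
  elim: J {HB} => [|J IH].
    by rewrite big_ord0; under eq_fun do rewrite big_ord0; exact: cvg_cst.
  rewrite big_ord_recr /=; under eq_fun do rewrite big_ord_recr /=.
  apply: cvgD => //; apply: cvgMr; rewrite expr2; under eq_fun do rewrite expr2.
  exact: cvgM.
have := cvg_lim (@Rhausdorff R) cs => <-.
by apply: limr_le; [apply/cvg_ex; eexists; exact: cs|exact: nearW].
Qed.

(** An ultrafilter finer than the one at infinity gives the limits of all coordinates at once; a
    subsequence is then read off by meeting finitely many of its members at a time. *)
Lemma diagonal_extraction (A : nat -> nat -> C) (B : nat -> R) :
  (forall k n, cabs (A k n) <= B n) ->
  exists (s : nat -> nat) b, {homo s : m n / (m < n)%N >-> (m < n)%N} /\
  forall n e, 0 < e -> exists K, forall k, (K <= k)%N -> cabs (A (s k) n - b n) <= e.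
Proof.
move=> AB.
have [U [Uultra Utail]] := ultraFilterLemma (eventually_filter : ProperFilter (\oo : set_system nat)).
have PU : ProperFilter U by exact: ultra_proper.
have FU : Filter U by exact: filter_filter.
have real_lim (u : nat -> R) M : (forall k, `|u k| <= M) ->
    exists l : R, forall e, 0 < e -> U [set k | `|u k - l| < e].
  move=> uM.
  have Fu : (u @ U) `[- M, M]%classic.
    have -> : (u @ U) `[- M, M]%classic = U setT.
      by congr U; apply/seteqP; split=> // k _ /=; rewrite in_itv /= -ler_norml.
    exact: filterT.
  have [l [_ ul]] := @segment_compact R (- M) M (u @ U) _ Fu.
  exists l => e e0; have [//|h] := in_ultra_setVsetC [set k | `|u k - l| < e] Uultra.
  have h' : (u @ U) (~` ball l e).
    change (U (u @^-1` (~` ball l e))); apply: filterS h => k /=; by rewrite /ball /= distrC.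
  by have [x []] := ul _ _ h' (nbhsx_ballx l _ e0).
have lim n : exists bn, forall e, 0 < e -> U [set k | cabs (A k n - bn) < e].
  have [x Hx] := real_lim (fun k => complex.Re (A k n)) (B n)
    (fun k => le_trans (ler_Re_cabs _) (AB k n)).
  have [y Hy] := real_lim (fun k => complex.Im (A k n)) (B n)
    (fun k => le_trans (ler_Im_cabs _) (AB k n)).
  exists (cpt x y) => e e0; have e2 : 0 < e / 2 by lra.
  apply: filterS (filterI (Hx _ e2) (Hy _ e2)) => k [/= h1 h2].
  rewrite (le_lt_trans (cabs_le_ReIm _))// cReB cImB /=; lra.
have [b Hb] := choice lim.
have pick N : exists k, (N <= k)%N /\ forall i, (i < N)%N -> cabs (A k i - b i) < N.+1%:R^-1.
  have UN : U [set k | (N <= k)%N] by apply: Utail; exists N.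
  have UA M : (M <= N)%N -> U [set k | forall i, (i < M)%N -> cabs (A k i - b i) < N.+1%:R^-1].
    elim: M => [|M IH] MN; first by apply: filterS UN.
    have i0 : 0 < N.+1%:R^-1 :> R by rewrite invr_gt0 ltr0n.
    apply: filterS (filterI (IH (ltnW MN)) (Hb M _ i0)) => k [/= h1 h2] i.
    by rewrite ltnS leq_eqVlt => /orP[/eqP->|/h1].
  by have [k [/= h1 h2]] := filter_ex (filterI UN (UA N (leqnn N))); exists k.
have [ka Hka] := choice pick.
(* [ka N] is at least N and settles the first N coordinates within 1 / (N + 1); the argument max (m
   + 1, s m + 1) makes [s] increase while every coordinate is eventually settled. *)
pose s := fix s m := if m is p.+1 then ka (maxn p.+1 (s p).+1) else ka 0%N.
have sS m : s m.+1 = ka (maxn m.+1 (s m).+1) by [].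
exists s, b; split.
  apply: homo_ltn => [a c d|m]; first exact: ltn_trans.
  by rewrite sS; have [h _] := Hka (maxn m.+1 (s m).+1); move: h; rewrite geq_max => /andP[].
move=> n e e0; pose K := Num.truncn (e^-1); exists (maxn n.+1 K).+1 => -[//|k].
rewrite ltnS geq_max => /andP[nk Kk].
have [_ h] := Hka (maxn k.+1 (s k).+1); rewrite sS.
apply: ltW (lt_le_trans (h n _) _); first by rewrite leq_max ltnW.
rewrite -[leRHS]invrK lef_pV2 ?posrE ?invr_gt0 ?ltr0n//.
have := truncnS_gt (e^-1); rewrite -/K => h2; apply: ltW (lt_le_trans h2 _).
by rewrite ler_nat ltnS (leq_trans Kk)// (leq_trans (leqnSn k))// leq_maxl.
Qed.

End Preliminaries.

(** * Compactness and the tail condition *)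

Section Star.
Variable R : realType.
Local Notation C := (R[i]).
Implicit Types (f g : C -> C) (a b : nat -> C) (phi : C -> C) (nsq : (C -> C) -> \bar R).
Implicit Types (beta : nat -> R) (e : R) (N d J k n : nat).

(** The last clause, slower than geometric decay, makes point evaluations bounded and makes
    sequences of finite norm converge on the disc. *)
Definition weight (beta : nat -> R) :=
  [/\ forall n, 0 < beta n, forall m n, (m <= n)%N -> beta n <= beta m
    & forall y, 0 < y < 1 -> exists2 c : R, 0 < c & forall n, c * y ^+ n <= beta n].

(** Common interface to the Hardy and Bergman norms: a norm is known through bounds on partial sums
    of coefficients. *)
Definition coef_norm (beta : nat -> R) nsq := forall f a, coefs f a ->
  (0 <= nsq f)%E /\ forall M, (nsq f <= M%:E)%E <-> sq_le beta a M.

Definition star (beta : nat -> R) phi := forall e : R, 0 < e -> exists N, forall a d b,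
  (forall n, (n < N)%N -> a n = 0) -> coefs (fun z => \sum_(n < d) a n * phi z ^+ n) b ->
  forall J, \sum_(k < J) beta k * cabs (b k) ^+ 2 <= e * \sum_(n < d) beta n * cabs (a n) ^+ 2.

Lemma analytic_selfmap_comp phi f : analytic_selfmap phi -> analytic_disc f ->
  analytic_disc (f \o phi).
Proof. by move=> [Hp p1] Hf z z1; apply: cholo_comp; [exact: Hp|apply/Hf/p1]. Qed.

Lemma coefs_trunc a d :
  coefs (fun z => \sum_(n < d) a n * z ^+ n) (fun n => if (n < d)%N then a n else 0).
Proof.
have h := @coefs_poly R d (fun n => if (n < d)%N then a n else 0).
apply: eq_coefs (h _) => [z _|n dn]; last by rewrite ltnNge dn.
by apply: eq_bigr => n _; rewrite ltn_ord.
Qed.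

Lemma sq_le_trunc (beta : nat -> R) a d : (forall n, 0 < beta n) ->
  sq_le beta (fun n => if (n < d)%N then a n else 0) (\sum_(n < d) beta n * cabs (a n) ^+ 2).
Proof.
move=> b0 J.
pose F n := beta n * cabs (if (n < d)%N then a n else 0) ^+ 2.
have F0 n : 0 <= F n by apply: mulr_ge0; [exact: ltW|exact: sqr_ge0].
rewrite -/(F _) (_ : \sum_(n < d) _ = \sum_(n < d) F n); last first.
  by apply: eq_bigr => n _; rewrite /F ltn_ord.
rewrite -(big_mkord xpredT F) -(big_mkord xpredT F).
have [Jd|dJ] := leqP J d.
  by rewrite (big_cat_nat (n := J) (p := d))//= lerDl sumr_ge0.
rewrite (big_cat_nat (n := d) (p := J))//= 1?ltnW// gerDl big_nat big1// => n /andP[dn _].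
by rewrite /F ltnNge dn /= cabs0 expr0n mulr0.
Qed.

Lemma small_tail beta (rho e : R) : weight beta -> 0 <= rho < 1 -> 0 < e ->
  exists N, forall M d x, (N <= M)%N -> 0 <= x <= rho ->
    \sum_(M <= n < d) x ^+ (2 * n) / beta n < e.
Proof.
move=> [b0 _ bl] /andP[r0 r1] e0; pose y := (1 + rho ^+ 2) / 2.
have r2 : rho ^+ 2 < 1 by rewrite exprn_ilt1.
have r20 : 0 <= rho ^+ 2 by exact: sqr_ge0.
have y01 : 0 < y < 1 by rewrite /y; lra.
have /andP[y0 y1] := y01; have [c c0 Hc] := bl y y01.
pose th := rho ^+ 2 / y.
have th01 : 0 <= th < 1.
  rewrite /th divr_ge0 ?(ltW y0)//=; rewrite ltr_pdivrMr// mul1r /y; lra.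
have h0 : 0 < e * c * (1 - th) by rewrite !mulr_gt0//; lra.
have [N HN] := expr_small th01 h0; exists N => M d x NM /andP[x0 xr].
apply: (@le_lt_trans _ _ (\sum_(M <= n < d) c^-1 * th ^+ n)).
  apply: ler_sum => n _; rewrite /th exprMn exprVn mulrCA -invfM.
  rewrite ler_pM ?invr_ge0 ?exprn_ge0//; first by exact: ltW.
    by rewrite exprM lerXn2r ?nnegrE ?exprn_ge0// lerXn2r ?nnegrE.
  by rewrite lef_pV2 ?posrE// mulr_gt0// exprn_gt0.
rewrite -mulr_sumr ltr_pdivrMl//.
apply: le_lt_trans (geo_sum_le M d th01) _.
by rewrite ltr_pdivrMr ?[c * e]mulrC; [exact: HN|lra].
Qed.

(** Smallness on one circle makes every coefficient small; the radius 1/2 is an arbitrary choice. *)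
Lemma half_circle_coef (psi : C -> C) b (K : R) : coefs psi b ->
  (forall t, 0 <= t <= 2 * pi -> cabs (psi (circ 2^-1 t)) <= K) ->
  forall n, cabs (b n) <= K * 2 ^+ n.
Proof.
move=> pb HK n; have h01 : 0 <= (2^-1 : R) < 1 by lra.
by have := coef_le_sup pb h01 HK n; rewrite exprVn ler_pdivrMr ?exprn_gt0.
Qed.

Lemma selfmap_half phi : analytic_selfmap phi ->
  exists rho : R, 0 <= rho < 1 /\ forall t, 0 <= t <= 2 * pi -> cabs (phi (circ 2^-1 t)) <= rho.
Proof. by move=> Hphi; apply: selfmap_circle_sup => //; lra. Qed.

(** Normalises a counterexample. Its norm is nonzero, because the zero polynomial has zero image. *)
Lemma star_failure beta phi e N a d b J : (forall n, 0 < beta n) -> 0 < e ->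
  (forall n, (n < N)%N -> a n = 0) -> coefs (fun z => \sum_(n < d) a n * phi z ^+ n) b ->
  e * \sum_(n < d) beta n * cabs (a n) ^+ 2 < \sum_(k < J) beta k * cabs (b k) ^+ 2 ->
  exists a' b', [/\ forall n, (n < N)%N -> a' n = 0,
    coefs (fun z => \sum_(n < d) a' n * phi z ^+ n) b',
    \sum_(n < d) beta n * cabs (a' n) ^+ 2 = 1 & e < \sum_(k < J) beta k * cabs (b' k) ^+ 2].
Proof.
move=> b0 e0 aN cb; set S := \sum_(n < d) _ => HJ.
have t0 n : 0 <= beta n * cabs (a n) ^+ 2 by apply: mulr_ge0; [exact: ltW|exact: sqr_ge0].
have S0 : 0 < S.
  rewrite lt_def andbC sumr_ge0//=.
  apply/eqP => S0; have a0 n : (n < d)%N -> a n = 0.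
    move=> nd; have := S0; rewrite /S (bigD1 (Ordinal nd))//= => /eqP.
    rewrite paddr_eq0 ?t0 ?sumr_ge0//.
    by rewrite mulf_eq0 (gt_eqF (b0 n)) sqrf_eq0 cabs_eq0 /= => /andP[/eqP -> _].
  have c0 : coefs (fun z : C => \sum_(n < d) a n * phi z ^+ n) (fun=> 0).
    apply: eq_coefs (@coefs_poly R 0 (fun=> 0) (fun _ _ => erefl)) => z _.
    by rewrite big_ord0 big1// => n _; rewrite a0 ?mul0r.
  move: HJ; rewrite S0 mulr0 big1 ?ltxx// => k _.
  by rewrite (coefs_inj cb c0) cabs0 expr0n mulr0.
pose s := (Num.sqrt S)^-1; have s2 : s ^+ 2 = S^-1 by rewrite exprVn sqr_sqrtr// ltW.
have sc x : cabs (s%:C%C * x) ^+ 2 = S^-1 * cabs x ^+ 2.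
  by rewrite cabsM cabs_real exprMn real_normK ?num_real// s2.
exists (fun n => s%:C%C * a n), (fun n => s%:C%C * b n); split.
- by move=> n /aN ->; rewrite mulr0.
- apply: eq_coefs (coefsZ s%:C%C cb) => z _.
  by rewrite mulr_sumr; apply: eq_bigr => n _; rewrite mulrA.
- by under eq_bigr do rewrite sc mulrCA; rewrite -mulr_sumr mulVf// gt_eqF.
- by under eq_bigr do rewrite sc mulrCA; rewrite -mulr_sumr ltr_pdivlMl// mulrC.
Qed.

Lemma cvg_ereal0P (u : nat -> \bar R) : (forall k, (0 <= u k)%E) ->
  (u k @[k --> \oo] --> 0%E) <->
  (forall e : R, 0 < e -> exists K, forall k, (K <= k)%N -> (u k <= e%:E)%E).
Proof.
move=> u0; split=> [cu e e0|H].
  have [Hf /cvgrPdist_le/(_ e e0) [K _ HK]] := (fine_cvgP _ _).1 cu.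
  have [K' _ HK'] := Hf; exists (maxn K K') => k; rewrite geq_max => /andP[h1 h2].
  have /= := HK k h1; rewrite sub0r normrN => h3.
  by rewrite -[u k]fineK ?lee_fin ?(le_trans (ler_norm _) h3)//; exact: HK'.
apply/fine_cvgP; split.
  have [K HK] := H 1 ltr01; exists K => // k /= /HK h.
  by rewrite ge0_fin_numE// (le_lt_trans h) ?ltry.
apply/cvgrPdist_le => e e0; have [K HK] := H e e0; exists K => // k /= /HK h.
rewrite sub0r normrN ger0_norm ?fine_ge0// -lee_fin fineK//.
by rewrite ge0_fin_numE// (le_lt_trans h) ?ltry.
Qed.

Lemma sq_le_term beta a M n : (forall n, 0 < beta n) -> sq_le beta a M ->
  beta n * cabs (a n) ^+ 2 <= M.
Proof.
move=> b0 /(_ n.+1); rewrite big_ord_recr /=; apply: le_trans; rewrite lerDr sumr_ge0// => i _.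
by apply: mulr_ge0; [exact: ltW|exact: sqr_ge0].
Qed.

(** If [star] fails, there are unit polynomials with zeros of order N at 0 whose images stay above
    e. They tend to 0 uniformly on smaller discs, so a norm limit of images can only be 0, a
    contradiction. *)
Lemma compact_star beta nsq phi (X : (C -> C) -> Prop) : weight beta -> coef_norm beta nsq ->
  (forall f, X f <-> analytic_disc f /\ (nsq f < +oo)%E) -> analytic_selfmap phi ->
  comp_compact X nsq phi -> star beta phi.
Proof.
move=> Wb Nb HX Hphi [_ Hc]; have [b0 bd bl] := Wb.
apply: contrapT => /existsNP[e /not_implyP[e0 /forallNP Hn]].
have wit N : exists w : (nat -> C) * nat * (nat -> C), [/\ forall n, (n < N)%N -> w.1.1 n = 0,
    coefs (fun z => \sum_(n < w.1.2) w.1.1 n * phi z ^+ n) w.2,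
    \sum_(n < w.1.2) beta n * cabs (w.1.1 n) ^+ 2 = 1 &
    exists J, e < \sum_(k < J) beta k * cabs (w.2 k) ^+ 2].
  have /existsNP[a /existsNP[d /existsNP[b /not_implyP[aN /not_implyP[cb /existsNP[J /negP]]]]]] := Hn N.
  rewrite -ltNge => HJ; have [a' [b' [h1 h2 h3 h4]]] := star_failure b0 e0 aN cb HJ.
  by exists (a', d, b'); split => //; exists J.
have {wit}[w Hw] := choice wit.
pose u N z : C := \sum_(n < (w N).1.2) (w N).1.1 n * z ^+ n.
have uc N := coefs_trunc (w N).1.1 (w N).1.2.
have un N : (nsq (u N) <= 1%:E)%E.
  apply/(Nb _ _ (uc N)).2; have [_ _ <- _] := Hw N; exact: sq_le_trunc.
have uX N : X (u N).
  by apply/HX; split; [exact: coefs_analytic (uc N)|rewrite (le_lt_trans (un N)) ?ltry].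
have [s [g [smono [Xg cv]]]] := Hc u 1 uX un.
have [q gq] := analytic_coefs ((HX g).1 Xg).1.
have ub k : coefs (fun z => u (s k) (phi z) - g z) (fun n => (w (s k)).2 n - q n).
  by apply: coefsB gq; have [_ h _ _] := Hw (s k).
have Hk eta : 0 < eta -> exists K, forall k, (K <= k)%N ->
    sq_le beta (fun n => (w (s k)).2 n - q n) eta.
  move=> eta0; have u0 k : (0 <= nsq (fun z => u (s k) (phi z) - g z)%R)%E by have [] := Nb _ _ (ub k).
  have [K HK] := (cvg_ereal0P u0).1 cv eta eta0; exists K => k /HK h.
  by have [_ h2] := Nb _ _ (ub k); exact/h2.
have sge k : (k <= s k)%N.
  by elim: k => // k IH; rewrite (leq_ltn_trans IH)// smono.
have [rho [r01 Hrho]] := selfmap_half Hphi.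
(* The image coefficients converge to q n by norm convergence, and to 0 because on the circle of
   radius 1/2 the map [phi] stays in a disc of radius rho < 1, where the polynomials are small. *)
have q0 n : q n = 0.
  apply/eqP; rewrite -cabs_eq0; apply/eqP/le_anti; rewrite cabs_ge0 andbT.
  apply/ler_addgt0Pr => t t0; rewrite add0r.
  pose x := t / 2 / 2 ^+ n; have x0 : 0 < x by rewrite !divr_gt0// exprn_gt0.
  have [N HN] := small_tail Wb r01 (exprn_gt0 2 x0).
  have eta0 : 0 < beta n * (t / 2) ^+ 2 by rewrite mulr_gt0// exprn_gt0// divr_gt0.
  have [K HK] := Hk _ eta0; pose k := maxn K N.
  have h1 : cabs ((w (s k)).2 n - q n) <= t / 2.
    have := sq_le_term n b0 (HK k (leq_maxl _ _)); rewrite ler_pM2l//.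
    by rewrite ler_pXn2r ?nnegrE ?cabs_ge0// ltW// divr_gt0.
  have h2 : cabs ((w (s k)).2 n) <= t / 2.
    have [aN cb S1 _] := Hw (s k).
    have -> : t / 2 = x * 2 ^+ n by rewrite /x divfK// gt_eqF// exprn_gt0.
    apply: (half_circle_coef cb) => th Hth.
    rewrite -(@ler_pXn2r _ 2) ?nnegrE ?cabs_ge0 ?(ltW x0)//.
    apply: le_trans (tail_eval _ _ b0 aN) _; rewrite S1 mul1r.
    apply/ltW/HN; last by rewrite cabs_ge0 Hrho.
    by rewrite (leq_trans _ (sge k))// leq_maxr.
  have := ler_cabs_dist (q n) ((w (s k)).2 n); rewrite [cabs (q n - _)]cabsB; lra.
have [K HK] := Hk (e / 2) ltac:(lra).
have [_ _ _ [J HJ]] := Hw (s K).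
have := HK K (leqnn K) J; under eq_bigr do rewrite q0 subr0.
by move=> h; have := lt_le_trans HJ h; lra.
Qed.

Lemma sup_sq_le beta f a (K : R) : weight beta -> coefs f a ->
  0 <= K -> (forall z, cabs z < 1 -> cabs (f z) <= K) -> sq_le beta a (beta 0%N * K ^+ 2).
Proof.
move=> [b0 bd _] fa K0 HK J.
have h : \sum_(k < J) cabs (a k) ^+ 2 <= K ^+ 2.
  apply: (@poly_le_of_lt1 R (fun n => cabs (a n) ^+ 2)) => [n|r r01]; first exact: sqr_ge0.
  apply: le_trans (coefs_le_M2 fa r01 J) _.
  apply: M2_sup => //; first exact: (analytic_circ_cont (coefs_analytic fa)).
  by move=> t _; apply: HK; have /andP[r0 r1] := r01; rewrite cabs_circ ger0_norm.
apply: (@le_trans _ _ (\sum_(k < J) beta 0%N * cabs (a k) ^+ 2)).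
  by apply: ler_sum => k _; rewrite ler_wpM2r ?sqr_ge0// bd.
by rewrite -mulr_sumr ler_wpM2l// ltW.
Qed.

(* The first [N] coefficients contribute a bounded function, the others are controlled by [star]. *)
Lemma star_comp_sq_le beta phi e : weight beta -> analytic_selfmap phi -> star beta phi -> 0 < e ->
  exists N, forall f a b M, coefs f a -> coefs (f \o phi) b -> sq_le beta a M ->
    sq_le beta b (2 * beta 0%N * (\sum_(n < N) cabs (a n)) ^+ 2 + 2 * e * M).
Proof.
move=> Wb Hphi Hs e0; have [b0 bd bl] := Wb; have [N HN] := Hs e e0; exists N => f a b M fa fb aM J.
have phia : analytic_disc phi by have [] := Hphi.
have an (c : nat -> C) d : analytic_disc (fun z => \sum_(n < d) c n * phi z ^+ n).
  exact: (analytic_selfmap_comp Hphi (@poly_analytic R d c)).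
have [p hp] := analytic_coefs (an a N).
have P1 : sq_le beta p (beta 0%N * (\sum_(n < N) cabs (a n)) ^+ 2).
  apply: (sup_sq_le Wb hp) => [|z z1]; first by apply: sumr_ge0 => i _; exact: cabs_ge0.
  rewrite (le_trans (ler_cabs_sum _ _ _))//; apply: ler_sum => n _.
  rewrite cabsM cabsX ler_piMr ?cabs_ge0// exprn_ile1 ?cabs_ge0// ltW//.
  by have [_] := Hphi; apply.
pose a' n : C := if (n < N)%N then 0 else a n.
have [c hc] := choice (fun d => analytic_coefs (an a' d)).
have [rho [r01 Hrho]] := selfmap_half Hphi.
have [K [y [K0 y01 HK]]] := coefs_tail fa r01.
(* [star] speaks of polynomials only: truncations of the tail converge coefficientwise, and the
   bound passes to the limit. *)
have Pc : \sum_(k < J) beta k * cabs (b k - p k) ^+ 2 <= e * M.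
  apply: (@fatou_finite R beta (fun d k => c d k) (fun k => b k - p k)) => [k t t0|d]; last first.
    have a'0 n : (n < N)%N -> a' n = 0 by rewrite /a' => ->.
    apply: le_trans (HN a' d (c d) a'0 (hc d) J) _; rewrite ler_pM2l//.
    apply: le_trans (aM d); apply: ler_sum => n _; rewrite ler_pM2l//.
    by rewrite /a'; case: ifP => // _; rewrite cabs0 expr0n /= sqr_ge0.
  have t2 : 0 < t / (K + 1) / 2 ^+ k by rewrite !divr_gt0 ?exprn_gt0//; lra.
  have [D HD] := expr_small y01 t2; exists (maxn D N) => d; rewrite geq_max => /andP[Dd Nd].
  have hb := coefsB (coefsB fb hp) (hc d); rewrite cabsB.
  apply: le_trans (half_circle_coef (K := K * y ^+ d) hb _ k) _.
    move=> th Hth; set z := circ _ _ => /=; rewrite -addrA -opprD.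
    have -> : \sum_(n < N) a n * phi z ^+ n + \sum_(n < d) a' n * phi z ^+ n =
        \sum_(n < d) a n * phi z ^+ n.
      rewrite (big_ord_widen d (fun n => a n * phi z ^+ n) Nd) big_mkcond -big_split /=.
      by apply: eq_bigr => n _; rewrite /a'; case: ifP; rewrite ?mul0r ?addr0 ?add0r.
    exact: HK (Hrho _ Hth).
  have yd := HD d Dd; rewrite -ler_pdivlMr ?exprn_gt0//.
  apply: (@le_trans _ _ ((K + 1) * y ^+ d)).
    by rewrite ler_wpM2r ?lerDl// exprn_ge0//; have /andP[] := y01.
  rewrite mulrC -ler_pdivlMr; last lra.
  by rewrite mulrAC (ltW yd).
apply: (@le_trans _ _ (\sum_(k < J) (2 * (beta k * cabs (p k) ^+ 2) +
    2 * (beta k * cabs (b k - p k) ^+ 2)))).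
  apply: ler_sum => k _; rewrite !(mulrCA 2) -mulrDr ler_pM2l//.
  have h1 : cabs (b k) <= cabs (p k) + cabs (b k - p k) by exact: ler_cabs_dist.
  have h2 : cabs (b k) ^+ 2 <= (cabs (p k) + cabs (b k - p k)) ^+ 2.
    by rewrite lerXn2r ?nnegrE ?addr_ge0 ?cabs_ge0.
  apply: le_trans h2 _; have := sqr_ge0 (cabs (p k) - cabs (b k - p k)); nra.
rewrite big_split /= -!mulr_sumr -!(mulrA 2) lerD// ler_pM2l//; exact: P1.
Qed.

(** A bounded sequence has a coefficientwise convergent subsequence, whose limit again has finite
    norm. Applied to the differences, [star_comp_sq_le] leaves finitely many coefficients, which
    tend to 0, and a small multiple of the norm bound. *)
Lemma star_compact beta nsq phi (X : (C -> C) -> Prop) : weight beta -> coef_norm beta nsq ->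
  (forall f, X f <-> analytic_disc f /\ (nsq f < +oo)%E) -> analytic_selfmap phi ->
  star beta phi -> comp_compact X nsq phi.
Proof.
move=> Wb Nb HX Hphi Hs; have [b0 bd bl] := Wb.
have Xsq f a : coefs f a -> X f -> exists M, sq_le beta a M.
  move=> fa /HX[_ fi]; have [f0 fM] := Nb f a fa; exists (fine (nsq f)).
  by apply/fM; rewrite fineK// ge0_fin_numE.
have sqX f a M : coefs f a -> sq_le beta a M -> X f.
  move=> fa aM; apply/HX; split; first exact: coefs_analytic fa.
  by have [_ /(_ M)[_ /(_ aM) h]] := Nb f a fa; rewrite (le_lt_trans h) ?ltry.
have Xcomp f : X f -> X (f \o phi).
  move=> Xf; have [a fa] := analytic_coefs ((HX f).1 Xf).1.
  have [M aM] := Xsq f a fa Xf; have [N HN] := star_comp_sq_le Wb Hphi Hs ltr01.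
  have [b fb] := analytic_coefs (analytic_selfmap_comp Hphi (coefs_analytic fa)).
  exact: sqX fb (HN _ _ _ _ fa fb aM).
split=> // u M Xu uM.
have [A HA] := choice (fun k => analytic_coefs ((HX (u k)).1 (Xu k)).1).
have AM k : sq_le beta (A k) M by have [_ h] := Nb _ _ (HA k); exact/h.
have M0 : 0 <= M by have := AM 0%N 0%N; rewrite big_ord0.
have AB k n : cabs (A k n) <= Num.sqrt (M / beta n).
  rewrite -(@ler_pXn2r _ 2) ?nnegrE ?cabs_ge0 ?sqrtr_ge0//.
  rewrite (@sqr_sqrtr _ (M / beta n)); last by rewrite divr_ge0// ltW.
  rewrite ler_pdivlMr// mulrC; exact: sq_le_term.
have [s [b [smono Hb]]] := diagonal_extraction AB.
have bM : sq_le beta b M.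
  move=> J; apply: (@fatou_finite R beta (fun d k => A (s d) k) b) => [k e e0|d]; last exact: AM.
  exact: Hb.
have b_disc : disc_bounded b.
  move=> r r01; have /andP[r0 r1] := r01.
  pose y := (1 + r ^+ 2) / 2; have r2 : r ^+ 2 < 1 by rewrite exprn_ilt1.
  have r20 : 0 <= r ^+ 2 by exact: sqr_ge0.
  have y01 : 0 < y < 1 by rewrite /y; lra.
  have [c c0 Hc] := bl y y01; exists (Num.sqrt (M / c)) => [|n]; first exact: sqrtr_ge0.
  rewrite -(@ler_pXn2r _ 2) ?nnegrE ?mulr_ge0 ?exprn_ge0 ?cabs_ge0 ?sqrtr_ge0//.
  rewrite (@sqr_sqrtr _ (M / c)); last by rewrite divr_ge0// ltW.
  rewrite ler_pdivlMr// exprMn.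
  apply: le_trans (sq_le_term n b0 bM); rewrite -mulrA mulrC ler_wpM2r ?sqr_ge0//.
  apply: le_trans (Hc n); rewrite mulrC ler_pM2l// -exprM mulnC exprM.
  by rewrite lerXn2r ?nnegrE//; rewrite /y; lra.
have [g0 Hg] := disc_bounded_coefs b_disc.
have Xg := sqX _ _ _ Hg bM.
exists s, (g0 \o phi); split=> //; split; first exact: Xcomp.
have hd k := coefsB (HA (s k)) Hg.
have hA k := analytic_coefs (analytic_selfmap_comp Hphi (coefs_analytic (hd k))).
have [c hc] := choice hA.
have dM k : sq_le beta (fun n => A (s k) n - b n) (4 * M).
  move=> J; apply: (@le_trans _ _ (\sum_(i < J) (2 * (beta i * cabs (A (s k) i) ^+ 2) +
      2 * (beta i * cabs (b i) ^+ 2)))).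
    apply: ler_sum => i _; rewrite !(mulrCA 2) -mulrDr ler_pM2l//.
    have h1 : cabs (A (s k) i - b i) <= cabs (A (s k) i) + cabs (b i) by exact: ler_cabsB.
    have h2 : cabs (A (s k) i - b i) ^+ 2 <= (cabs (A (s k) i) + cabs (b i)) ^+ 2.
      by rewrite lerXn2r ?nnegrE ?addr_ge0 ?cabs_ge0.
    apply: le_trans h2 _; have := sqr_ge0 (cabs (A (s k) i) - cabs (b i)); nra.
  rewrite big_split /= -!mulr_sumr; have := AM (s k) J; have := bM J; lra.
have Hn k := Nb _ _ (hc k).
apply: (cvg_ereal0P (u := fun k => nsq (fun z => u (s k) (phi z) - (g0 \o phi) z)) _).2 => [k|e e0].
  by have [] := Hn k.
(* The differences have squared norm at most 4 M, so their tails contribute 2 e1 (4 M) <= e / 2. *)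
pose e1 := e / (16 * (M + 1)); have e10 : 0 < e1 by rewrite divr_gt0//; lra.
have [N HN] := star_comp_sq_le Wb Hphi Hs e10.
(* If N coefficients are at most [x], their sum S is at most 1 and at most e / (4 beta 0), whence 2
   beta 0 S^2 <= e / 2. *)
pose x := Num.min 1 (e / (4 * beta 0%N)) / N.+1%:R.
have x0 : 0 < x by rewrite divr_gt0// lt_min ltr01 divr_gt0// mulr_gt0.
have : exists K, forall k, (K <= k)%N -> \sum_(n < N) cabs (A (s k) n - b n) <= N%:R * x.
  move: (x) x0 => t; elim: N {HN x} t => [|N IH] t t0; first by exists 0%N => k _; rewrite big_ord0 mul0r.
  have [K1 h1] := IH t t0; have [K2 h2] := Hb N t t0.
  exists (maxn K1 K2) => k; rewrite geq_max => /andP[/h1 h3 /h2 h4].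
  by rewrite big_ord_recr /= -natr1 mulrDl mul1r lerD.
move=> [K HK]; exists K => k /HK h; have [_ /(_ e)[_]] := Hn k; apply=> J.
apply: le_trans (HN _ _ _ _ (hd k) (hc k) (dM k) J) _.
set S := \sum_(n < N) _ in h *; have S0 : 0 <= S by apply: sumr_ge0 => i _; exact: cabs_ge0.
have Sm : S <= Num.min 1 (e / (4 * beta 0%N)).
  apply: le_trans h _; rewrite /x mulrCA ler_piMr//; first by rewrite le_min ler01 divr_ge0 ?mulr_ge0 ?ltW.
  by rewrite ler_pdivrMr ?ltr0n// mul1r ler_nat.
have S1 : S <= 1 by apply: le_trans Sm _; rewrite ge_min lexx.
have S2 : S <= e / (4 * beta 0%N) by apply: le_trans Sm _; rewrite ge_min lexx orbT.
have h1 : 2 * beta 0%N * S ^+ 2 <= e / 2.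
  move: S2; rewrite ler_pdivlMr ?mulr_gt0// => S2.
  have : beta 0%N * S ^+ 2 <= beta 0%N * S by rewrite ler_pM2l// expr2 ler_piMl.
  lra.
have h2 : 2 * e1 * (4 * M) <= e / 2.
  rewrite /e1 (_ : _ * _ = e / 2 * (M / (M + 1))); last by field; lra.
  rewrite ler_piMr//; first lra.
  by rewrite ler_pdivrMr; lra.
lra.
Qed.

End Star.

(** * Boundary behaviour from reproducing kernels *)

Section Angular.
Variable R : realType.
Local Notation C := (R[i]).
Implicit Types (f g : C -> C) (a b : nat -> C) (phi : C -> C).
Implicit Types (beta : nat -> R) (e x y : R) (N d J k n : nat).

Definition angular phi := forall j, (0 < j)%N -> exists2 dl : R, 0 < dl < 1 &
  forall z, 1 - dl < cabs z < 1 -> cabs (phi z) <= cabs z ^+ j.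

(** Partial sum of the reproducing kernel on the diagonal, at points with |z|^2 = y. *)
Definition ker beta J y := \sum_(n < J) y ^+ n / beta n.

Definition ker_tail beta N J y := \sum_(n < J) (if (n < N)%N then 0 else y ^+ n / beta n).

Lemma ker_ge0 beta J y : (forall n, 0 < beta n) -> 0 <= y -> 0 <= ker beta J y.
Proof.
by move=> b0 y0; apply: sumr_ge0 => n _; apply: divr_ge0; [exact: exprn_ge0|exact: ltW].
Qed.

Lemma ker_mono beta J J' y : (forall n, 0 < beta n) -> 0 <= y -> (J <= J')%N ->
  ker beta J y <= ker beta J' y.
Proof.
move=> b0 y0 JJ; rewrite /ker -!(big_mkord xpredT (fun n => y ^+ n / beta n)).
rewrite (big_cat_nat (n := J) (p := J'))//= lerDl sumr_ge0// => n _.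
by apply: divr_ge0; [exact: exprn_ge0|exact: ltW].
Qed.

Lemma ker_bounded beta y : weight beta -> 0 <= y < 1 -> exists t, forall J, ker beta J y <= t.
Proof.
move=> [b0 _ bl] /andP[y0 y1]; pose q := (1 + y) / 2.
have q01 : 0 < q < 1 by rewrite /q; lra.
have /andP[q0 q1] := q01; have [c c0 Hc] := bl q q01.
have th01 : 0 <= y / q < 1.
  by rewrite divr_ge0 ?(ltW q0)//= ltr_pdivrMr// mul1r /q; lra.
exists (c^-1 * ((y / q) ^+ 0 / (1 - y / q))) => J.
apply: le_trans (_ : c^-1 * \sum_(0 <= n < J) (y / q) ^+ n <= _); last first.
  by rewrite ler_wpM2l ?invr_ge0 ?(ltW c0)//; exact: geo_sum_le.
rewrite mulr_sumr big_mkord; apply: ler_sum => n _.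
rewrite exprMn exprVn mulrCA -invfM ler_wpM2l ?exprn_ge0//.
by rewrite lef_pV2 ?posrE// mulr_gt0// exprn_gt0.
Qed.

(** The test polynomial is the kernel tail at phi z: its squared norm and the value of its image at
    z are both S. Evaluation at z costs the full kernel t, so S^2 <= e S t. In effect the adjoint of
    C_phi maps the kernel at z to the one at phi z. *)
Lemma kernel_star beta phi e N z t : weight beta -> analytic_selfmap phi -> 0 < e ->
  (forall a d b, (forall n, (n < N)%N -> a n = 0) ->
    coefs (fun z => \sum_(n < d) a n * phi z ^+ n) b ->
    forall J, \sum_(k < J) beta k * cabs (b k) ^+ 2 <= e * \sum_(n < d) beta n * cabs (a n) ^+ 2) ->
  cabs z < 1 -> (forall J, ker beta J (cabs z ^+ 2) <= t) ->
  forall d, ker_tail beta N d (cabs (phi z) ^+ 2) <= e * t.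
Proof.
move=> [b0 bd bl] Hphi e0 HN z1 Ht d; set S := ker_tail _ _ _ _.
pose w := phi z; pose a n : C := if (n < N)%N then 0 else (w^*)%C ^+ n * ((beta n)^-1)%:C%C.
have t0 : 0 <= t by have := Ht 0%N; rewrite /ker big_ord0.
have S0 : 0 <= S.
  apply: sumr_ge0 => n _; case: ifP => // _.
  by apply: divr_ge0; [rewrite exprn_ge0// sqr_ge0|exact: ltW].
have aN n : (n < N)%N -> a n = 0 by rewrite /a => ->.
have an : analytic_disc (fun z => \sum_(n < d) a n * phi z ^+ n).
  exact: (analytic_selfmap_comp Hphi (@poly_analytic R d a)).
have [b hb] := analytic_coefs an.
have Fw : \sum_(n < d) a n * phi z ^+ n = S%:C%C.
  rewrite /S /ker_tail rmorph_sum; apply: eq_bigr => n _.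
  rewrite /a; case: ifP => _; first by rewrite mul0r.
  by rewrite mulrAC -exprMn mulrC [_ * w]mulrC mul_conj_cabs -rmorphXn -rmorphM mulrC.
have Fn : \sum_(n < d) beta n * cabs (a n) ^+ 2 = S.
  apply: eq_bigr => n _; rewrite /a; case: ifP => _; first by rewrite cabs0 expr0n mulr0.
  rewrite cabsM cabsX cabsJ cabs_real ger0_norm ?invr_ge0 ?(ltW (b0 n))//.
  by rewrite exprMn -!exprM mulnC; field; rewrite gt_eqF.
have h1 : S <= Num.sqrt (e * S * t).
  apply/ler_addgt0Pr => eta eta0; have [J0 HJ] := hb z z1 eta eta0.
  have := HJ J0 (leqnn _); rewrite Fw => h.
  have -> : S = cabs S%:C%C by rewrite cabs_real ger0_norm.
  apply: le_trans (ler_cabs_dist _ (\sum_(n < J0) b n * z ^+ n)) _; apply: lerD h.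
  rewrite -(@ler_pXn2r _ 2) ?nnegrE ?cabs_ge0 ?sqrtr_ge0//.
  rewrite (@sqr_sqrtr _ (e * _ * t)) ?mulr_ge0 ?cabs_ge0 ?(ltW e0)//.
  apply: le_trans (tail_eval J0 z b0 (N := 0) (fun n h => ltac:(by []))) _.
  rewrite cabs_real ger0_norm// -Fn; apply: ler_pM.
  - by apply: sumr_ge0 => n _; rewrite mulr_ge0 ?sqr_ge0 ?(ltW (b0 n)).
  - by apply: sumr_ge0 => n _; rewrite divr_ge0 ?exprn_ge0 ?cabs_ge0 ?(ltW (b0 n)).
  - exact: HN.
  - rewrite big_mkord; under eq_bigr do rewrite exprM; exact: Ht.
have h2 : S ^+ 2 <= e * S * t.
  rewrite -(@sqr_sqrtr _ (e * S * t)) ?mulr_ge0 ?(ltW e0)//.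
  by rewrite ler_pXn2r ?nnegrE ?sqrtr_ge0.
have [->|Sn] := eqVneq S 0; first by rewrite mulr_ge0// ltW.
have Sp : 0 < S by rewrite lt_def Sn.
by move: h2; rewrite expr2 mulrAC ler_pM2r.
Qed.

(** The indices are grouped in blocks of length j: on the block of d the powers are at most y^(j d),
    and doubling compares the weights with beta d. *)
Lemma ker_dilate beta j K d y : (forall n, 0 < beta n) -> (0 < j)%N -> 0 < K ->
  (forall n, beta (n %/ j)%N <= K * beta n) -> 0 <= y <= 1 ->
  ker beta (d * j) y <= j%:R * K * ker beta d (y ^+ j).
Proof.
move=> b0 j0 K0 HK /andP[y0 y1]; elim: d => [|d IH].
  by rewrite mul0n /ker !big_ord0 mulr0.
rewrite /ker big_ord_recr /= mulrDr -(big_mkord xpredT (fun n => y ^+ n / beta n)).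
rewrite (big_cat_nat (n := (d * j)%N))//=; last by rewrite leq_mul2r leqnSn orbT.
apply: lerD; first by rewrite big_mkord.
apply: (@le_trans _ _ (\sum_(d * j <= n < d.+1 * j) K * ((y ^+ j) ^+ d / beta d))).
  rewrite big_nat [leRHS]big_nat; apply: ler_sum => n /andP[n1 n2].
  have nd : (n %/ j = d)%N.
    by apply/eqP; rewrite eqn_leq leq_divRL// n1 andbT -ltnS ltn_divLR.
  have h1 : y ^+ n <= (y ^+ j) ^+ d by rewrite -exprM mulnC ler_wiXn2l.
  have h2 : (beta n)^-1 <= K / beta d.
    by rewrite ler_pdivlMr// mulrC ler_pdivrMr// -nd.
  rewrite mulrCA; apply: ler_pM => //; first exact: exprn_ge0.
  by rewrite invr_ge0 ltW.
by rewrite sumr_const_nat mulSn addnK -mulrA -[leLHS]mulr_natl.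
Qed.

Lemma bernoulli y J : 0 <= y <= 1 -> 1 - J%:R * (1 - y) <= y ^+ J.
Proof.
move=> /andP[y0 y1]; elim: J => [|J IH]; first by rewrite mul0r subr0 expr0.
have p1 : y ^+ J <= 1 by rewrite exprn_ile1.
rewrite (exprS y) -natr1; nra.
Qed.

Lemma ker_split beta N d y : (forall n, 0 < beta n) -> 0 <= y <= 1 ->
  ker beta d y <= ker_tail beta N d y + ker beta N 1.
Proof.
move=> b0 /andP[y0 y1].
apply: (@le_trans _ _ (ker_tail beta N d y + ker beta (minn N d) 1)); last first.
  by rewrite lerD2l ker_mono// geq_minl.
elim: d => [|d IH]; first by rewrite /ker_tail minn0 /ker !big_ord0 addr0.
have kerS J x : ker beta J.+1 x = ker beta J x + x ^+ J / beta J by rewrite /ker big_ord_recr.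
rewrite kerS /ker_tail big_ord_recr /= -/(ker_tail beta N d y).
have [dN|Nd] := ltnP d N.
  rewrite (minn_idPr dN) kerS addr0 addrA.
  apply: lerD; first by rewrite (minn_idPr (ltnW dN)) in IH.
  by rewrite ler_wpM2r ?invr_ge0 ?(ltW (b0 d))// expr1n exprn_ile1.
rewrite (minn_idPl (leqW Nd)) addrAC lerD2r.
by rewrite (minn_idPl Nd) in IH.
Qed.

(* Testing [star] on the tails of reproducing kernels: if [|phi z| > |z|^j] then, by doubling, the
   kernel at [z] would be bounded by the few terms left out of the tail. *)
Lemma star_angular beta phi : weight beta -> doubling beta -> analytic_selfmap phi ->
  star beta phi -> angular phi.
Proof.
move=> Wb Db Hphi Hs j j0; have [b0 bd bl] := Wb; have [K K0 HK] := Db j j0.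
have jK : 0 < j%:R * K by rewrite mulr_gt0// ltr0n.
(* Chosen so that the dilation constant j K times e t is t / 2, which the left side absorbs. *)
pose e := (2 * (j%:R * K))^-1; have e0 : 0 < e by rewrite invr_gt0 mulr_gt0.
have [N HN] := Hs e e0.
pose B := j%:R * K * ker beta N 1.
have B0 : 0 <= B by rewrite mulr_ge0 ?(ltW jK)// ker_ge0.
(* If (r^2)^J >= 1/2, the first J terms of the kernel already give J / (2 beta 0), which exceeds 2
   B. Bernoulli's inequality ensures this once 1 - r < 1 / (4 (J + 1)). *)
pose J := (Num.truncn (4 * B * beta 0%N)).+1.
have J0 : 4 * B * beta 0%N < J%:R by exact: truncnS_gt.
have Jp : 0 < J%:R :> R by rewrite ltr0n.
exists ((4 * (J%:R + 1))^-1).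
  by rewrite invr_gt0 mulr_gt0//= ?addr_gt0// invf_lt1 ?mulr_gt0 ?addr_gt0//; lra.
move=> z /andP[z0 z1]; rewrite leNgt; apply/negP => Hz.
set r := cabs z in z0 z1 Hz; have r0 : 0 <= r by exact: cabs_ge0.
have y0 : 0 <= r ^+ 2 by exact: sqr_ge0.
have y1 : r ^+ 2 < 1 by rewrite exprn_ilt1.
have yj0 : 0 <= (r ^+ 2) ^+ j by exact: exprn_ge0.
have y01 : 0 <= r ^+ 2 < 1 by rewrite y0.
have y01' : 0 <= r ^+ 2 <= 1 by rewrite y0 ltW.
have [t' Ht'] := ker_bounded Wb y01.
pose T := [set ker beta J (r ^+ 2) | J in setT].
have T0 : T !=set0 by exists (ker beta 0 (r ^+ 2)), 0%N.
have Tub : has_ubound T by exists t' => _ [J1 _ <-].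
(* The least upper bound is essential: applied to it, the estimate [k2] becomes t <= t / 2 + B. *)
pose t := sup T; have Ht J1 : ker beta J1 (r ^+ 2) <= t by apply: ub_le_sup => //; exists J1.
have k1 d : ker_tail beta N d ((r ^+ 2) ^+ j) <= e * t.
  apply: le_trans (kernel_star Wb Hphi e0 HN z1 Ht d); apply: ler_sum => n _.
  case: ifP => // _; rewrite ler_wpM2r ?invr_ge0 ?(ltW (b0 n))//.
  rewrite lerXn2r ?nnegrE ?sqr_ge0// -exprM mulnC exprM.
  by rewrite lerXn2r ?nnegrE ?exprn_ge0 ?cabs_ge0// ltW.
have yj1 : 0 <= (r ^+ 2) ^+ j <= 1 by rewrite yj0 exprn_ile1// ltW.
have k2 d : ker beta d (r ^+ 2) <= t / 2 + B.
  apply: (@le_trans _ _ (ker beta (d * j) (r ^+ 2))).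
    by apply: ker_mono => //; rewrite leq_pmulr.
  apply: le_trans (ker_dilate d b0 j0 K0 HK y01') _.
  rewrite (_ : t / 2 + B = j%:R * K * (e * t + ker beta N 1)); last first.
    rewrite mulrDr -/B; congr (_ + _); rewrite /e; field.
    by rewrite (gt_eqF K0) pnatr_eq0 -lt0n j0.
  rewrite ler_wpM2l ?(ltW jK)//; apply: le_trans (ker_split N d b0 yj1) _.
  by rewrite lerD2r.
have tB : t <= 2 * B.
  have : t <= t / 2 + B by apply: ge_sup => // _ [d _ <-].
  lra.
have yJ : 2^-1 <= (r ^+ 2) ^+ J.
  apply: le_trans (bernoulli J y01').
  have h4 : (4 * (J%:R + 1))^-1 * (4 * (J%:R + 1)) = 1 :> R by rewrite mulVf// gt_eqF//; lra.
  have h5 : 0 < (4 * (J%:R + 1))^-1 :> R by rewrite invr_gt0; lra.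
  move: h4 h5 z0; set dl := (_)^-1 => h4 h5 z0.
  have : 1 - r ^+ 2 <= 2 * dl by rewrite expr2; nra.
  nra.
have h : J%:R / (2 * beta 0%N) <= ker beta J (r ^+ 2).
  rewrite -[X in X%:R](card_ord J) -sumr_const mulr_suml; apply: ler_sum => n _.
  rewrite mul1r invfM; apply: ler_pM; rewrite ?invr_ge0//.
    exact: ltW.
    apply: le_trans yJ _; apply: ler_wiXn2l; rewrite ?(ltW y1)//.
    exact: ltnW (ltn_ord n).
  by rewrite lef_pV2 ?posrE// bd.
have := le_trans (le_trans h (Ht J)) tB; rewrite ler_pdivrMr ?mulr_gt0//; lra.
Qed.

(** With r = |z|, 1 - |phi z| >= 1 - r^j >= j r^j (1 - r), and r^j >= 1/2 near the circle, so the
    quotient is at least j / 2 > |M|. *)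
Lemma angular_limit phi : angular phi -> forall M : R, exists2 delta : R, 0 < delta < 1 &
  forall z, 1 - delta < cabs z < 1 -> M < (1 - cabs (phi z)) / (1 - cabs z).
Proof.
move=> Ha M; pose j := (Num.truncn (2 * `|M|)).+1.
have j0 : 2 * `|M| < j%:R by exact: truncnS_gt.
have jp : 0 < j%:R :> R by rewrite ltr0n.
have [dl /andP[dl0 dl1] Hdl] := Ha j isT.
exists (Num.min dl (2 * j%:R)^-1).
  by rewrite lt_min dl0 invr_gt0 mulr_gt0//= gt_min dl1.
move=> z /andP[z0 z1]; move: z0; rewrite ltrBlDr -ltrBlDl lt_min => /andP[z2 z3].
have r0 := cabs_ge0 z; have Hz : cabs (phi z) <= cabs z ^+ j.
  by apply: Hdl; rewrite z1 andbT; lra.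
have y01 : 0 <= cabs z <= 1 by rewrite r0 ltW.
have rj : 2^-1 <= cabs z ^+ j.
  apply: le_trans (bernoulli j y01).
  have h4 : (2 * j%:R)^-1 * (2 * j%:R) = 1 :> R by rewrite mulVf// gt_eqF//; lra.
  have h5 : 0 < (2 * j%:R)^-1 :> R by rewrite invr_gt0; lra.
  move: h4 h5 z3; set d := (_)^-1 => h4 h5 z3; nra.
have geo n : n%:R * cabs z ^+ n * (1 - cabs z) <= 1 - cabs z ^+ n.
  elim: n => [|n IH]; first by rewrite !mul0r subrr.
  have p0 : 0 <= cabs z ^+ n by exact: exprn_ge0.
  rewrite (exprS (cabs z)) -natr1.
  have n0 : 0 <= n%:R :> R by [].
  have h : (n%:R + 1) * (cabs z * cabs z ^+ n) <= (n%:R + 1) * cabs z ^+ n.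
    by rewrite ler_wpM2l ?addr_ge0// ler_piMl// ltW.
  nra.
rewrite ltr_pdivlMr; last lra.
have := geo j; have := ler_norm M; move: j0 jp rj Hz => h1 h2 h3 h4 h5 h6.
have h7 : M < j%:R * cabs z ^+ j by nra.
have : M * (1 - cabs z) < j%:R * cabs z ^+ j * (1 - cabs z) by rewrite ltr_pM2r//; lra.
lra.
Qed.

End Angular.

(** * Subordination without a fixed point at 0 *)

Section Littlewood.
Variable R : realType.
Local Notation C := (R[i]).
Implicit Types (f g h : C -> C) (a b p : nat -> C) (phi psi : C -> C).
Implicit Types (beta : nat -> R) (e x y : R) (N d J k n m : nat).

Lemma coefs_at0 f a : coefs f a -> f 0 = a 0%N.
Proof.
move=> fa; apply/eqP; rewrite -subr_eq0 -cabs_eq0; apply/eqP/le_anti; rewrite cabs_ge0 andbT.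
apply/ler_addgt0Pr => e e0; rewrite add0r.
have [J0 /(_ J0.+1 (leqnSn _))] := fa 0 ltac:(by rewrite cabs0) e e0.
rewrite big_ord_recl expr0 mulr1 big1 ?addr0// => n _.
by rewrite expr0n mulr0.
Qed.

(** By Parseval, adding a constant changes the mean only through the coefficient of index 0. *)
Lemma M2_shift (c : C) h r : analytic_disc h -> 0 <= r < 1 ->
  M2 r (fun z => c + h z) <= M2 r h + cabs (c + h 0) ^+ 2 - cabs (h 0) ^+ 2.
Proof.
move=> ah r01; have [p hp] := analytic_coefs ah.
have c0 : coefs (fun=> c) (fun n => if n == 0%N then c else 0).
  have h1 n : (1 <= n)%N -> (if n == 0%N then c else 0) = 0 by case: n.
  apply: eq_coefs (coefs_poly h1) => z _; by rewrite big_ord1 expr0 mulr1.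
apply: (M2_le_coefs (coefsD c0 hp) r01) => -[|J].
  rewrite big_ord0 (coefs_at0 hp) -addrA.
  have := coefs_le_M2 hp r01 1; rewrite big_ord1 muln0 expr0 mulr1 => h1.
  by have := sqr_ge0 (cabs (c + p 0%N)); lra.
have := coefs_le_M2 hp r01 J.+1; rewrite !big_ord_recl /= !muln0 !expr0 !mulr1 (coefs_at0 hp).
under [X in _ -> _ + X <= _]eq_bigr do rewrite add0r.
lra.
Qed.

(* Littlewood's subordination principle with a weight on the value at [0], which makes the
   induction on the degree close although [psi 0] need not vanish. *)
Lemma littlewood psi (r b : R) a d : analytic_disc psi -> 0 <= r < 1 -> 0 <= b < 1 ->
  (forall t, 0 <= t <= 2 * pi -> cabs (psi (circ r t)) <= 1) -> cabs (psi 0) <= b ->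
  M2 r (fun z => \sum_(n < d) a n * psi z ^+ n) <=
  ((1 - b ^+ 2)^-1 + (1 - b ^+ 2)^-1 ^+ 2) * \sum_(n < d) cabs (a n) ^+ 2.
Proof.
move=> apsi r01 /andP[b0 b1] psi1 psib; set ka := (1 - b ^+ 2)^-1.
have b2 : b ^+ 2 < 1 by rewrite exprn_ilt1.
have ka0 : 0 < ka by rewrite invr_gt0; lra.
have kab : ka * (1 - b ^+ 2) = 1 by rewrite mulVf// gt_eqF//; lra.
pose F a' d' z : C := \sum_(n < d') a' n * psi z ^+ n.
have aF a' d' : analytic_disc (F a' d').
  apply: (@analytic_sum R d' (fun n z => a' n * psi z ^+ n)) => n z z1.
  have h1 := @cholo_cst R (a' n) z; have h2 := @choloX R psi n z (apsi z z1); exact: (choloM h1 h2).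
suff : M2 r (F a d) + ka * cabs (psi 0 * F a d 0) ^+ 2 <=
    (ka + ka ^+ 2) * \sum_(n < d) cabs (a n) ^+ 2.
  by apply: le_trans; rewrite lerDl mulr_ge0 ?sqr_ge0// ltW.
elim: d a => [|d IH] a.
  rewrite !big_ord0 /F big_ord0 mulr0 cabs0 expr0n !mulr0 addr0.
  rewrite (_ : (fun z => _) = (fun=> 0)); first by rewrite M2_cst cabs0 expr0n.
  by apply/funext => z; rewrite big_ord0.
pose G := F (fun n => a n.+1) d; have {}IH := IH (fun n => a n.+1).
have FG z : F a d.+1 z = a 0%N + psi z * G z.
  rewrite /F big_ord_recl expr0 mulr1 mulr_sumr; congr (_ + _); apply: eq_bigr => n _.
  by rewrite /= (exprS (psi z)) mulrCA.
rewrite (_ : F a d.+1 = fun z => a 0%N + psi z * G z); last exact/funext.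
have aG : analytic_disc G by exact: aF.
have apG : analytic_disc (fun z => psi z * G z) by exact: (analyticM apsi aG).
have h1 := M2_shift (a 0%N) apG r01; rewrite -/G in IH.
have h2 : M2 r (fun z => psi z * G z) <= M2 r G.
  rewrite -[leRHS]mul1r -(expr1n _ 2); apply: M2_le; [exact: analytic_circ_cont| |].
    exact: analytic_circ_cont.
  by move=> t Ht; rewrite cabsM ler_wpM2r ?cabs_ge0// psi1.
rewrite big_ord_recl; set S := \sum_(i < d) _ in IH *.
set q := psi 0 * G 0 in h1 IH *; set s := cabs (a 0%N).
have h3 : cabs (a 0%N + q) <= s + cabs q by exact: ler_cabsD.
have q0 := cabs_ge0 q; have s0 : 0 <= s by exact: cabs_ge0.
have u0 := cabs_ge0 (a 0%N + q); set u := cabs (a 0%N + q) in h1 h3 u0 *.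
rewrite cabsM -/u; set v := cabs q in h1 h3 q0 IH.
have h4 : (cabs (psi 0) * u) ^+ 2 <= b ^+ 2 * u ^+ 2.
  by rewrite exprMn ler_wpM2r ?sqr_ge0// lerXn2r ?nnegrE ?cabs_ge0.
have h5 : u ^+ 2 <= (s + v) ^+ 2 by rewrite lerXn2r ?nnegrE ?addr_ge0.
have h6 : ka * (cabs (psi 0) * u) ^+ 2 <= ka * (b ^+ 2 * u ^+ 2) by rewrite ler_pM2l.
have h7 : ka * (b ^+ 2 * u ^+ 2) = ka * u ^+ 2 - u ^+ 2.
  by rewrite -[X in _ = _ - X]mul1r -kab; ring.
have h8 : ka * u ^+ 2 <= ka * (s + v) ^+ 2 by rewrite ler_pM2l.
(* This bounds the cross term 2 ka s v by ka^2 s^2 + v^2, and -v^2 is available from [M2_shift];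
   hence the constant ka + ka^2. The value of [ka] was fixed by ka b^2 = ka - 1, used in [h7]. *)
have h9 := sqr_ge0 (ka * s - v).
have h10 : ka * (s + v) ^+ 2 = ka * s ^+ 2 + 2 * (ka * s * v) + ka * v ^+ 2 by ring.
have h11 : (ka * s - v) ^+ 2 = ka ^+ 2 * s ^+ 2 - 2 * (ka * s * v) + v ^+ 2 by ring.
rewrite [leRHS]mulrDr (mulrDl ka _ (s ^+ 2)).
have := le_trans h1 (lerB (lerD h2 (lexx _)) (lexx _)).
move: IH h6 h7 h8 h9 h10 h11; clear; lra.
Qed.

(** Littlewood's inequality is applied to phi / r^j, bounded by 1 on the circle of radius r by
    [angular]. The constant depends on phi 0 only; it is the same for all j, and only r0 varies. *)
Lemma angular_M2 phi : analytic_selfmap phi -> angular phi ->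
  exists2 La : R, 0 < La & forall j, (0 < j)%N -> exists2 r0 : R, 0 < r0 < 1 &
  forall r a d, r0 <= r < 1 -> M2 r (fun z => \sum_(n < d) a n * phi z ^+ n) <=
    La * \sum_(n < d) cabs (a n) ^+ 2 * r ^+ (2 * (j * n)).
Proof.
move=> Hphi Ha; have [aphi phi1] := Hphi.
have c1 : cabs (phi 0) < 1 by apply: phi1; rewrite cabs0.
have c0 := cabs_ge0 (phi 0); set c := cabs (phi 0) in c0 c1.
pose b := (1 + c) / 2; have b01 : 0 <= b < 1 by rewrite /b; lra.
have bp : 0 < b by rewrite /b; lra.
have b2 : b ^+ 2 < 1 by have /andP[h1 h2] := b01; rewrite exprn_ilt1.
have ka0 : 0 < (1 - b ^+ 2)^-1 by rewrite invr_gt0; lra.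
exists ((1 - b ^+ 2)^-1 + (1 - b ^+ 2)^-1 ^+ 2); first by rewrite addr_gt0// exprn_gt0.
move=> j j0; have [dl /andP[dl0 dl1] Hdl] := Ha j j0.
have jp : 0 < j%:R :> R by rewrite ltr0n.
(* The rescaled value at 0 is c / r^j, which is at most b exactly when r^j >= q; Bernoulli's
   inequality gives this for r close to 1. *)
pose q := c / b; have q1 : q < 1 by rewrite ltr_pdivrMr// mul1r /b; lra.
have q0 : 0 <= q by rewrite divr_ge0// ltW.
have m0 : 0 < (1 - q) / (2 * j%:R) by rewrite divr_gt0 ?mulr_gt0//; lra.
have m1 : (1 - q) / (2 * j%:R) < 1.
  rewrite ltr_pdivrMr ?mulr_gt0// mul1r.
  have : 1 <= j%:R :> R by rewrite ler1n.
  lra.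
exists (1 - Num.min (dl / 2) ((1 - q) / (2 * j%:R))).
  rewrite subr_gt0 gt_min m1 orbT /= ltrBlDr ltrDl lt_min m0 andbT; lra.
move=> r a d /andP[r0 r1].
have rm : 1 - r <= Num.min (dl / 2) ((1 - q) / (2 * j%:R)) by lra.
move: rm; rewrite le_min => /andP[rm1 rm2].
have rp : 0 < r by lra.
have rj : q <= r ^+ j.
  apply: le_trans (bernoulli j _); last by rewrite !ltW.
  move: rm2; rewrite ler_pdivlMr ?mulr_gt0//; lra.
have rjp : 0 < r ^+ j by rewrite exprn_gt0.
pose psi z := (r ^+ j)^-1%:C%C * phi z.
have apsi : analytic_disc psi.
  exact: (analyticM (@analytic_cst R _) aphi).
have r01 : 0 <= r < 1 by rewrite r1 ltW.
have cpsi z : cabs (psi z) = cabs (phi z) / r ^+ j.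
  by rewrite cabsM cabs_real ger0_norm ?invr_ge0 ?(ltW rjp)// mulrC.
have psi1 t : 0 <= t <= 2 * pi -> cabs (psi (circ r t)) <= 1.
  move=> _; rewrite cpsi ler_pdivrMr// mul1r.
  have cr : cabs (circ r t) = r by rewrite cabs_circ gtr0_norm.
  by rewrite -[X in _ <= X ^+ j]cr Hdl// cr r1 andbT; lra.
have psi0 : cabs (psi 0) <= b.
  rewrite cpsi -/c ler_pdivrMr// mulrC -ler_pdivrMr//.
have := littlewood (fun n => a n * ((r ^+ j) ^+ n)%:C%C) d apsi r01 b01 psi1 psi0.
rewrite (eq_M2 (g := fun z => \sum_(n < d) a n * phi z ^+ n)) => [|z _].
  congr (_ <= _); congr (_ * _); apply: eq_bigr => n _.
  rewrite cabsM cabs_real ger0_norm ?exprn_ge0 ?(ltW rp)//.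
  by rewrite exprMn -(exprM r) -(exprM r) [(2 * _)%N]mulnC.
apply: eq_bigr => n _; rewrite /psi exprMn -rmorphXn -mulrA; congr (_ * _).
by rewrite mulrA -rmorphM exprVn mulfV ?rmorph1 ?mul1r// gt_eqF// exprn_gt0.
Qed.

End Littlewood.

(** * Interpolation between weights *)

Section Transfer.
Variable R : realType.
Local Notation C := (R[i]).
Local Notation mu := (@lebesgue_measure R).
Implicit Types (a b : nat -> C) (phi : C -> C).
Implicit Types (beta : nat -> R) (e x y th : R) (N d J k n m M : nat).

(** Minimum of |x|^2 + th^(n-m) |y|^2 over x + y = 1. As a function of n it is a smoothed indicator
    of n <= m. *)
Definition interp th m n : R := th ^+ n / (th ^+ n + th ^+ m).

Lemma interp_gt0 th m n : 0 < th -> 0 < interp th m n.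
Proof. by move=> t0; rewrite divr_gt0 ?addr_gt0 ?exprn_gt0. Qed.

Lemma interp_le1 th m n : 0 < th -> interp th m n <= 1.
Proof.
by move=> t0; rewrite ler_pdivrMr ?addr_gt0 ?exprn_gt0// mul1r lerDl exprn_ge0// ltW.
Qed.

Lemma interp_le th m n : 0 < th -> (m <= n)%N -> interp th m n <= th ^+ (n - m).
Proof.
move=> t0 mn; rewrite ler_pdivrMr ?addr_gt0 ?exprn_gt0// mulrDr -[X in _ + X]exprD subnK//.
by rewrite lerDr mulr_ge0 ?exprn_ge0 ?ltW.
Qed.

Lemma interp_ge th m k : 0 < th < 1 -> (k <= m)%N -> 2^-1 <= interp th m k.
Proof.
move=> /andP[t0 t1] km; rewrite ler_pdivlMr ?addr_gt0 ?exprn_gt0//.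
have : th ^+ m <= th ^+ k by rewrite ler_wiXn2l ?ltW.
lra.
Qed.

(** Abel summation against the decrements of [beta]: on the indicator of n <= m, with n <= M, it
    returns beta n. *)
Definition layer beta M (h : nat -> R) :=
  \sum_(m < M) (beta m - beta m.+1) * h m + beta M * h M.

Lemma layer_lower beta th M k : weight beta -> 0 < th < 1 -> (k <= M)%N ->
  beta k / 2 <= layer beta M (fun m => interp th m k).
Proof.
move=> [b0 bd _] th01 kM; have /andP[t0 t1] := th01; rewrite /layer.
suff : beta k / 2 <= \sum_(m < M) (beta m - beta m.+1) * interp th m k + beta M / 2.
  move=> h; apply: le_trans h _; rewrite lerD2l ler_pM2l//; exact: interp_ge.
have dm m : 0 <= beta m - beta m.+1 by rewrite subr_ge0 bd.
have base : beta k / 2 <= \sum_(m < k) (beta m - beta m.+1) * interp th m k + beta k / 2.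
  by rewrite lerDr sumr_ge0// => m _; rewrite mulr_ge0// ltW// interp_gt0.
rewrite -(subnKC kM); elim: (M - k)%N => [|i IH]; first by rewrite addn0.
apply: le_trans IH _; rewrite addnS big_ord_recr /=.
have := dm (k + i)%N; have := interp_ge th01 (leq_addr i k).
set D := _ - beta _ => h1 h2; have : beta (k + i)%N = D + beta (k + i).+1 by rewrite /D subrK.
nra.
Qed.

(** Terms with m >= n telescope to at most beta n. For m < n the sum of beta m * th^(n-m) remains;
    doubling handles m >= n / 2, and slow decay of [beta] handles smaller m. *)
Lemma layer_upper beta th : weight beta -> doubling beta -> 0 < th < 1 ->
  exists2 K, 0 < K & forall M n, (n <= M)%N -> layer beta M (fun m => interp th m n) <= K * beta n.
Proof.
move=> [b0 bd bl] Db th01; have /andP[t0 t1] := th01.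
have [K2 K20 HK2] := Db 2 isT.
(* Half of the decay th^(n-m) = ta^(n-m) ta^(n-m) is spent on comparing beta m with beta n, the
   other half on summing. For m < n / 2 the first half is at most y^n, where y^2 = ta. *)
pose ta := Num.sqrt th; have ta2 : ta ^+ 2 = th by rewrite sqr_sqrtr// ltW.
have ta0 : 0 < ta by rewrite sqrtr_gt0.
have ta1 : ta < 1 by rewrite -sqrtr1 ltr_sqrt.
pose y := Num.sqrt ta; have y2 : y ^+ 2 = ta by rewrite sqr_sqrtr// ltW.
have y0 : 0 < y by rewrite sqrtr_gt0.
have y1 : y < 1 by rewrite -sqrtr1 ltr_sqrt.
have [c c0 Hc] := bl y ltac:(by rewrite y0).
pose D := K2 + beta 0%N / c.
have bc : 0 < beta 0%N / c by rewrite divr_gt0.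
have D0 : 0 < D by rewrite addr_gt0.
have claim m n : (m <= n)%N -> beta m * ta ^+ (n - m) <= D * beta n.
  move=> mn; rewrite mulrDl; have [h|h] := leqP (n %/ 2) m.
    apply: (@le_trans _ _ (K2 * beta n)); last by rewrite lerDl mulr_ge0// ltW.
    apply: (@le_trans _ _ (beta m)); first by rewrite ler_piMr ?exprn_ile1 ?(ltW ta0) ?(ltW ta1)// ltW.
    by apply: le_trans (HK2 n); exact: bd.
  apply: (@le_trans _ _ (beta 0%N / c * beta n)); last by rewrite lerDr mulr_ge0// ltW.
  apply: (@le_trans _ _ (beta 0%N * y ^+ n)).
    apply: ler_pM; rewrite ?exprn_ge0 ?(ltW (b0 m)) ?(ltW ta0) ?bd//.
    have nm : (n <= 2 * (n - m))%N by clear - h; lia.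
    by rewrite -y2 -exprM ler_wiXn2l ?(ltW y0) ?(ltW y1).
  by rewrite -mulrA ler_pM2l// ler_pdivlMl// Hc.
exists (D / (1 - ta) + 1); first by rewrite addr_gt0// divr_gt0// subr_gt0.
move=> M n nM; rewrite /layer.
have dm m : 0 <= beta m - beta m.+1 by rewrite subr_ge0 bd.
apply: (@le_trans _ _ (\sum_(m < M) (beta m - beta m.+1) * interp th m n + beta M)).
  by rewrite lerD2l ler_piMr ?interp_le1// ltW.
apply: (@le_trans _ _ (\sum_(m < n) (beta m - beta m.+1) * interp th m n + beta n)).
  rewrite -(subnKC nM); elim: (M - n)%N => [|i IH]; first by rewrite addn0.
  apply: le_trans IH; rewrite addnS big_ord_recr /= -addrA lerD2l.
  rewrite -lerBrDr ler_piMr//; exact: interp_le1.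
rewrite mulrDl mul1r lerD2r.
apply: (@le_trans _ _ (\sum_(m < n) D * beta n * ta ^+ (n - m))).
  apply: ler_sum => m _; have mn : (m <= n)%N by exact: ltnW.
  apply: (@le_trans _ _ (beta m * (ta ^+ (n - m) * ta ^+ (n - m)))).
    apply: ler_pM => //; first by rewrite ltW// interp_gt0.
      by rewrite gerBl ltW.
    by rewrite -expr2 -exprM mulnC exprM ta2 interp_le.
  by rewrite mulrA ler_wpM2r ?exprn_ge0 ?(ltW ta0)// claim.
rewrite -mulr_sumr [leRHS]mulrAC ler_pM2l ?mulr_gt0//.
rewrite (reindex_inj rev_ord_inj) /=.
apply: (@le_trans _ _ (\sum_(0 <= i < n) ta ^+ i)).
  rewrite big_mkord; apply: ler_sum => i _.
  by rewrite ler_wiXn2l ?(ltW ta0) ?(ltW ta1)// subKn// leqnSn.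
have := geo_sum_le 0 n (ltac:(by rewrite (ltW ta0)) : 0 <= ta < 1).
by rewrite expr0 mul1r.
Qed.

(* [l^2] is split at each level [m] into a part measured without weight and a part measured with
   the weight [th^n]; [star] for the trivial weight controls the first, [angular] the second. *)
Lemma interp_star phi : analytic_selfmap phi -> star (fun=> 1) phi -> angular phi ->
  exists2 th, 0 < th < 1 & forall e, 0 < e -> exists N, forall a d b, (forall n, (n < N)%N -> a n = 0) ->
  coefs (fun z => \sum_(n < d) a n * phi z ^+ n) b -> forall m J,
  \sum_(k < J) interp th m k * cabs (b k) ^+ 2 <= e * \sum_(n < d) interp th m n * cabs (a n) ^+ 2.
Proof.
move=> Hphi Hs Ha; have [La La0 HLa] := angular_M2 Hphi Ha.
have [r0 r01 HM] := HLa 2 isT; have /andP[rp r1] := r01.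
pose th := r0 ^+ 2.
have t0 : 0 < th by exact: exprn_gt0.
have t1 : th < 1 by rewrite exprn_ilt1// ltW.
have t01 : 0 <= th < 1 by rewrite t1 ltW.
exists th => [|e e0]; first by rewrite t0.
have [N1 HN1] := Hs e e0; have [N2 HN2] := expr_small t01 (divr_gt0 e0 La0).
exists (maxn N1 N2) => a d b aN cb m J.
have p0 n : 0 < th ^+ n by exact: exprn_gt0.
have s0 n : 0 < th ^+ n + th ^+ m by exact: addr_gt0.
pose h n := interp th m n.
have h0 n : 0 <= h n by rewrite ltW// interp_gt0.
have h1 n : 0 <= 1 - h n by rewrite subr_ge0 interp_le1.
(* The minimising splitting for [interp]: with h its value, h^2 + th^(n-m) (1 - h)^2 = h, so no
   constant is lost. *)
pose a0 n : C := (h n)%:C%C * a n; pose a1 n : C := (1 - h n)%:C%C * a n.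
have an (c : nat -> C) : analytic_disc (fun z => \sum_(n < d) c n * phi z ^+ n).
  exact: (analytic_selfmap_comp Hphi (@poly_analytic R d c)).
have [q0 hq0] := analytic_coefs (an a0); have [q1 hq1] := analytic_coefs (an a1).
have bE k : b k = q0 k + q1 k.
  have h2 : coefs (fun z => \sum_(n < d) a n * phi z ^+ n) (fun k => q0 k + q1 k).
    apply: eq_coefs (coefsD hq0 hq1) => z _; rewrite -big_split /=; apply: eq_bigr => n _.
    by rewrite -mulrDl -mulrDl -rmorphD /= addrC subrK mul1r.
  exact: (coefs_inj cb h2).
have ca0 n : cabs (a0 n) ^+ 2 = h n ^+ 2 * cabs (a n) ^+ 2.
  by rewrite cabsM cabs_real ger0_norm// exprMn.
have ca1 n : cabs (a1 n) ^+ 2 = (1 - h n) ^+ 2 * cabs (a n) ^+ 2.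
  by rewrite cabsM cabs_real ger0_norm// exprMn.
have E0 : \sum_(k < J) cabs (q0 k) ^+ 2 <= e * \sum_(n < d) h n ^+ 2 * cabs (a n) ^+ 2.
  have a0N n : (n < N1)%N -> a0 n = 0.
    by move=> nN; rewrite /a0 aN ?mulr0// (leq_trans nN)// leq_maxl.
  have := HN1 a0 d q0 a0N hq0 J; under eq_bigr do rewrite mul1r.
  by under [X in _ <= _ * X]eq_bigr do rewrite mul1r ca0.
have E1 : \sum_(k < J) th ^+ k * cabs (q1 k) ^+ 2 <=
    e * \sum_(n < d) th ^+ n * ((1 - h n) ^+ 2 * cabs (a n) ^+ 2).
  have r01' : 0 <= r0 < 1 by rewrite r1 ltW.
  have := coefs_le_M2 hq1 r01' J; under eq_bigr do rewrite exprM mulrC.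
  move=> /le_trans; apply; apply: le_trans (HM r0 a1 d _) _; first by rewrite lexx.
  rewrite !mulr_sumr; apply: ler_sum => n _; rewrite ca1 exprM -/th mul2n -addnn exprD.
  have [nN|Nn] := ltnP n (maxn N1 N2); first by rewrite aN// cabs0 expr0n /= !(mulr0, mul0r).
  (* Exponent j = 2 produces th^(2n) where the weight is th^n; the spare th^n beats the constant
     [La]. *)
  have h2 : La * th ^+ n <= e.
    rewrite mulrC -ler_pdivlMr// ltW// HN2//.
    by rewrite (leq_trans _ Nn)// leq_maxr.
  have h3 : 0 <= th ^+ n * ((1 - h n) ^+ 2 * cabs (a n) ^+ 2).
    apply: mulr_ge0; first exact: ltW.
    by apply: mulr_ge0; exact: sqr_ge0.
  have := ler_wpM2r h3 h2; congr (_ <= _); ring.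
apply: (@le_trans _ _ (\sum_(k < J) (cabs (q0 k) ^+ 2 + th ^- m * (th ^+ k * cabs (q1 k) ^+ 2)))).
  apply: ler_sum => k _; rewrite bE /interp.
  have b1 : cabs (q0 k + q1 k) ^+ 2 <= (cabs (q0 k) + cabs (q1 k)) ^+ 2.
    by rewrite lerXn2r ?nnegrE ?addr_ge0 ?cabs_ge0 ?ler_cabsD.
  rewrite mulrAC ler_pdivrMr//; apply: (@le_trans _ _ (th ^+ k * (cabs (q0 k) + cabs (q1 k)) ^+ 2)).
    by rewrite ler_pM2l.
  move: (cabs (q0 k)) (cabs (q1 k)) (th ^+ k) (th ^+ m) (p0 k) (p0 m) => {b1}x y W S W0 S0.
  (* For any splitting, |x + y|^2 W / (W + S) <= x^2 + y^2 W / S, the defect being a square. *)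
  have E : (x ^+ 2 + S^-1 * (W * y ^+ 2)) * (W + S) - W * (x + y) ^+ 2 = (S * x - W * y) ^+ 2 / S.
    by field; rewrite gt_eqF.
  by rewrite -subr_ge0 E; apply: divr_ge0; [exact: sqr_ge0|exact: ltW].
rewrite big_split /= -mulr_sumr.
apply: le_trans (lerD E0 (ler_wpM2l _ E1)) _; first by rewrite invr_ge0 ltW.
rewrite mulrCA -mulrDr ler_pM2l// mulr_sumr -big_split /=; apply: ler_sum => n _.
rewrite /h /interp le_eqVlt; apply/orP; left; apply/eqP.
move: (cabs (a n) ^+ 2) (th ^+ n) (th ^+ m) (p0 n) (p0 m) => X W S W0 S0.
field; rewrite !gt_eqF//; exact: addr_gt0.
Qed.

(** [interp_star] is uniform in m, so it can be summed over m against the decrements of [beta];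
    [layer_lower] and [layer_upper] return to [beta] at the cost of the factors 2 and K. *)
Lemma star_transfer beta phi : weight beta -> doubling beta -> analytic_selfmap phi ->
  star (fun=> 1) phi -> angular phi -> star beta phi.
Proof.
move=> Wb Db Hphi Hs Ha e e0; have [b0 bd bl] := Wb.
have [th th01 Hth] := interp_star Hphi Hs Ha; have /andP[t0 t1] := th01.
have [K K0 HK] := layer_upper Wb Db th01.
have e1 : 0 < e / (2 * K) by rewrite divr_gt0// mulr_gt0.
have [N HN] := Hth _ e1; exists N => a d b aN cb J; pose M := maxn d J.
have dm m : 0 <= beta m - beta m.+1 by rewrite subr_ge0 bd.
have swap L (c : nat -> C) : \sum_(n < L) layer beta M (fun m => interp th m n) * cabs (c n) ^+ 2 =
    layer beta M (fun m => \sum_(n < L) interp th m n * cabs (c n) ^+ 2).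
  rewrite /layer mulr_sumr; under [in RHS]eq_bigr do rewrite mulr_sumr.
  rewrite exchange_big -big_split /=; apply: eq_bigr => n _.
  by rewrite mulrDl mulr_suml mulrA; congr (_ + _); apply: eq_bigr => m _; rewrite mulrA.
have h1 : \sum_(k < J) beta k / 2 * cabs (b k) ^+ 2 <=
    layer beta M (fun m => \sum_(k < J) interp th m k * cabs (b k) ^+ 2).
  rewrite -swap; apply: ler_sum => k _; rewrite ler_wpM2r ?sqr_ge0//.
  by apply: layer_lower => //; rewrite (leq_trans (ltnW (ltn_ord k)))// leq_maxr.
have h2 : layer beta M (fun m => \sum_(k < J) interp th m k * cabs (b k) ^+ 2) <=
    e / (2 * K) * layer beta M (fun m => \sum_(n < d) interp th m n * cabs (a n) ^+ 2).
  rewrite /layer mulrDr; apply: lerD.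
    by rewrite [leRHS]mulr_sumr; apply: ler_sum => m _; rewrite mulrCA ler_wpM2l// HN.
  by rewrite mulrCA ler_pM2l// HN.
have h3 : layer beta M (fun m => \sum_(n < d) interp th m n * cabs (a n) ^+ 2) <=
    K * \sum_(n < d) beta n * cabs (a n) ^+ 2.
  rewrite -swap [leRHS]mulr_sumr; apply: ler_sum => n _; rewrite [leRHS]mulrA ler_wpM2r ?sqr_ge0//.
  by apply: HK; rewrite (leq_trans (ltnW (ltn_ord n)))// leq_maxl.
have := le_trans h1 (le_trans h2 (ler_wpM2l (ltW e1) h3)).
under eq_bigr do rewrite mulrAC; rewrite -mulr_suml ler_pdivrMr//.
move=> /le_trans; apply; rewrite le_eqVlt; apply/orP; left; apply/eqP.
by field; rewrite gt_eqF.
Qed.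

End Transfer.

(** * The unweighted Bergman space and the conclusion *)

Section Final.
Variable R : realType.
Local Notation C := (R[i]).
Local Notation mu := (@lebesgue_measure R).
Implicit Types (a b : nat -> C) (phi : C -> C) (sigma : R -> R).
Implicit Types (N d J k n m : nat).

Section Moments.
Variable sigma : R -> R.
Hypothesis cs : {within `[0, 1[%classic, continuous sigma}.
Hypothesis s_gt0 : forall r, 0 <= r < 1 -> 0 < sigma r.
Hypothesis s_int : mu.-integrable `[0, 1[%classic (EFin \o sigma).

Lemma moment_sum (c : nat -> R) (e : nat -> nat) d :
  mu.-integrable `[0, 1[%classic
    (EFin \o (fun r => \sum_(n < d) c n * (2 * r ^+ (2 * e n).+1 * sigma r))) /\
  \int[mu]_(r in `[0, 1[) (\sum_(n < d) c n * (2 * r ^+ (2 * e n).+1 * sigma r)) =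
  \sum_(n < d) c n * beta sigma (e n).
Proof.
have wi n := weight_integrable cs s_gt0 s_int (2 * e n).+1.

elim: d => [|d [IHi IHe]].
  rewrite (_ : (fun r => _) = (fun=> 0)); last by apply/funext => r; rewrite big_ord0.
  by split; [exact: integrable0|rewrite big_ord0 Rintegral_cst// mul0r].
have ci : mu.-integrable `[0, 1[%classic
    (EFin \o (fun r => c d * (2 * r ^+ (2 * e d).+1 * sigma r))).
  have := @integrableZl _ _ _ mu _ (measurable_itv `[0%R, 1%R[) (c d) _ (wi d).
  by apply: eq_integrable => // r _; rewrite /= EFinM.
rewrite (_ : (fun r => _) = (fun r => (\sum_(n < d) c n * (2 * r ^+ (2 * e n).+1 * sigma r)) +
    c d * (2 * r ^+ (2 * e d).+1 * sigma r))); last by apply/funext => r; rewrite big_ord_recr.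
split.
  by have := @integrableD _ _ _ mu _ (measurable_itv `[0%R, 1%R[) _ _ IHi ci; apply: eq_integrable => // r _; rewrite /= EFinD.
rewrite big_ord_recr /= RintegralD// IHe; congr (_ + _).
by rewrite (@RintegralZl _ _ _ mu _ _ (c d) (measurable_itv `[0%R, 1%R[) (wi d)).
Qed.

(** The inequality is multiplied by 2 r sigma r and integrated, so that r^(2k) becomes beta k; [e]
    carries the dilated exponents. *)
Lemma moment_le (A B : nat -> R) (e : nat -> nat) (D : R) J d :
  (forall r, 0 <= r < 1 ->
    \sum_(k < J) A k * r ^+ (2 * k) <= \sum_(n < d) B n * r ^+ (2 * e n) + D) ->
  \sum_(k < J) A k * beta sigma k <= \sum_(n < d) B n * beta sigma (e n) + D * beta sigma 0.
Proof.
move=> H.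
have [i1 <-] := moment_sum A id J; have [i2 <-] := moment_sum B e d.
have [i3 /esym] := moment_sum (fun=> D) (fun=> 0%N) 1; rewrite big_ord1 => ->.
rewrite -RintegralD//; apply: le_Rintegral => //.
  have := @integrableD _ _ _ mu _ (measurable_itv `[0%R, 1%R[) _ _ i2 i3; apply: eq_integrable => // r _; by rewrite /= EFinD.
move=> r; rewrite /= in_itv /= => r01; have /andP[r0 r1] := r01.
have h0 : 0 <= 2 * r * sigma r by rewrite !mulr_ge0// ltW// s_gt0.
have E (F : nat -> R) (u : nat -> nat) L : (\sum_(n < L) F n * r ^+ (2 * u n)) * (2 * r * sigma r) =
    \sum_(n < L) F n * (2 * r ^+ (2 * u n).+1 * sigma r).
  by rewrite mulr_suml; apply: eq_bigr => n _; rewrite (exprS r); ring.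
have := ler_wpM2r h0 (H r r01); rewrite (mulrDl _ D) (E B e).
have /= -> := E A id J.
rewrite big_ord1; exact.
Qed.

End Moments.

(** After integration the n-th squared coefficient carries beta (j n) = 1 / (j n + 1) and an
    exponentially small r0^(2 j n) instead of 1 / (n + 1); j large makes the first small, n large
    the second. *)
Lemma angular_star_one phi : analytic_selfmap phi -> angular phi ->
  star (beta ((fun=> 1) : R -> R)) phi.
Proof.
move=> Hphi Ha e e0; have [La La0 HLa] := angular_M2 Hphi Ha.
pose eta := e / (2 * La); have eta0 : 0 < eta by rewrite divr_gt0// mulr_gt0.
(* For n >= 1, n + 1 <= 2 n <= eta j n, so 1 / (j n + 1) <= eta / (n + 1). *)
pose j := (Num.truncn (2 / eta)).+1.
have j0 : 2 / eta < j%:R by exact: truncnS_gt.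
have [r0 /andP[rp r1] HM] := HLa j isT.
pose y := (1 + r0) / 2; have y01 : 0 <= y < 1 by rewrite /y; lra.
have ry : 0 <= r0 < y by rewrite /y; lra.
have [K K0 HK] := natr_geo ry.
have K1 : 0 < K + 1 by lra.
have [N0 HN0] := expr_small y01 (divr_gt0 eta0 K1).
(* Index 0 is excluded because there 1 / (j n + 1) shows no gain. *)
exists (maxn 1 N0) => a d b aN cb J.
pose F r := \sum_(k < J) cabs (b k) ^+ 2 * r ^+ (2 * k).
have HF r : r0 <= r < 1 -> F r <= \sum_(n < d) La * cabs (a n) ^+ 2 * r ^+ (2 * (j * n)).
  move=> /andP[rr r_lt1]; apply: (@le_trans _ _ (M2 r (fun z => \sum_(n < d) a n * phi z ^+ n))).
    by apply: coefs_le_M2 => //; rewrite r_lt1 (le_trans _ rr)// ltW.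
  apply: le_trans (HM r a d _) _; first by rewrite rr.
  by rewrite mulr_sumr; apply: ler_sum => n _; rewrite mulrA.
pose D := \sum_(n < d) La * cabs (a n) ^+ 2 * r0 ^+ (2 * (j * n)).
have La2 n : 0 <= La * cabs (a n) ^+ 2 by rewrite mulr_ge0 ?sqr_ge0 ?ltW.
have D0 : 0 <= D by apply: sumr_ge0 => n _; rewrite mulr_ge0// exprn_ge0// ltW.
have Hall r : 0 <= r < 1 ->
    F r <= \sum_(n < d) La * cabs (a n) ^+ 2 * r ^+ (2 * (j * n)) + D.
  move=> /andP[rp' r1'].
  have [h|h] := leP r0 r; first by apply: le_trans (HF r _) _; [rewrite h|rewrite lerDl].
  apply: (@le_trans _ _ (F r0)).
    apply: ler_sum => k _; rewrite ler_wpM2l ?sqr_ge0// lerXn2r ?nnegrE// ltW//.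
  apply: le_trans (HF r0 _) _; first by rewrite lexx.
  by rewrite lerDr sumr_ge0// => n _; rewrite mulr_ge0// exprn_ge0.
have := @moment_le _ (@within_one R) (fun _ _ => ltr01) (@integrable_one R)
  (fun k => cabs (b k) ^+ 2) (fun n => La * cabs (a n) ^+ 2) (fun n => j * n)%N D J d Hall.
rewrite beta_one invr1 mulr1; under eq_bigr do rewrite mulrC.
move=> /le_trans; apply; rewrite /D -big_split /= mulr_sumr; apply: ler_sum => n _.
have [nN|Nn] := ltnP n (maxn 1 N0); first by rewrite aN// cabs0 expr0n /= !(mulr0, mul0r) addr0.
have n0 : (0 < n)%N by rewrite (leq_trans _ Nn)// leq_maxl.
have nN0 : (N0 <= n)%N by rewrite (leq_trans _ Nn)// leq_maxr.
rewrite -mulrDr !beta_one [leLHS]mulrAC [leRHS]mulrA ler_wpM2r ?sqr_ge0//.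
have p1 : 0 < n.+1%:R :> R by rewrite ltr0n.
have h1 : (j * n).+1%:R^-1 <= eta / n.+1%:R.
  rewrite ler_pdivlMr// mulrC ler_pdivrMr ?ltr0n//.
  move: j0; rewrite ltr_pdivrMr// -(natr1 n) -(natr1 (j * n)) natrM => j0.
  have n1 : 1 <= n%:R :> R by rewrite ler1n.
  have : 2 * n%:R <= j%:R * eta * n%:R by rewrite ler_wpM2r// ltW.
  move: n1 eta0; clear; nra.
have h2 : r0 ^+ (2 * (j * n)) <= eta / n.+1%:R.
  apply: (@le_trans _ _ (r0 ^+ n)).
    have jn : (n <= 2 * (j * n))%N.
      by rewrite (@leq_trans (j * n))// leq_pmull.
    by rewrite ler_wiXn2l// ltW.
  rewrite ler_pdivlMr// -natr1 mulrDr mulr1 mulrC.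
  have h3 : r0 ^+ n <= y ^+ n by rewrite lerXn2r ?nnegrE ?(ltW rp)//; rewrite /y; lra.
  have := HN0 n nN0; rewrite ltr_pdivlMr// => h4.
  have := HK n; move: h3 h4; clear; lra.
have -> : e / n.+1%:R = La * (eta / n.+1%:R + eta / n.+1%:R).
  rewrite /eta; move: (n.+1%:R : R) p1 {h1 h2} => q q0.
  by field; rewrite !gt_eqF.
by rewrite ler_pM2l// lerD.
Qed.

Lemma weight_one : weight ((fun=> 1) : nat -> R).
Proof.
split=> // y /andP[y0 y1]; exists 1 => // n.
by rewrite mul1r exprn_ile1// ltW.
Qed.

Lemma hardy_coef_norm : coef_norm (fun=> 1) (@hardy_sq R).
Proof. by move=> f a fa; split; [exact: hardy_ge0 fa|move=> M; exact: hardyP]. Qed.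

Lemma bergman_weight sigma : {within `[0, 1[%classic, continuous sigma} ->
  (forall r, 0 <= r < 1 -> 0 < sigma r) ->
  mu.-integrable `[0, 1[%classic (EFin \o sigma) ->
  weight (beta sigma) /\ coef_norm (beta sigma) (bergman_sq sigma).
Proof.
move=> cs s0 si; split; first by split; [exact: beta_gt0|exact: beta_dec|exact: beta_lower].
by move=> f a fa; split; [exact: bergman_ge0 fa|move=> M; exact: bergmanP].
Qed.

End Final.

Theorem theorem3p2 (R : realType) (phi : R[i] -> R[i]) (sigma : R -> R) :
  analytic_selfmap phi ->
  {within `[0, 1[%classic, continuous sigma} ->
  (forall r, 0 <= r < 1 -> 0 < sigma r) ->
  lebesgue_measure.-integrable `[0, 1[%classic (EFin \o sigma) ->
  I_admissible (omega_sigma sigma) ->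
  (comp_compact (@hardy_space R) (@hardy_sq R) phi ->
     comp_compact (bergman_space sigma) (bergman_sq sigma) phi) /\
  (comp_compact (bergman_space sigma) (bergman_sq sigma) phi ->
     comp_compact (bergman_space (fun _ => 1)) (bergman_sq (fun _ => 1)) phi /\
     (forall M : R, exists2 delta : R, 0 < delta < 1 &
        forall z : R[i], 1 - delta < cabs z < 1 ->
          M < (1 - cabs (phi z)) / (1 - cabs z))).
Proof.
move=> Hphi cs s0 si [w0 [_ [_ [_ [[dl [dl0 W2]] _]]]]].
have [Wb Nb] := bergman_weight cs s0 si.
have [W1 N1] := bergman_weight (@within_one R) (fun _ _ => ltr01) (@integrable_one R).
have Db : doubling (beta sigma).
  have Q0 : 0 < 2 `^ (1 + dl) :> R by rewrite powR_gt0.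
  apply: (doubling_of_double Q0); [exact: beta_gt0|exact: beta_dec|].
  by apply: beta_double => // r r01; rewrite ltW// w0.
split=> Hc.
  have S1 := compact_star (weight_one R) (@hardy_coef_norm R) (fun f => iff_refl _) Hphi Hc.
  have Ha := star_angular (weight_one R) (@doubling_one R) Hphi S1.
  exact: (star_compact Wb Nb (fun f => iff_refl _) Hphi (star_transfer Wb Db Hphi S1 Ha)).
have Ha := star_angular Wb Db Hphi (compact_star Wb Nb (fun f => iff_refl _) Hphi Hc).
split; last exact: angular_limit.
exact: (star_compact W1 N1 (fun f => iff_refl _) Hphi (angular_star_one Hphi Ha)).
Qed.
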